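(* Let $\mathbb K$ be a field. The bicategories $2\text{-Vect}^{\mathbb K}$ (matrices of finite-dimensional vector spaces) and $2\text{-}\mathcal Vect^{\mathbb K}$ (module categories module-equivalent to some $\mathcal A^n$) are equivalent: there exist 2-functors $F:2\text{-Vect}^{\mathbb K}\to2\text{-}\mathcal Vect^{\mathbb K}$ and $G:2\text{-}\mathcal Vect^{\mathbb K}\to2\text{-Vect}^{\mathbb K}$ with natural 2-isomorphisms from the two composites to the respective identity 2-functors.
   Context: 2-functors are (weak) pseudofunctors between bicategories. A natural 2-transformation $\psi:F\Rightarrow G$ consists of 1-morphisms $\psi^1_x:F(x)\to G(x)$ and natural transformations $\psi^2_{x,y}:F_{x,y}\diamond\psi^1_y\Rightarrow\psi^1_x\diamond G_{x,y}$ satisfying the standard coherence with composition and units; it is a natural 2-isomorphism if all $\psi^1_x$ are equivalences (quasi-invertible) and all $\psi^2_{x,y}$ are natural isomorphisms. Horizontal composition $\diamond$ is written left to right. $2\text{-Vect}^{\mathbb K}$: objects are natural numbers $n\in\mathbb N$ ($0\in\mathbb N$); the categories of 1-morphisms $n\to0$ and $0\to m$ are trivial (one object, one morphism); for $n,m>0$ the 1-morphisms $n\to m$ are $n\times m$ matrices $(V_{i,j})$ of finite-dimensional $\mathbb K$-vector spaces; 2-morphisms $(V_{i,j})\Rightarrow(W_{i,j})$ are matrices of linear maps $\varphi_{i,j}:V_{i,j}\to W_{i,j}$ composed entrywise; horizontal composition is $(V\diamond W)_{i,j}=\bigoplus_kV_{i,k}\otimes W_{k,j}$ on 1-morphisms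 and $(\bigoplus_k\varphi_{i,k}\otimes\psi_{k,j})$ on 2-morphisms; $\mathbf i_n$ has $\mathbb K$ on the diagonal and $0$ elsewhere; associativity and unit constraints come from those of $\otimes$. Let $\mathcal A^n$ be the category of finite-dimensional modules over the algebra $\mathbb K^n$ ($\mathcal A^0$ is the zero category); $\mathcal A^1$ is the monoidal category of finite-dimensional vector spaces. An $\mathcal A^1$-module category is a category $\mathcal C$ with an action bifunctor $\boxtimes:\mathcal C\times\mathcal A^1\to\mathcal C$ and the usual coherent associativity and unit isomorphisms; $\mathcal A^n$ is one via $M\boxtimes X=M\otimes_{\mathbb K}X$. A module functor $F:\mathcal C\to\mathcal D$ is a functor with natural morphisms $F_{M,X}:F(M\boxtimes X)\to F(M)\boxtimes X$ satisfying the usual pentagon and triangle conditions; it is strong if all $F_{M,X}$ are isomorphisms. A module natural transformation $\psi:F\Rightarrow G$ is a natural transformation with $G_{M,X}\circ\psi_{M\boxtimes X}=(\psi_M\boxtimes\mathrm{Id}_X)\circ F_{M,X}$. A module equivalence is an equivalence that is a strong module functor with a quasi-inverse that is a strong module functor. $2\text{-}\mathcal Vect^{\mathbb K}$: the 2-category whose objects are the $\mathcal A^1$-module categories module-equivalent to $\mathcal A^n$ for some $n\in\mathbb N$, whose 1-morphisms are $\mathcal A^1$-module functors, whose 2-morphisms are module natural transformations, with horizontal composition $F\diamond G:=G\circ F$ and $(F\diamond G)_{M,X}=G_{F(M),X}\circ G(F_{M,X})$. *)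

(* Defs.v *)
From HB Require Import structures.
From mathcomp Require Import all_boot all_order all_algebra.
From mathcomp Require Import boolp.

Set Implicit Arguments.
Unset Strict Implicit.
Unset Printing Implicit Defensive.

Import GRing.Theory.

Declare Scope cat_scope.
Delimit Scope cat_scope with cat.
Local Open Scope cat_scope.

Reserved Notation "f \dia g" (at level 40, left associativity).
Reserved Notation "a \Dia b" (at level 40, left associativity).
Reserved Notation "x \ten y" (at level 40, left associativity).
Reserved Notation "f \Ten g" (at level 40, left associativity).
Reserved Notation "M \box X" (at level 40, left associativity).
Reserved Notation "f \Box g" (at level 40, left associativity).

Record category := Category {
  Ob :> Type;
  mor : Ob -> Ob -> Type;
  idm : forall x, mor x x;
  vcomp : forall x y z, mor y z -> mor x y -> mor x z;
  comp1m : forall x y (f : mor x y), vcomp (idm y) f = f;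
  compm1 : forall x y (f : mor x y), vcomp f (idm x) = f;
  compA : forall x y z t (h : mor z t) (g : mor y z) (f : mor x y),
    vcomp h (vcomp g f) = vcomp (vcomp h g) f }.

Arguments mor {c} x y : rename.
Arguments idm {c} x : rename.
Arguments vcomp {c x y z} g f : rename.
Arguments comp1m {c x y} f : rename.
Arguments compm1 {c x y} f : rename.
Arguments compA {c x y z t} h g f : rename.

Notation "g \o f" := (vcomp g f) : cat_scope.

Record iso (C : category) (x y : C) := Iso {
  fwd :> mor x y;
  bwd : mor y x;
  bwdK : bwd \o fwd = idm x;
  fwdK : fwd \o bwd = idm y }.

Definition is_iso (C : category) (x y : C) (f : mor x y) : Prop :=
  exists g : mor y x, g \o f = idm x /\ f \o g = idm y.

Definition prod_category (C D : category) : category.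
Proof.
refine (@Category (C * D) (fun p q => (mor p.1 q.1 * mor p.2 q.2)%type)
  (fun p => (idm p.1, idm p.2))
  (fun p q r g f => (g.1 \o f.1, g.2 \o f.2)) _ _ _).
- by move=> p q [f g] /=; rewrite !comp1m.
- by move=> p q [f g] /=; rewrite !compm1.
- by move=> p q r s [h h'] [g g'] [f f'] /=; rewrite !compA.
Defined.

Record functor (C D : category) := Functor {
  fob :> C -> D;
  fmap : forall x y, mor x y -> mor (fob x) (fob y);
  fmap1 : forall x, fmap (idm x) = idm (fob x);
  fmapM : forall x y z (g : mor y z) (f : mor x y),
    fmap (g \o f) = fmap g \o fmap f }.

Arguments fmap {C D} F {x y} f : rename.
Arguments fmap1 {C D} F x : rename.
Arguments fmapM {C D} F {x y z} g f : rename.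

Definition bimap (C D E : category) (F : functor (prod_category C D) E)
    (x x' : C) (y y' : D) (f : mor x x') (g : mor y y') :
    mor (F (x, y)) (F (x', y')) :=
  @fmap _ _ F (x, y) (x', y') (f, g).
Arguments bimap {C D E} F {x x' y y'} f g : rename.

Lemma bimap1 C D E (F : functor (prod_category C D) E) (x : C) (y : D) :
  bimap F (idm x) (idm y) = idm (F (x, y)).
Proof. exact: (fmap1 F (x, y)). Qed.

Lemma bimapM C D E (F : functor (prod_category C D) E) (x x' x'' : C)
    (y y' y'' : D) (f' : mor x' x'') (f : mor x x')
    (g' : mor y' y'') (g : mor y y') :
  bimap F (f' \o f) (g' \o g) = bimap F f' g' \o bimap F f g.
Proof.
exact: (@fmapM _ _ F (x, y) (x', y') (x'', y'') (f', g') (f, g)).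
Qed.

Lemma bimapMl C D E (F : functor (prod_category C D) E) (x x' x'' : C)
    (y : D) (f' : mor x' x'') (f : mor x x') :
  bimap F (f' \o f) (idm y) = bimap F f' (idm y) \o bimap F f (idm y).
Proof. by rewrite -bimapM comp1m. Qed.

Lemma bimapMr C D E (F : functor (prod_category C D) E) (x : C)
    (y y' y'' : D) (g' : mor y' y'') (g : mor y y') :
  bimap F (idm x) (g' \o g) = bimap F (idm x) g' \o bimap F (idm x) g.
Proof. by rewrite -bimapM comp1m. Qed.

Definition id_functor (C : category) : functor C C :=
  @Functor C C (fun x => x) (fun _ _ f => f)
    (fun _ => erefl) (fun _ _ _ _ _ => erefl).

Definition comp_functor (C D E : category) (G : functor D E) (F : functor C D) :
  functor C E.
Proof.
refine (@Functor C E (fun x => G (F x)) (fun _ _ f => fmap G (fmap F f)) _ _).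
- by move=> x; rewrite !fmap1.
- by move=> x y z g f; rewrite !fmapM.
Defined.

Record nat_trans (C D : category) (F G : functor C D) := NatTrans {
  ncomp :> forall x : C, mor (F x) (G x);
  natural : forall (x y : C) (f : mor x y),
    ncomp y \o fmap F f = fmap G f \o ncomp x }.

Definition is_nat_iso C D (F G : functor C D) (a : nat_trans F G) : Prop :=
  forall x, is_iso (a x).

Definition quasi_inverse C D (F : functor C D) (G : functor D C) : Prop :=
  (exists a : nat_trans (comp_functor G F) (id_functor C), is_nat_iso a) /\
  (exists b : nat_trans (comp_functor F G) (id_functor D), is_nat_iso b).

Lemma iso_is_iso (C : category) (x y : C) (f : iso x y) : is_iso f.
Proof. by exists (bwd f); rewrite bwdK fwdK. Qed.

Definition id_iso (C : category) (x : C) : iso x x :=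
  @Iso C x x (idm x) (idm x) (comp1m _) (comp1m _).

Definition comp_iso (C : category) (x y z : C) (g : iso y z) (f : iso x y) :
  iso x z.
Proof.
apply: (@Iso C x z (g \o f) (bwd f \o bwd g)).
- by rewrite compA -(compA (bwd f)) bwdK compm1 bwdK.
- by rewrite compA -(compA (fwd g)) fwdK compm1 fwdK.
Defined.

Definition fmap_iso (C D : category) (F : functor C D) (x y : C) (f : iso x y) :
  iso (F x) (F y).
Proof.
apply: (@Iso D (F x) (F y) (fmap F f) (fmap F (bwd f))).
- by rewrite -fmapM bwdK fmap1.
- by rewrite -fmapM fwdK fmap1.
Defined.

(** Horizontal composition is written from left to right: for [f : homcat x y]
    and [g : homcat y z], [f \dia g : homcat x z]. *)

Record bicategory := Bicategory {
  cell :> Type;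
  homcat : cell -> cell -> category;
  hcomp : forall x y z, functor (prod_category (homcat x y) (homcat y z)) (homcat x z);
  unit1 : forall x, homcat x x;
  assoc : forall x y z t (f : homcat x y) (g : homcat y z) (h : homcat z t),
    iso (hcomp x z t (hcomp x y z (f, g), h))
        (hcomp x y t (f, hcomp y z t (g, h)));
  lunit : forall x y (f : homcat x y), iso (hcomp x x y (unit1 x, f)) f;
  runit : forall x y (f : homcat x y), iso (hcomp x y y (f, unit1 y)) f;
  assoc_nat : forall x y z t (f f' : homcat x y) (g g' : homcat y z) (h h' : homcat z t)
    (a : mor f f') (b : mor g g') (c : mor h h'),
    assoc f' g' h' \o
      bimap (hcomp x z t) (bimap (hcomp x y z) a b) c =
    bimap (hcomp x y t) a (bimap (hcomp y z t) b c) \o assoc f g h;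
  lunit_nat : forall x y (f f' : homcat x y) (a : mor f f'),
    lunit f' \o bimap (hcomp x x y) (idm (unit1 x)) a = a \o lunit f;
  runit_nat : forall x y (f f' : homcat x y) (a : mor f f'),
    runit f' \o bimap (hcomp x y y) a (idm (unit1 y)) = a \o runit f;
  pentagon : forall x y z t u
    (f : homcat x y) (g : homcat y z) (h : homcat z t) (k : homcat t u),
    assoc f g (hcomp z t u (h, k)) \o assoc (hcomp x y z (f, g)) h k =
    bimap (hcomp x y u) (idm f) (assoc g h k) \o
      assoc f (hcomp y z t (g, h)) k \o
      bimap (hcomp x t u) (assoc f g h) (idm k);
  triangle : forall x y z (f : homcat x y) (g : homcat y z),
    bimap (hcomp x y z) (idm f) (lunit g) \o assoc f (unit1 y) g =
    bimap (hcomp x y z) (runit f) (idm g) }.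

Arguments homcat {b} x y : rename.
Arguments hcomp {b} x y z : rename.
Arguments unit1 {b} x : rename.
Arguments assoc {b x y z t} f g h : rename.
Arguments lunit {b x y} f : rename.
Arguments runit {b x y} f : rename.

Notation "f \dia g" := (hcomp _ _ _ (f, g)) : cat_scope.
Notation "a \Dia b" := (bimap (hcomp _ _ _) a b) : cat_scope.

Definition quasi_invertible (B : bicategory) (x y : B) (f : homcat x y) : Prop :=
  exists g : homcat y x,
    inhabited (iso (f \dia g) (unit1 x)) /\ inhabited (iso (g \dia f) (unit1 y)).

Record pseudofunctor (B B' : bicategory) := Pseudofunctor {
  pob :> B -> B';
  phom : forall x y, functor (homcat x y) (homcat (pob x) (pob y));
  phcomp : forall x y z (f : homcat x y) (g : homcat y z),
    iso (phom x y f \dia phom y z g) (phom x z (f \dia g));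
  punit : forall x, iso (unit1 (pob x)) (phom x x (unit1 x));
  phcomp_nat : forall x y z (f f' : homcat x y) (g g' : homcat y z)
    (a : mor f f') (b : mor g g'),
    phcomp f' g' \o (fmap (phom x y) a \Dia fmap (phom y z) b) =
    fmap (phom x z) (a \Dia b) \o phcomp f g;
  passoc : forall x y z t (f : homcat x y) (g : homcat y z) (h : homcat z t),
    fmap (phom x t) (assoc f g h) \o phcomp (f \dia g) h
      \o (phcomp f g \Dia idm (phom z t h)) =
    phcomp f (g \dia h) \o (idm (phom x y f) \Dia phcomp g h)
      \o assoc (phom x y f) (phom y z g) (phom z t h);
  plunit : forall x y (f : homcat x y),
    fmap (phom x y) (lunit f) \o phcomp (unit1 x) f
      \o (punit x \Dia idm (phom x y f)) =
    lunit (phom x y f);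
  prunit : forall x y (f : homcat x y),
    fmap (phom x y) (runit f) \o phcomp f (unit1 y)
      \o (idm (phom x y f) \Dia punit y) =
    runit (phom x y f) }.

Arguments phom {B B'} F {x y} : rename.
Arguments phcomp {B B'} F {x y z} f g : rename.
Arguments punit {B B'} F x : rename.

Section PseudofunctorWhiskering.
Variables (B B' : bicategory) (F : pseudofunctor B B') (x y z : B).

Lemma phcomp_natl (f f' : homcat x y) (g : homcat y z) (a : mor f f') :
  phcomp F f' g \o (fmap (phom F) a \Dia idm (phom F g)) =
  fmap (phom F) (a \Dia idm g) \o phcomp F f g.
Proof. by rewrite -phcomp_nat fmap1. Qed.

Lemma phcomp_natr (f : homcat x y) (g g' : homcat y z) (b : mor g g') :
  phcomp F f g' \o (idm (phom F f) \Dia fmap (phom F) b) =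
  fmap (phom F) (idm f \Dia b) \o phcomp F f g.
Proof. by rewrite -phcomp_nat fmap1. Qed.

End PseudofunctorWhiskering.

Definition id_pseudofunctor (B : bicategory) : pseudofunctor B B.
Proof.
apply: (@Pseudofunctor B B (fun x => x) (fun x y => id_functor (homcat x y))
  (fun x y z f g => id_iso (f \dia g)) (fun x => id_iso (unit1 x))) => /=.
- by move=> *; rewrite comp1m compm1.
- by move=> *; rewrite bimap1 !bimap1 !compm1 !comp1m.
- by move=> *; rewrite bimap1 !compm1.
- by move=> *; rewrite bimap1 !compm1.
Defined.

Definition comp_pseudofunctor (B B' B'' : bicategory)
  (G : pseudofunctor B' B'') (F : pseudofunctor B B') : pseudofunctor B B''.
Proof.
apply: (@Pseudofunctor B B'' (fun x => G (F x))
  (fun x y => comp_functor (phom G) (phom F))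
  (fun x y z f g =>
     comp_iso (fmap_iso (phom G) (phcomp F f g)) (phcomp G (phom F f) (phom F g)))
  (fun x => comp_iso (fmap_iso (phom G) (punit F x)) (punit G (F x)))) => /=.
- move=> x y z f f' g g' a b.
  by rewrite -compA phcomp_nat !compA -!fmapM phcomp_nat.
- move=> x y z t f g h.
  rewrite bimapMl !compA -[_ \o phcomp G _ _ \o bimap _ _ _]compA phcomp_natl.
  rewrite !compA -!fmapM passoc !fmapM.
  rewrite -[_ \o phcomp G _ _]compA -[X in X = _]compA passoc.
  rewrite bimapMr !compA -[_ \o phcomp G _ _ \o bimap _ _ _ in RHS]compA.
  by rewrite phcomp_natr !compA.
- move=> x y f.
  rewrite bimapMl !compA -[_ \o phcomp G _ _ \o bimap _ _ _]compA phcomp_natl.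
  by rewrite !compA -!fmapM plunit plunit.
- move=> x y f.
  rewrite bimapMr !compA -[_ \o phcomp G _ _ \o bimap _ _ _]compA phcomp_natr.
  by rewrite !compA -!fmapM prunit prunit.
Defined.

Record nat_2trans (B B' : bicategory) (F G : pseudofunctor B B') := Nat2Trans {
  psi1 :> forall x, homcat (F x) (G x);
  psi2 : forall x y (f : homcat x y),
    mor (phom F f \dia psi1 y) (psi1 x \dia phom G f);
  psi2_nat : forall x y (f f' : homcat x y) (a : mor f f'),
    psi2 f' \o (fmap (phom F) a \Dia idm (psi1 y)) =
    (idm (psi1 x) \Dia fmap (phom G) a) \o psi2 f;
  psi2_comp : forall x y z (f : homcat x y) (g : homcat y z),
    psi2 (f \dia g) \o (phcomp F f g \Dia idm (psi1 z)) =
    (idm (psi1 x) \Dia phcomp G f g)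
      \o assoc (psi1 x) (phom G f) (phom G g)
      \o (psi2 f \Dia idm (phom G g))
      \o bwd (assoc (phom F f) (psi1 y) (phom G g))
      \o (idm (phom F f) \Dia psi2 g)
      \o assoc (phom F f) (phom F g) (psi1 z);
  psi2_unit : forall x,
    psi2 (unit1 x) \o (punit F x \Dia idm (psi1 x)) =
    (idm (psi1 x) \Dia punit G x) \o bwd (runit (psi1 x)) \o lunit (psi1 x) }.

Arguments psi2 {B B' F G} n {x y} f : rename.

Definition is_nat_2iso B B' (F G : pseudofunctor B B') (psi : nat_2trans F G) :
    Prop :=
  (forall x, quasi_invertible (psi x)) /\
  (forall x y (f : homcat x y), is_iso (psi2 psi f)).

Record monoidal := Monoidal {
  mcat :> category;
  mten : functor (prod_category mcat mcat) mcat;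
  mone : mcat;
  massoc : forall x y z : mcat, iso (mten (mten (x, y), z)) (mten (x, mten (y, z)));
  mlunit : forall x : mcat, iso (mten (mone, x)) x;
  mrunit : forall x : mcat, iso (mten (x, mone)) x;
  massoc_nat : forall (x x' y y' z z' : mcat)
    (f : mor x x') (g : mor y y') (h : mor z z'),
    massoc x' y' z' \o bimap mten (bimap mten f g) h =
    bimap mten f (bimap mten g h) \o massoc x y z;
  mlunit_nat : forall (x x' : mcat) (f : mor x x'),
    mlunit x' \o bimap mten (idm mone) f = f \o mlunit x;
  mrunit_nat : forall (x x' : mcat) (f : mor x x'),
    mrunit x' \o bimap mten f (idm mone) = f \o mrunit x;
  mpentagon : forall x y z t : mcat,
    massoc x y (mten (z, t)) \o massoc (mten (x, y)) z t =
    bimap mten (idm x) (massoc y z t) \o massoc x (mten (y, z)) t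
      \o bimap mten (massoc x y z) (idm t);
  mtriangle : forall x y : mcat,
    bimap mten (idm x) (mlunit y) \o massoc x mone y =
    bimap mten (mrunit x) (idm y) }.

Arguments mone {m} : rename.
Arguments massoc {m} x y z : rename.
Arguments mlunit {m} x : rename.
Arguments mrunit {m} x : rename.

Notation "x \ten y" := (mten _ (x, y)) : cat_scope.
Notation "f \Ten g" := (bimap (mten _) f g) : cat_scope.

Record modcat (V : monoidal) := ModCat {
  mdcat :> category;
  mact : functor (prod_category mdcat V) mdcat;
  aassoc : forall (M : mdcat) (X Y : V),
    iso (mact (mact (M, X), Y)) (mact (M, X \ten Y));
  aunit : forall M : mdcat, iso (mact (M, mone)) M;
  aassoc_nat : forall (M M' : mdcat) (X X' Y Y' : V)
    (f : mor M M') (g : mor X X') (h : mor Y Y'),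
    aassoc M' X' Y' \o bimap mact (bimap mact f g) h =
    bimap mact f (g \Ten h) \o aassoc M X Y;
  aunit_nat : forall (M M' : mdcat) (f : mor M M'),
    aunit M' \o bimap mact f (idm mone) = f \o aunit M;
  apentagon : forall (M : mdcat) (X Y Z : V),
    aassoc M X (Y \ten Z) \o aassoc (mact (M, X)) Y Z =
    bimap mact (idm M) (massoc X Y Z) \o aassoc M (X \ten Y) Z
      \o bimap mact (aassoc M X Y) (idm Z);
  atriangle : forall (M : mdcat) (X : V),
    bimap mact (idm M) (mlunit X) \o aassoc M mone X =
    bimap mact (aunit M) (idm X) }.

Arguments aassoc {V m} M X Y : rename.
Arguments aunit {V m} M : rename.

Notation "M \box X" := (mact _ (M, X)) : cat_scope.
Notation "f \Box g" := (bimap (mact _) f g) : cat_scope.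

(** The structure morphisms [mstr] are not assumed to be invertible. *)
Record modfunctor (V : monoidal) (C D : modcat V) := ModFunctor {
  mfun :> functor C D;
  mstr : forall (M : C) (X : V), mor (mfun (M \box X)) (mfun M \box X);
  mstr_nat : forall (M M' : C) (X X' : V) (f : mor M M') (g : mor X X'),
    mstr M' X' \o fmap mfun (f \Box g) =
    (fmap mfun f \Box g) \o mstr M X;
  mstr_assoc : forall (M : C) (X Y : V),
    aassoc (mfun M) X Y \o (mstr M X \Box idm Y) \o mstr (M \box X) Y =
    mstr M (X \ten Y) \o fmap mfun (aassoc M X Y);
  mstr_unit : forall M : C,
    aunit (mfun M) \o mstr M mone = fmap mfun (aunit M) }.

Arguments mstr {V C D} F M X : rename.

Definition strong (V : monoidal) (C D : modcat V) (F : modfunctor C D) : Prop :=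
  forall (M : C) (X : V), is_iso (mstr F M X).

(** [G] is a quasi-inverse of the underlying functor of [F]: the natural
    isomorphisms are not required to be module transformations. *)
Definition module_equivalent (V : monoidal) (C D : modcat V) : Prop :=
  exists (F : modfunctor C D) (G : modfunctor D C),
    [/\ strong F, strong G & quasi_inverse F G].

Record modtrans (V : monoidal) (C D : modcat V) (F G : modfunctor C D) :=
  ModTrans {
    mtrans :> nat_trans F G;
    mtrans_str : forall (M : C) (X : V),
      mstr G M X \o mtrans (M \box X) = (mtrans M \Box idm X) \o mstr F M X }.

Lemma modtrans_eq (V : monoidal) (C D : modcat V) (F G : modfunctor C D)
  (a b : modtrans F G) : (forall M, a M = b M) -> a = b.
Proof.
case: a b => [[a na] sa] [[b nb] sb] /= eq_ab.
have eab : a = b by apply: functional_extensionality_dep.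
move: na sa nb sb; rewrite {}eab {eq_ab} => na sa nb.
by rewrite (Prop_irrelevance nb na) => sb; rewrite (Prop_irrelevance sb sa).
Qed.

Section ModBicategory.
Variable V : monoidal.

Section HomCategory.
Variables C D : modcat V.

Definition modtrans_id (F : modfunctor C D) : modtrans F F.
Proof.
apply: (@ModTrans V C D F F
  (@NatTrans C D F F (fun M => idm (F M)) _)) => [M N f|sq M X] /=.
- by rewrite comp1m compm1.
- by rewrite bimap1 comp1m compm1.
Defined.

Definition modtrans_comp (F G H : modfunctor C D)
  (b : modtrans G H) (a : modtrans F G) : modtrans F H.
Proof.
apply: (@ModTrans V C D F H
  (@NatTrans C D F H (fun M => b M \o a M) _)) => [M N f|sq M X] /=.
- by rewrite -compA natural !compA natural.
- rewrite compA mtrans_str -compA mtrans_str compA -bimapM compm1.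
  by [].
Defined.

Definition modhom : category.
Proof.
apply: (@Category (modfunctor C D) (@modtrans V C D) modtrans_id modtrans_comp).
- by move=> F G a; apply: modtrans_eq => M /=; rewrite comp1m.
- by move=> F G a; apply: modtrans_eq => M /=; rewrite compm1.
- by move=> F G H K c b a; apply: modtrans_eq => M /=; rewrite compA.
Defined.

Definition modhom_iso (F G : modhom) (a : mor F G) (b : mor G F)
  (abK : forall M, b M \o a M = idm (F M))
  (baK : forall M, a M \o b M = idm (G M)) : iso F G.
Proof. by apply: (@Iso modhom F G a b); apply: modtrans_eq. Defined.

End HomCategory.

Definition id_modfunctor (C : modcat V) : modfunctor C C.
Proof.
apply: (@ModFunctor V C C (id_functor C) (fun M X => idm (M \box X))) => /=.
- by move=> *; rewrite comp1m compm1.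
- by move=> *; rewrite bimap1 !compm1 comp1m.
- by move=> *; rewrite compm1.
Defined.

Definition comp_modfunctor (C D E : modcat V)
  (F : modfunctor C D) (G : modfunctor D E) : modfunctor C E.
Proof.
apply: (@ModFunctor V C E (comp_functor G F)
  (fun M X => mstr G (F M) X \o fmap G (mstr F M X))) => /=.
- move=> M M' X X' f g.
  by rewrite -compA -fmapM mstr_nat fmapM !compA mstr_nat.
- move=> M X Y.
  rewrite bimapMl -!compA (compA (fmap G (mstr F M X) \Box idm Y)).
  rewrite -mstr_nat !compA mstr_assoc -!compA -!fmapM.
  by congr (_ \o fmap G _); rewrite compA mstr_assoc.
- by move=> M; rewrite compA mstr_unit -fmapM mstr_unit.
Defined.

Definition hcomp_modtrans (C D E : modcat V) (F F' : modfunctor C D)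
  (G G' : modfunctor D E) (a : modtrans F F') (b : modtrans G G') :
  modtrans (comp_modfunctor F G) (comp_modfunctor F' G').
Proof.
apply: (@ModTrans V C E (comp_modfunctor F G) (comp_modfunctor F' G')
  (@NatTrans C E (comp_modfunctor F G) (comp_modfunctor F' G')
    (fun M => b (F' M) \o fmap G (a M)) _)) => [M N f|sq M X] /=.
- by rewrite -compA -fmapM (natural a) fmapM !compA (natural b).
- rewrite bimapMl -!compA (compA (fmap G' (mstr F' M X))) -(natural b).
  rewrite -!compA -fmapM mtrans_str fmapM !compA mtrans_str -!compA.
  by congr (_ \o _); rewrite !compA mstr_nat.
Defined.

Definition modhcomp (C D E : modcat V) :
  functor (prod_category (modhom C D) (modhom D E)) (modhom C E).
Proof.
apply: (@Functor (prod_category (modhom C D) (modhom D E)) (modhom C E)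
  (fun p => comp_modfunctor p.1 p.2)
  (fun p q ab => hcomp_modtrans ab.1 ab.2)) => /=.
- by move=> [F G]; apply: modtrans_eq => M /=; rewrite fmap1 compm1.
- move=> [F1 G1] [F2 G2] [F3 G3] [a b] [a' b'].
  apply: modtrans_eq => M /=.
  by rewrite -!compA (compA (fmap G2 (a M))) -(natural b') fmapM !compA.
Defined.

Section Constraints.

Variables C D E H : modcat V.

(** Composition of module functors is associative and unital on the nose, so
    the components of all constraints below are identities. *)
Definition modassoc_fwd (F : modfunctor C D) (G : modfunctor D E)
    (K : modfunctor E H) :
  modtrans (comp_modfunctor (comp_modfunctor F G) K)
           (comp_modfunctor F (comp_modfunctor G K)).
Proof.
apply: (@ModTrans V C H _ _ (@NatTrans C H
  (comp_modfunctor (comp_modfunctor F G) K)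
  (comp_modfunctor F (comp_modfunctor G K))
  (fun M => idm (K (G (F M)))) _)) => [M N f|sq M X] /=.
- by rewrite comp1m compm1.
- by rewrite bimap1 compm1 comp1m fmapM compA.
Defined.

Definition modassoc_bwd (F : modfunctor C D) (G : modfunctor D E)
    (K : modfunctor E H) :
  modtrans (comp_modfunctor F (comp_modfunctor G K))
           (comp_modfunctor (comp_modfunctor F G) K).
Proof.
apply: (@ModTrans V C H _ _ (@NatTrans C H
  (comp_modfunctor F (comp_modfunctor G K))
  (comp_modfunctor (comp_modfunctor F G) K)
  (fun M => idm (K (G (F M)))) _)) => [M N f|sq M X] /=.
- by rewrite comp1m compm1.
- by rewrite bimap1 compm1 comp1m fmapM compA.
Defined.

Definition modassoc (F : modhom C D) (G : modhom D E) (K : modhom E H) :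
  iso (modhcomp C E H (modhcomp C D E (F, G), K))
      (modhcomp C D H (F, modhcomp D E H (G, K))).
Proof.
by apply: (modhom_iso (a := modassoc_fwd F G K) (b := modassoc_bwd F G K)) =>
  M /=; rewrite comp1m.
Defined.

Definition modlunit_fwd (F : modfunctor C D) :
  modtrans (comp_modfunctor (id_modfunctor C) F) F.
Proof.
apply: (@ModTrans V C D _ _ (@NatTrans C D
  (comp_modfunctor (id_modfunctor C) F) F
  (fun M => idm (F M)) _)) => [M N f|sq M X] /=.
- by rewrite comp1m compm1.
- by rewrite bimap1 compm1 comp1m fmap1 compm1.
Defined.

Definition modlunit_bwd (F : modfunctor C D) :
  modtrans F (comp_modfunctor (id_modfunctor C) F).
Proof.
apply: (@ModTrans V C D _ _ (@NatTrans C D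
  F (comp_modfunctor (id_modfunctor C) F)
  (fun M => idm (F M)) _)) => [M N f|sq M X] /=.
- by rewrite comp1m compm1.
- by rewrite bimap1 compm1 comp1m fmap1 compm1.
Defined.

Definition modlunit (F : modhom C D) :
  iso (modhcomp C C D (id_modfunctor C, F)) F.
Proof.
by apply: (modhom_iso (a := modlunit_fwd F) (b := modlunit_bwd F)) =>
  M /=; rewrite comp1m.
Defined.

Definition modrunit_fwd (F : modfunctor C D) :
  modtrans (comp_modfunctor F (id_modfunctor D)) F.
Proof.
apply: (@ModTrans V C D _ _ (@NatTrans C D
  (comp_modfunctor F (id_modfunctor D)) F
  (fun M => idm (F M)) _)) => [M N f|sq M X] /=.
- by rewrite comp1m compm1.
- by rewrite bimap1 compm1 !comp1m.
Defined.

Definition modrunit_bwd (F : modfunctor C D) :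
  modtrans F (comp_modfunctor F (id_modfunctor D)).
Proof.
apply: (@ModTrans V C D _ _ (@NatTrans C D
  F (comp_modfunctor F (id_modfunctor D))
  (fun M => idm (F M)) _)) => [M N f|sq M X] /=.
- by rewrite comp1m compm1.
- by rewrite bimap1 compm1 !comp1m.
Defined.

Definition modrunit (F : modhom C D) :
  iso (modhcomp C D D (F, id_modfunctor D)) F.
Proof.
by apply: (modhom_iso (a := modrunit_fwd F) (b := modrunit_bwd F)) =>
  M /=; rewrite comp1m.
Defined.

End Constraints.

(** The full sub-bicategory, on the module categories satisfying [P], of the
    bicategory of [V]-module categories. *)

Record modcat_in (P : modcat V -> Prop) := ModCatIn {
  mdc :> modcat V;
  mdcP : P mdc }.

Definition modbicat (P : modcat V -> Prop) : bicategory.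
Proof.
apply: (@Bicategory (modcat_in P) (fun C D => modhom C D)
  (fun C D E => modhcomp C D E) (fun C => id_modfunctor C)
  (fun C D E H => @modassoc C D E H)
  (fun C D => @modlunit C D) (fun C D => @modrunit C D)).
- move=> C D E H F F' G G' K K' a b c; apply: modtrans_eq => M /=.
  by rewrite comp1m compm1 fmapM compA.
- by move=> C D F F' a; apply: modtrans_eq => M /=;
    rewrite fmap1 comp1m !compm1.
- by move=> C D F F' a; apply: modtrans_eq => M /=; rewrite comp1m !compm1 ?comp1m.
- move=> C D E H J F G K L; apply: modtrans_eq => M /=.
  by rewrite ?fmap1 ?comp1m ?compm1.
- move=> C D E F G; apply: modtrans_eq => M /=.
  by rewrite ?fmap1 ?comp1m ?compm1.
Defined.

End ModBicategory.

Local Open Scope ring_scope.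

Section LinearAlgebra.
Variable K : fieldType.
Implicit Types U V W X : vectType K.

Lemma linfunE V W (f : V -> W) : linear f -> linfun f =1 f.
Proof.
move=> lf v.
pose ff : {linear V -> W} := HB.pack f (GRing.isLinear.Build K V W _ f lf).
exact: (lfunE ff).
Qed.

Lemma linear_add (V W : lmodType K) (f : V -> W) :
  linear f -> {morph f : x y / x + y}.
Proof. by move=> lf x y; have := lf 1 x y; rewrite !scale1r. Qed.

Definition bilin U V W (b : U -> V -> W) : Prop :=
  (forall v, linear (b^~ v)) /\ (forall u, linear (b u)).

(** A tensor is given by its coordinates in the product of the chosen bases;
    see [tensor_universal] below for the universal property. *)
Definition tensor U V : vectType K := 'M[K]_(\dim {: U}, \dim {: V}).

Definition pure U V (u : U) (v : V) : tensor U V :=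
  \matrix_(i, j) (coord (vbasis fullv) i u * coord (vbasis fullv) j v).

Definition tlift U V W (b : U -> V -> W) : 'Hom(tensor U V, W) :=
  linfun (fun t : 'M[K]_(\dim {: U}, \dim {: V}) => \sum_i \sum_j
    t i j *: b (vbasis fullv)`_i (vbasis fullv)`_j).

Lemma tliftE' U V W (b : U -> V -> W) (t : tensor U V) :
  tlift b t = \sum_i \sum_j
    (t : 'M_(_, _)) i j *: b (vbasis fullv)`_i (vbasis fullv)`_j.
Proof.
rewrite linfunE // => a x y.
rewrite scaler_sumr -big_split; apply: eq_bigr => i _ /=.
rewrite scaler_sumr -big_split; apply: eq_bigr => j _ /=.
by rewrite !mxE scalerDl scalerA.
Qed.

Lemma pure_bilin U V : bilin (@pure U V).
Proof.
split=> [v a x y | u a x y]; apply/matrixP=> i j; rewrite !mxE linearP.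
- by rewrite mulrDl mulrA.
- by rewrite mulrDr mulrCA.
Qed.

Lemma pureDl U V (v : V) : {morph (fun u : U => pure u v) : x y / x + y}.
Proof. exact/linear_add/(pure_bilin U V).1. Qed.

Lemma pureDr U V (u : U) : {morph @pure U V u : x y / x + y}.
Proof. exact/linear_add/(pure_bilin U V).2. Qed.

Lemma pureZl U V a (u : U) (v : V) : pure (a *: u) v = a *: pure u v.
Proof. by apply/matrixP=> i j; rewrite !mxE linearZ mulrA. Qed.

Lemma pureZr U V a (u : U) (v : V) : pure u (a *: v) = a *: pure u v.
Proof. by apply/matrixP=> i j; rewrite !mxE linearZ mulrCA. Qed.

Lemma pure0l U V (v : V) : pure (0 : U) v = 0.
Proof. by rewrite -(scale0r 0) pureZl scale0r. Qed.

Lemma pure0r U V (u : U) : pure u (0 : V) = 0.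
Proof. by rewrite -(scale0r 0) pureZr scale0r. Qed.

Lemma tensor_sum U V (t : tensor U V) :
  t = \sum_i \sum_j
    pure ((t : 'M_(_, _)) i j *: (vbasis fullv)`_i) (vbasis fullv)`_j.
Proof.
rewrite [LHS]matrix_sum_delta; apply: eq_bigr => i _; apply: eq_bigr => j _.
rewrite pureZl; congr (_ *: _); apply/matrixP=> k l; rewrite !mxE.
rewrite !coord_free ?(basis_free (vbasisP _)) // -natrM mulnb.
by rewrite ![_ == k]eq_sym ![_ == l]eq_sym.
Qed.

Lemma tensor_eq U V (W : zmodType) (f g : tensor U V -> W) :
    {morph f : x y / x + y} -> {morph g : x y / x + y} ->
  (forall u v, f (pure u v) = g (pure u v)) -> f =1 g.
Proof.
move=> fD gD fg.
have f0 : f 0 = 0 by apply: (addIr (f 0)); rewrite -fD !add0r.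
have g0 : g 0 = 0 by apply: (addIr (g 0)); rewrite -gD !add0r.
move=> t; rewrite [t]tensor_sum (big_morph f fD f0) (big_morph g gD g0).
apply: eq_bigr => i _; rewrite (big_morph f fD f0) (big_morph g gD g0).
by apply: eq_bigr => j _.
Qed.

Lemma tliftE U V W (b : U -> V -> W) : bilin b ->
  forall u v, tlift b (pure u v) = b u v.
Proof.
move=> [bl br] u v; rewrite tliftE'.
pose bu : {linear V -> W} := HB.pack (b u) (GRing.isLinear.Build K V W _ _ (br u)).
rewrite -[b u v]/(bu v) [in RHS](coord_vbasis (memvf v)) linear_sum exchange_big.
apply: eq_bigr => j _; rewrite linearZ [bu]lock /= -lock -[bu _]/(b u _).
set w := _`_j.
pose bv : {linear U -> W} :=
  HB.pack (b^~ w) (GRing.isLinear.Build K U W _ _ (bl w)).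
rewrite -[b u w]/(bv u) [in RHS](coord_vbasis (memvf u)) linear_sum scaler_sumr.
by apply: eq_bigr => i _; rewrite linearZ /= mxE scalerA mulrC.
Qed.

Lemma tensor_universal U V W (b : U -> V -> W) : bilin b ->
  exists! f : 'Hom(tensor U V, W), forall u v, f (pure u v) = b u v.
Proof.
move=> bb; exists (tlift b); split=> [|f fE]; first exact: tliftE.
apply/lfunP; apply: tensor_eq => [x y|x y|u v]; rewrite ?linearD //.
by rewrite tliftE // fE.
Qed.

Lemma tlift_linear X U V W (b : X -> U -> V -> W) :
    (forall u v, linear (fun x => b x u v)) ->
  forall t, linear (fun x => tlift (b x) t).
Proof.
move=> lb t a x y; rewrite !tliftE' scaler_sumr -big_split.
apply: eq_bigr => i _ /=; rewrite scaler_sumr -big_split; apply: eq_bigr => j _.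
by rewrite /= lb scalerDr !scalerA mulrC.
Qed.

Section DirectSum.
Variables (n : nat) (V : 'I_n -> vectType K).

Definition dsum_of : Type := {dffun forall k : 'I_n, V k}.
HB.instance Definition _ := Choice.on dsum_of.

Implicit Types f g h : dsum_of.

Definition dsum_add f g : dsum_of := [ffun k => f k + g k].
Definition dsum_opp f : dsum_of := [ffun k => - f k].
Definition dsum_zero : dsum_of := [ffun k => 0].
Definition dsum_scale (a : K) f : dsum_of := [ffun k => a *: f k].

Fact dsum_addA : associative dsum_add.
Proof. by move=> f g h; apply/ffunP=> k; rewrite !ffunE addrA. Qed.
Fact dsum_addC : commutative dsum_add.
Proof. by move=> f g; apply/ffunP=> k; rewrite !ffunE addrC. Qed.
Fact dsum_add0 : left_id dsum_zero dsum_add.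
Proof. by move=> f; apply/ffunP=> k; rewrite !ffunE add0r. Qed.
Fact dsum_addN : left_inverse dsum_zero dsum_opp dsum_add.
Proof. by move=> f; apply/ffunP=> k; rewrite !ffunE addNr. Qed.

HB.instance Definition _ := GRing.isZmodule.Build dsum_of
  dsum_addA dsum_addC dsum_add0 dsum_addN.

Fact dsum_scaleA a b f : dsum_scale a (dsum_scale b f) = dsum_scale (a * b) f.
Proof. by apply/ffunP=> k; rewrite !ffunE scalerA. Qed.
Fact dsum_scale1 : left_id 1 dsum_scale.
Proof. by move=> f; apply/ffunP=> k; rewrite !ffunE scale1r. Qed.
Fact dsum_scaleDr : right_distributive dsum_scale +%R.
Proof. by move=> a f g; apply/ffunP=> k; rewrite !ffunE scalerDr. Qed.
Fact dsum_scaleDl f : {morph dsum_scale^~ f : a b / a + b}.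
Proof. by move=> a b; apply/ffunP=> k; rewrite !ffunE scalerDl. Qed.

HB.instance Definition _ := GRing.Zmodule_isLmodule.Build K dsum_of
  dsum_scaleA dsum_scale1 dsum_scaleDr dsum_scaleDl.

Lemma dsumD (x y : dsum_of) k : (x + y) k = x k + y k.
Proof. by rewrite ffunE. Qed.
Lemma dsumZ a (x : dsum_of) k : (a *: x) k = a *: x k.
Proof. by rewrite ffunE. Qed.

Fact dsum_vect : Vector.axiom (\sum_(k < n) \dim {: V k}) dsum_of.
Proof.
exists (fun f => \mxrow_k passmx.rVof (vbasis {: V k}) (f k)) => [a f g|].
  rewrite -mul_scalar_mx mul_mxrow -mxrowD; apply: eq_mxrow => k.
  rewrite dsumD dsumZ mul_scalar_mx.
  by apply/rowP=> i; rewrite !mxE linearP.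
exists (fun r => [ffun k => passmx.vecof (vbasis {: V k}) (submxrow r k)] : dsum_of).
- by move=> f; apply/ffunP=> k; rewrite ffunE mxrowK passmx.rVofK ?vbasisP.
- move=> r; rewrite -[RHS]submxrowK; apply: eq_mxrow => k.
  by rewrite ffunE passmx.vecofK ?vbasisP.
Qed.

HB.instance Definition _ := Lmodule_hasFinDim.Build K dsum_of dsum_vect.

Definition dsum : vectType K := dsum_of.

Definition dproj (k : 'I_n) (x : dsum) : V k := (x : dsum_of) k.

Definition dinj (k : 'I_n) (v : V k) : dsum :=
  [ffun l => match k =P l with
             | ReflectT e => eq_rect k (fun l => V l : Type) v l e
             | ReflectF _ => 0
             end] : dsum_of.

Lemma dprojD k : {morph dproj k : x y / x + y}.
Proof. by move=> x y; exact: dsumD. Qed.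
Lemma dprojZ k a x : dproj k (a *: x) = a *: dproj k x.
Proof. exact: dsumZ. Qed.

Lemma dsumP (x y : dsum) : (forall k, dproj k x = dproj k y) -> x = y.
Proof. by move=> xy; apply/ffunP. Qed.

Lemma dprojK k (v : V k) : dproj k (dinj v) = v.
Proof.
rewrite /dproj ffunE; case: eqP => // e.
by rewrite (eq_irrelevance e erefl).
Qed.

Lemma dproj_inj k l (v : V k) : k != l -> dproj l (dinj v) = 0.
Proof. by rewrite /dproj ffunE; case: eqP. Qed.

Lemma dinj_linear k : linear (@dinj k).
Proof.
move=> a u v; apply: dsumP => l; rewrite dprojD dprojZ.
have [<-|kl] := eqVneq k l; first by rewrite !dprojK.
by rewrite !dproj_inj // scaler0 addr0.
Qed.

Lemma dinjD k : {morph @dinj k : x y / x + y}.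
Proof. exact/linear_add/dinj_linear. Qed.

Lemma dsum_sum (x : dsum) : x = \sum_k dinj (dproj k x).
Proof.
have proj0 l : dproj l 0 = 0 by rewrite /dproj ffunE.
apply: dsumP => l; rewrite (big_morph (dproj l) (@dprojD l) (proj0 l)).
by rewrite (bigD1 l) //= dprojK big1 ?addr0 // => k; apply: dproj_inj.
Qed.

Lemma dsum_eq (W : zmodType) (f g : dsum -> W) :
    {morph f : x y / x + y} -> {morph g : x y / x + y} ->
  (forall k v, f (@dinj k v) = g (dinj v)) -> f =1 g.
Proof.
move=> fD gD fg.
have f0 : f 0 = 0 by apply: (addIr (f 0)); rewrite -fD !add0r.
have g0 : g 0 = 0 by apply: (addIr (g 0)); rewrite -gD !add0r.
move=> x; rewrite [x]dsum_sum (big_morph f fD f0) (big_morph g gD g0).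
by apply: eq_bigr.
Qed.

Definition dlift W (b : forall k, V k -> W) : 'Hom(dsum, W) :=
  linfun (fun x => \sum_k b k (dproj k x)).

Lemma dlift_sum W (b : forall k, V k -> W) : (forall k, linear (b k)) ->
  forall x, dlift b x = \sum_k b k (dproj k x).
Proof.
move=> lb x; rewrite linfunE // => a y z.
rewrite scaler_sumr -big_split; apply: eq_bigr => k _ /=.
by rewrite dprojD dprojZ lb.
Qed.

Lemma dliftE W (b : forall k, V k -> W) : (forall k, linear (b k)) ->
  forall k (v : V k), dlift b (dinj v) = b k v.
Proof.
move=> lb k v; rewrite dlift_sum // (bigD1 k) //= dprojK big1 ?addr0 // => l kl.
have b0 : b l 0 = 0 by apply: (addIr (b l 0)); rewrite -(linear_add (lb l)) !add0r.
by rewrite dproj_inj // eq_sym.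
Qed.

End DirectSum.


Lemma dlift_linear n (V : 'I_n -> vectType K) X W
    (b : X -> forall k, V k -> W) :
    (forall k v, linear (fun x => b x k v)) -> (forall x k, linear (b x k)) ->
  forall t, linear (fun x => dlift (b x) t).
Proof.
move=> lx lb t a x y; rewrite !dlift_sum // scaler_sumr -big_split.
by apply: eq_bigr => k _ /=; rewrite lx.
Qed.

End LinearAlgebra.

Arguments dinj {K n V} k v.
Arguments dproj {K n V} k x.

Section TensorMaps.
Variable K : fieldType.
Implicit Types U V W X Y Z : vectType K.

Lemma lfunD V W (f : 'Hom(V, W)) : {morph f : x y / x + y}.
Proof. exact: linearD. Qed.

Lemma lfun_linear V W (f : 'Hom(V, W)) : linear f.
Proof. exact: linearP. Qed.

Definition tmap U U' V V' (f : 'Hom(U, U')) (g : 'Hom(V, V')) :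
    'Hom(tensor U V, tensor U' V') :=
  tlift (fun u v => pure (f u) (g v)).

Lemma tmapE U U' V V' (f : 'Hom(U, U')) (g : 'Hom(V, V')) u v :
  tmap f g (pure u v) = pure (f u) (g v).
Proof.
rewrite tliftE //; split=> [w|w] a x y.
- by rewrite linearP (pure_bilin _ _).1.
- by rewrite linearP (pure_bilin _ _).2.
Qed.

Lemma pure_linear_l U V v : linear (fun u : U => pure u (v : V)).
Proof. exact: (pure_bilin U V).1. Qed.

Lemma pure_linear_r U V u : linear (fun v : V => pure (u : U) v).
Proof. exact: (pure_bilin U V).2. Qed.

(** The usual constraints: [(u (x) v) (x) w |-> u (x) (v (x) w)],
    [a (x) v |-> a v], [v (x) a |-> a v]; see [tassocE], [tlunitE], [trunitE]. *)
Definition tassoc U V W :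
    'Hom(tensor (tensor U V) W, tensor U (tensor V W)) :=
  tlift (fun s w => tlift (fun u v => pure u (pure v w)) s).

Lemma tassocE U V W (u : U) (v : V) (w : W) :
  tassoc U V W (pure (pure u v) w) = pure u (pure v w).
Proof.
rewrite tliftE ?tliftE //; split=> [x|x] a y z.
- by rewrite pure_linear_l.
- by rewrite !pure_linear_l pure_linear_r.
- by rewrite linearP.
- apply: (tlift_linear (b := fun w u v => pure u (pure v w))) => u' v' b y' z'.
  by rewrite !pure_linear_r.
Qed.

Definition tassocV U V W :
    'Hom(tensor U (tensor V W), tensor (tensor U V) W) :=
  tlift (fun u s => tlift (fun v w => pure (pure u v) w) s).

Lemma tassocVE U V W (u : U) (v : V) (w : W) :
  tassocV U V W (pure u (pure v w)) = pure (pure u v) w.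
Proof.
rewrite tliftE ?tliftE //; split=> [x|x] a y z.
- by rewrite pure_linear_r pure_linear_l.
- by rewrite pure_linear_r.
- apply: (tlift_linear (b := fun u v w => pure (pure u v) w)) => v' w' b y' z'.
  by rewrite !pure_linear_l.
- by rewrite linearP.
Qed.

Definition tlunit V : 'Hom(tensor K^o V, V) := tlift (U := K^o) (fun (a : K) v => a *: v).
Definition tlunitV V : 'Hom(V, tensor K^o V) := linfun (pure (1 : K^o)).
Definition trunit V : 'Hom(tensor V K^o, V) := tlift (V := K^o) (fun v (a : K) => a *: v).
Definition trunitV V : 'Hom(V, tensor V K^o) :=
  linfun (fun v => pure v (1 : K^o)).

Lemma tlunitE V (a : K^o) v : tlunit V (pure a v) = (a : K) *: v.
Proof.
rewrite tliftE //; split=> [u|b] c x y.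
- by rewrite scalerDl scalerA.
- by rewrite scalerDr !scalerA mulrC.
Qed.

Lemma trunitE V v (a : K^o) : trunit V (pure v a) = (a : K) *: v.
Proof.
rewrite tliftE //; split=> [b|u] c x y.
- by rewrite scalerDr !scalerA mulrC.
- by rewrite scalerDl scalerA.
Qed.

Lemma tlunitVE V v : tlunitV V v = pure (1 : K^o) v.
Proof. by rewrite linfunE //; apply: pure_linear_r. Qed.

Lemma trunitVE V v : trunitV V v = pure v (1 : K^o).
Proof. by rewrite linfunE //; apply: pure_linear_l. Qed.

End TensorMaps.

Ltac additive :=
  let x := fresh in let y := fresh in
  move=> x y; rewrite /= ?comp_lfunE ?id_lfunE;
  by do ?[rewrite lfunD | rewrite dinjD | rewrite pureDl | rewrite pureDr].

Ltac tensor_ext := apply: tensor_eq; [additive | additive |].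
Ltac dsum_ext := apply: dsum_eq; [additive | additive |].

Section TensorLaws.
Variable K : fieldType.
Implicit Types U V W X Y Z : vectType K.

Lemma tmap1 U V : tmap \1%VF \1%VF = \1%VF :> 'End(tensor U V).
Proof.
by apply/lfunP; tensor_ext => u v; rewrite tmapE !id_lfunE.
Qed.

Lemma tmapM U U' U'' V V' V'' (f' : 'Hom(U', U'')) (f : 'Hom(U, U'))
    (g' : 'Hom(V', V'')) (g : 'Hom(V, V')) :
  tmap (f' \o f) (g' \o g) = (tmap f' g' \o tmap f g)%VF.
Proof.
by apply/lfunP; tensor_ext => u v; rewrite comp_lfunE !tmapE !comp_lfunE.
Qed.

Lemma tassocK U V W : (tassocV U V W \o tassoc U V W)%VF = \1%VF.
Proof.
apply/lfunP; tensor_ext => s w; move: s; tensor_ext => u v.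
by rewrite comp_lfunE tassocE tassocVE id_lfunE.
Qed.

Lemma tassocVK U V W : (tassoc U V W \o tassocV U V W)%VF = \1%VF.
Proof.
apply/lfunP; tensor_ext => u s; move: s; tensor_ext => v w.
by rewrite comp_lfunE tassocVE tassocE id_lfunE.
Qed.

Lemma tlunitK V : (tlunitV V \o tlunit V)%VF = \1%VF.
Proof.
apply/lfunP; tensor_ext => a v.
by rewrite comp_lfunE tlunitE tlunitVE id_lfunE pureZr -pureZl [_ *: 1]mulr1.
Qed.

Lemma tlunitVK V : (tlunit V \o tlunitV V)%VF = \1%VF.
Proof. by apply/lfunP=> v; rewrite comp_lfunE tlunitVE tlunitE scale1r id_lfunE. Qed.

Lemma trunitK V : (trunitV V \o trunit V)%VF = \1%VF.
Proof.
apply/lfunP; tensor_ext => v a.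
by rewrite comp_lfunE trunitE trunitVE id_lfunE pureZl -pureZr [_ *: 1]mulr1.
Qed.

Lemma trunitVK V : (trunit V \o trunitV V)%VF = \1%VF.
Proof. by apply/lfunP=> v; rewrite comp_lfunE trunitVE trunitE scale1r id_lfunE. Qed.

Lemma tassoc_nat U U' V V' W W' (f : 'Hom(U, U')) (g : 'Hom(V, V'))
    (h : 'Hom(W, W')) :
  (tassoc U' V' W' \o tmap (tmap f g) h = tmap f (tmap g h) \o tassoc U V W)%VF.
Proof.
apply/lfunP; tensor_ext => s w; move: s; tensor_ext => u v.
by rewrite !comp_lfunE tassocE !tmapE tassocE.
Qed.

Lemma tlunit_nat V V' (f : 'Hom(V, V')) :
  (tlunit V' \o tmap \1%VF f = f \o tlunit V)%VF.
Proof.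
apply/lfunP; tensor_ext => a v.
by rewrite !comp_lfunE tmapE !tlunitE id_lfunE linearZ.
Qed.

Lemma trunit_nat V V' (f : 'Hom(V, V')) :
  (trunit V' \o tmap f \1%VF = f \o trunit V)%VF.
Proof.
apply/lfunP; tensor_ext => v a.
by rewrite !comp_lfunE tmapE !trunitE id_lfunE linearZ.
Qed.

Lemma tpentagon U V W X :
  (tassoc U V (tensor W X) \o tassoc (tensor U V) W X =
   tmap \1 (tassoc V W X) \o tassoc U (tensor V W) X
     \o tmap (tassoc U V W) \1)%VF.
Proof.
apply/lfunP; tensor_ext => s x; move: s; tensor_ext => s w.
move: s; tensor_ext => u v.
by rewrite !comp_lfunE !(tmapE, tassocE, id_lfunE).
Qed.

Lemma ttriangle U V :
  (tmap \1 (tlunit V) \o tassoc U K^o V = tmap (trunit U) \1)%VF.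
Proof.
apply/lfunP; tensor_ext => s v; move: s; tensor_ext => u a.
by rewrite comp_lfunE tassocE !tmapE !id_lfunE tlunitE trunitE pureZl pureZr.
Qed.

Definition dmap n (V W : 'I_n -> vectType K) (f : forall k, 'Hom(V k, W k)) :
    'Hom(dsum V, dsum W) :=
  dlift (fun k v => dinj k (f k v)).

Lemma dmapE n (V W : 'I_n -> vectType K) (f : forall k, 'Hom(V k, W k)) k v :
  dmap f (dinj k v) = dinj k (f k v).
Proof. by rewrite dliftE // => l a x y; rewrite linearP dinj_linear. Qed.

End TensorLaws.

Section Vect.
Variable K : fieldType.

Definition Vect_cat : category.
Proof.
refine (@Category (vectType K) (fun V W => 'Hom(V, W)) (fun V => \1%VF)
  (fun U V W g f => (g \o f)%VF) _ _ _).
- by move=> V W f; apply: comp_lfun1l.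
- by move=> V W f; apply: comp_lfun1r.
- by move=> U V W X h g f; apply: comp_lfunA.
Defined.

Definition Vect_tensor : functor (prod_category Vect_cat Vect_cat) Vect_cat.
Proof.
refine (@Functor (prod_category Vect_cat Vect_cat) Vect_cat
  (fun p => tensor p.1 p.2) (fun p q f => tmap f.1 f.2) _ _).
- by move=> [U V]; apply: tmap1.
- by move=> p q r g f; apply: tmapM.
Defined.

Definition Vect : monoidal.
Proof.
refine (@Monoidal Vect_cat Vect_tensor (K^o : vectType K)
  (fun U V W => @Iso Vect_cat (tensor (tensor U V) W) (tensor U (tensor V W))
     (tassoc U V W) (tassocV U V W) (tassocK U V W) (tassocVK U V W))
  (fun V => @Iso Vect_cat (tensor K^o V) V
     (tlunit V) (tlunitV V) (tlunitK V) (tlunitVK V))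
  (fun V => @Iso Vect_cat (tensor V K^o) V
     (trunit V) (trunitV V) (trunitK V) (trunitVK V)) _ _ _ _ _).
- by move=> *; apply: tassoc_nat.
- by move=> *; apply: tlunit_nat.
- by move=> *; apply: trunit_nat.
- by move=> *; apply: tpentagon.
- by move=> *; apply: ttriangle.
Defined.

Section PowerModules.
Variable n : nat.

(** The algebra [K^n] is [{ffun 'I_n -> K^o}] with its pointwise operations;
    for [n = 0] it is the zero ring, and [rho1] forces [carrier = 0]. *)
Record fdmod := FdMod {
  carrier :> vectType K;
  rho : 'Hom({ffun 'I_n -> K^o}, 'End(carrier));
  rho1 : rho 1 = \1%VF;
  rhoM : forall a b, rho (a * b) = (rho a \o rho b)%VF }.

Record fdhom (M N : fdmod) := FdHom {
  fdfun :> 'Hom(M, N);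
  fdfun_equiv : forall a, (fdfun \o rho M a = rho N a \o fdfun)%VF }.

Lemma fdhom_eq M N (f g : fdhom M N) : f = g :> 'Hom(M, N) -> f = g.
Proof.
case: f g => [f fP] [g gP] /= fg; move: fP gP; rewrite fg => fP gP.
by rewrite (Prop_irrelevance fP gP).
Qed.

Definition fdmod_cat : category.
Proof.
refine (@Category fdmod fdhom
  (fun M => @FdHom M M \1%VF _) (fun L M N g f => @FdHom L N (g \o f)%VF _)
  _ _ _).
- by move=> M N f; apply/fdhom_eq/comp_lfun1l.
- by move=> M N f; apply/fdhom_eq/comp_lfun1r.
- by move=> L M N P h g f; apply/fdhom_eq/comp_lfunA.
Unshelve.
- by move=> a; rewrite comp_lfun1l comp_lfun1r.
- by move=> a; rewrite -comp_lfunA fdfun_equiv !comp_lfunA fdfun_equiv.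
Defined.

Lemma tmap_linear_l (U U' V V' : vectType K) (g : 'Hom(V, V')) :
  linear (fun f : 'Hom(U, U') => tmap f g).
Proof.
move=> a f f'; apply/lfunP; tensor_ext => u v.
by rewrite !lfun_simp !tmapE !lfun_simp pure_linear_l.
Qed.

Definition fdmod_act_ob (M : fdmod) (X : vectType K) : fdmod.
Proof.
refine (@FdMod (tensor M X) (linfun (fun a => tmap (rho M a) \1%VF)) _ _).
- by rewrite linfunE ?rho1 ?tmap1 // => a x y; rewrite linearP tmap_linear_l.
- have lin : linear (fun a => tmap (rho M a) (\1 : 'End(X))%VF).
    by move=> a x y; rewrite linearP tmap_linear_l.
  by move=> a b; rewrite !linfunE // rhoM -tmapM comp_lfun1l.
Defined.

Lemma fdmod_act_rho M X a : rho (fdmod_act_ob M X) a = tmap (rho M a) \1%VF.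
Proof. by rewrite linfunE // => b x y; rewrite linearP tmap_linear_l. Qed.

Definition fdmod_act_hom (M M' : fdmod) (X X' : vectType K)
  (f : fdhom M M') (g : 'Hom(X, X')) :
  fdhom (fdmod_act_ob M X) (fdmod_act_ob M' X').
Proof.
refine (@FdHom (fdmod_act_ob M X) (fdmod_act_ob M' X') (tmap f g) _) => a.
by rewrite !fdmod_act_rho -!tmapM fdfun_equiv comp_lfun1l comp_lfun1r.
Defined.

Definition fdmod_act : functor (prod_category fdmod_cat Vect_cat) fdmod_cat.
Proof.
refine (@Functor (prod_category fdmod_cat Vect_cat) fdmod_cat
  (fun p => fdmod_act_ob p.1 p.2) (fun p q f => fdmod_act_hom f.1 f.2) _ _).
- by move=> [M X]; apply/fdhom_eq/tmap1.
- by move=> p q r g f; apply/fdhom_eq/tmapM.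
Defined.

Definition fdmod_assoc (M : fdmod) (X Y : vectType K) :
  @iso fdmod_cat (fdmod_act_ob (fdmod_act_ob M X) Y)
                 (fdmod_act_ob M (tensor X Y)).
Proof.
refine (@Iso fdmod_cat (fdmod_act_ob (fdmod_act_ob M X) Y)
  (fdmod_act_ob M (tensor X Y))
  (@FdHom (fdmod_act_ob (fdmod_act_ob M X) Y) (fdmod_act_ob M (tensor X Y))
     (tassoc M X Y) _)
  (@FdHom (fdmod_act_ob M (tensor X Y)) (fdmod_act_ob (fdmod_act_ob M X) Y)
     (tassocV M X Y) _) _ _).
- exact/fdhom_eq/tassocK.
- exact/fdhom_eq/tassocVK.
Unshelve.
- by move=> a; rewrite !fdmod_act_rho tassoc_nat tmap1.
- move=> a; rewrite !fdmod_act_rho -[LHS]comp_lfun1r -(tassocVK M X Y).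
  rewrite comp_lfunA -(comp_lfunA (tassocV M X Y)) -tmap1 -tassoc_nat.
  by rewrite comp_lfunA tassocK comp_lfun1l.
Defined.

Definition fdmod_unit (M : fdmod) :
  @iso fdmod_cat (fdmod_act_ob M (K^o : vectType K)) M.
Proof.
refine (@Iso fdmod_cat (fdmod_act_ob M (K^o : vectType K)) M
  (@FdHom (fdmod_act_ob M (K^o : vectType K)) M (trunit M) _)
  (@FdHom M (fdmod_act_ob M (K^o : vectType K)) (trunitV M) _) _ _).
- exact/fdhom_eq/trunitK.
- exact/fdhom_eq/trunitVK.
Unshelve.
- by move=> a; rewrite fdmod_act_rho trunit_nat.
- move=> a; rewrite fdmod_act_rho -[LHS]comp_lfun1r -(trunitVK M).
  rewrite comp_lfunA -(comp_lfunA (trunitV M)) -trunit_nat.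
  by rewrite comp_lfunA trunitK comp_lfun1l.
Defined.

Definition fdmod_modcat : modcat Vect.
Proof.
refine (@ModCat Vect fdmod_cat fdmod_act fdmod_assoc fdmod_unit _ _ _ _).
- by move=> *; apply/fdhom_eq/tassoc_nat.
- by move=> *; apply/fdhom_eq/trunit_nat.
- by move=> *; apply/fdhom_eq/tpentagon.
- by move=> *; apply/fdhom_eq/ttriangle.
Defined.

End PowerModules.

Definition ModVect2 : bicategory :=
  modbicat (fun C : modcat Vect => exists n, module_equivalent C (fdmod_modcat n)).

End Vect.

Section Matrices.
Variable K : fieldType.

(** No special clause is needed for [n = 0] or [m = 0]: there is then exactly
    one matrix and one morphism, see [mat_cat_trivial] below. *)
Definition mat_cat (n m : nat) : category.
Proof.
refine (@Category ('I_n -> 'I_m -> vectType K)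
  (fun V W => forall i j, 'Hom(V i j, W i j))
  (fun V i j => \1%VF) (fun U V W g f i j => (g i j \o f i j)%VF) _ _ _).
- by move=> V W f; apply: functional_extensionality_dep => i;
    apply: functional_extensionality_dep => j; apply: comp_lfun1l.
- by move=> V W f; apply: functional_extensionality_dep => i;
    apply: functional_extensionality_dep => j; apply: comp_lfun1r.
- by move=> U V W X h g f; apply: functional_extensionality_dep => i;
    apply: functional_extensionality_dep => j; apply: comp_lfunA.
Defined.

Lemma mat_eq n m (V W : mat_cat n m) (f g : mor V W) :
  (forall i j, f i j = g i j) -> f = g.
Proof.
by move=> fg; apply: functional_extensionality_dep => i;
  apply: functional_extensionality_dep.
Qed.

Lemma mat_cat_trivial n m : (n == 0%N) || (m == 0%N) ->
  (exists V : mat_cat n m, forall W, W = V) /\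
  (forall (V W : mat_cat n m), exists f : mor V W, forall g, g = f).
Proof.
move=> nm; have F (i : 'I_n) (j : 'I_m) : False.
  by case: i j => i + [j]; case/orP: nm => /eqP->.
split=> [|V W].
- exists (fun _ _ => K^o : vectType K) => W.
  by apply: functional_extensionality_dep => i;
    apply: functional_extensionality_dep => j; case: (F i j).
- by exists (fun _ _ => 0) => g; apply: mat_eq => i j; case: (F i j).
Qed.

Definition mat_hcomp (n m p : nat) :
  functor (prod_category (mat_cat n m) (mat_cat m p)) (mat_cat n p).
Proof.
refine (@Functor (prod_category (mat_cat n m) (mat_cat m p)) (mat_cat n p)
  (fun VW i j => dsum (fun k => tensor (VW.1 i k) (VW.2 k j)))
  (fun VW VW' fg i j => dmap (fun k => tmap (fg.1 i k) (fg.2 k j))) _ _).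
- move=> [V W]; apply: mat_eq => i j /=; apply/lfunP; dsum_ext => k t.
  by rewrite dmapE tmap1 !id_lfunE.
- move=> [U X] [V Y] [W Z] [g g'] [f f']; apply: mat_eq => i j /=.
  apply/lfunP; dsum_ext => k t.
  by rewrite comp_lfunE !dmapE tmapM comp_lfunE.
Defined.

Definition unit_entry n (i j : 'I_n) : vectType K :=
  if i == j then (K^o : vectType K) else ('rV[K]_0 : vectType K).

Definition mat_unit n : mat_cat n n := @unit_entry n.
Arguments mat_unit n : clear implicits.

(** The identification of the diagonal entries of the unit matrix with [K],
    and the zero map off the diagonal. *)
Definition unit_eps n (i j : 'I_n) : 'Hom(unit_entry i j, K^o) :=
  match i == j as b
    return 'Hom(if b then (K^o : vectType K) else ('rV[K]_0 : vectType K), K^o)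
  with true => \1%VF | false => 0 end.

Definition unit_eta n (i j : 'I_n) : 'Hom(K^o, unit_entry i j) :=
  match i == j as b
    return 'Hom(K^o, if b then (K^o : vectType K) else ('rV[K]_0 : vectType K))
  with true => \1%VF | false => 0 end.

Lemma unit_epsK n (i : 'I_n) : cancel (unit_eps i i) (unit_eta i i).
Proof.
rewrite /unit_eps /unit_eta /unit_entry eqxx => x.
by rewrite !id_lfunE.
Qed.

Lemma unit_etaK n (i : 'I_n) : cancel (unit_eta i i) (unit_eps i i).
Proof.
rewrite /unit_eps /unit_eta /unit_entry eqxx => x.
by rewrite !id_lfunE.
Qed.

Lemma unit_entry0 n (i j : 'I_n) (x : unit_entry i j) : i != j -> x = 0.
Proof.
rewrite /unit_entry in x * => /negPf ij; move: x; rewrite ij => x.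
by rewrite [x]thinmx0.
Qed.

Section Assoc.
Variables (n m p q : nat).
Variables (V : mat_cat n m) (W : mat_cat m p) (X : mat_cat p q).

(** [(v (x) w) (x) x |-> v (x) (w (x) x)] on each summand, see [mat_assocE]. *)
Definition mat_assoc :
    mor (mat_hcomp n p q (mat_hcomp n m p (V, W), X))
        (mat_hcomp n m q (V, mat_hcomp m p q (W, X))) := fun i l =>
  dlift (fun k => tlift (fun s (x : X k l) =>
    dlift (fun j => tlift (fun (v : V i j) (w : W j k) =>
      dinj j (pure v (dinj k (pure w x))))) s)).

Definition mat_assocV :
    mor (mat_hcomp n m q (V, mat_hcomp m p q (W, X)))
        (mat_hcomp n p q (mat_hcomp n m p (V, W), X)) := fun i l =>
  dlift (fun j => tlift (fun (v : V i j) s =>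
    dlift (fun k => tlift (fun (w : W j k) (x : X k l) =>
      dinj k (pure (dinj j (pure v w)) x))) s)).

Lemma mat_assoc_bilin k l (x : X k l) i j :
  bilin (fun (v : V i j) (w : W j k) =>
    dinj (V := fun j => tensor (V i j) (mat_hcomp m p q (W, X) j l))
      j (pure v (dinj k (pure w x)))).
Proof.
split=> [w|v] a y z.
- by rewrite pure_linear_l dinj_linear.
- by rewrite pure_linear_l dinj_linear pure_linear_r dinj_linear.
Qed.

Lemma mat_assocV_bilin i j (v : V i j) k l :
  bilin (fun (w : W j k) (x : X k l) =>
    dinj (V := fun k => tensor (mat_hcomp n m p (V, W) i k) (X k l))
      k (pure (dinj j (pure v w)) x)).
Proof.
split=> [x|w] a y z.
- by rewrite pure_linear_r dinj_linear pure_linear_l dinj_linear.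
- by rewrite pure_linear_r dinj_linear.
Qed.

Lemma mat_assocE i j k l (v : V i j) (w : W j k) (x : X k l) :
  mat_assoc i l (dinj k (pure (dinj j (pure v w)) x)) =
  dinj j (pure v (dinj k (pure w x))).
Proof.
rewrite /mat_assoc dliftE; last by move=> k'; apply: lfun_linear.
rewrite tliftE; last first.
  split=> [x'|s]; first exact: lfun_linear.
  move=> a y z.
  apply: (dlift_linear (b := fun (x : X k l) j => tlift (fun (v : V i j) w =>
      dinj (V := fun j => tensor (V i j) (mat_hcomp m p q (W, X) j l))
        j (pure v (dinj k (pure w x)))))) => [j' t|x' j'];
    last exact: lfun_linear.
  move=> b y' z'.
  apply: (tlift_linear (b := fun (x : X k l) (v : V i j') (w : W j' k) =>
    dinj (V := fun j => tensor (V i j) (mat_hcomp m p q (W, X) j l))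
      j' (pure v (dinj k (pure w x))))) => v' w' c y1 z1.
  by rewrite pure_linear_r dinj_linear pure_linear_r dinj_linear.
rewrite dliftE; last by move=> j'; apply: lfun_linear.
by rewrite (tliftE (mat_assoc_bilin _ _ _)).
Qed.

Lemma mat_assocVE i j k l (v : V i j) (w : W j k) (x : X k l) :
  mat_assocV i l (dinj j (pure v (dinj k (pure w x)))) =
  dinj k (pure (dinj j (pure v w)) x).
Proof.
rewrite /mat_assocV dliftE; last by move=> k'; apply: lfun_linear.
rewrite tliftE; last first.
  split=> [s|x']; last exact: lfun_linear.
  move=> a y z.
  apply: (dlift_linear (b := fun (v : V i j) k => tlift (fun w (x : X k l) =>
      dinj (V := fun k => tensor (mat_hcomp n m p (V, W) i k) (X k l))
        k (pure (dinj j (pure v w)) x)))) => [k' t|x' k'];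
    last exact: lfun_linear.
  move=> b y' z'.
  apply: (tlift_linear (b := fun (v : V i j) (w : W j k') (x : X k' l) =>
    dinj (V := fun k => tensor (mat_hcomp n m p (V, W) i k) (X k l))
      k' (pure (dinj j (pure v w)) x))) => v' w' c y1 z1.
  by rewrite pure_linear_l dinj_linear pure_linear_l dinj_linear.
rewrite dliftE; last by move=> j'; apply: lfun_linear.
by rewrite (tliftE (mat_assocV_bilin _ _ _)).
Qed.

End Assoc.

Section Unitors.
Variables (n m : nat) (V : mat_cat n m).

Definition mat_lunit : mor (mat_hcomp n n m (mat_unit n, V)) V := fun i j =>
  linfun (fun x => tlunit (V i j) (tmap (unit_eps i i) \1 (dproj i x))).

Definition mat_lunitV : mor V (mat_hcomp n n m (mat_unit n, V)) := fun i j =>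
  linfun (fun v => dinj i (pure (unit_eta i i 1) v)).

Definition mat_runit : mor (mat_hcomp n m m (V, mat_unit m)) V := fun i j =>
  linfun (fun x => trunit (V i j) (tmap \1 (unit_eps j j) (dproj j x))).

Definition mat_runitV : mor V (mat_hcomp n m m (V, mat_unit m)) := fun i j =>
  linfun (fun v => dinj j (pure v (unit_eta j j 1))).

Lemma mat_lunitE i j (a : unit_entry i i) (v : V i j) :
  mat_lunit i j (dinj i (pure a v)) = (unit_eps i i a : K) *: v.
Proof.
rewrite linfunE; last by move=> b x y; rewrite dprojD dprojZ !linearP.
by rewrite dprojK tmapE id_lfunE tlunitE.
Qed.

Lemma mat_runitE i j (v : V i j) (a : unit_entry j j) :
  mat_runit i j (dinj j (pure v a)) = (unit_eps j j a : K) *: v.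
Proof.
rewrite linfunE; last by move=> b x y; rewrite dprojD dprojZ !linearP.
by rewrite dprojK tmapE id_lfunE trunitE.
Qed.

Lemma mat_lunitVE i j (v : V i j) :
  mat_lunitV i j v = dinj i (pure (unit_eta i i 1) v).
Proof. by rewrite linfunE // => a x y; rewrite pure_linear_r dinj_linear. Qed.

Lemma mat_runitVE i j (v : V i j) :
  mat_runitV i j v = dinj j (pure v (unit_eta j j 1)).
Proof. by rewrite linfunE // => a x y; rewrite pure_linear_l dinj_linear. Qed.

End Unitors.

Lemma dinj0 n (V : 'I_n -> vectType K) k : dinj k (0 : V k) = 0 :> dsum V.
Proof. by apply: (addIr (dinj k 0)); rewrite -dinjD !add0r. Qed.

Lemma mat_assocK n m p q (V : mat_cat n m) (W : mat_cat m p)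
    (X : mat_cat p q) i l :
  (mat_assocV V W X i l \o mat_assoc V W X i l = \1)%VF.
Proof.
apply/lfunP; dsum_ext => k; tensor_ext => s x; move: s.
dsum_ext => j; tensor_ext => v w.
by rewrite comp_lfunE mat_assocE mat_assocVE id_lfunE.
Qed.

Lemma mat_assocVK n m p q (V : mat_cat n m) (W : mat_cat m p)
    (X : mat_cat p q) i l :
  (mat_assoc V W X i l \o mat_assocV V W X i l = \1)%VF.
Proof.
apply/lfunP; dsum_ext => j; tensor_ext => v s; move: s.
dsum_ext => k; tensor_ext => w x.
by rewrite comp_lfunE mat_assocVE mat_assocE id_lfunE.
Qed.

Definition mat_assoc_iso n m p q (V : mat_cat n m) (W : mat_cat m p)
    (X : mat_cat p q) :
    iso (mat_hcomp n p q (mat_hcomp n m p (V, W), X))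
        (mat_hcomp n m q (V, mat_hcomp m p q (W, X))) :=
  @Iso (mat_cat n q) _ _ (mat_assoc V W X) (mat_assocV V W X)
    (mat_eq (mat_assocK V W X)) (mat_eq (mat_assocVK V W X)).

Lemma mat_lunitK n m (V : mat_cat n m) i j :
  (mat_lunitV V i j \o mat_lunit V i j = \1)%VF.
Proof.
apply/lfunP; dsum_ext => k; tensor_ext => a v; rewrite comp_lfunE id_lfunE.
have [ik|ik] := eqVneq i k; last first.
  by rewrite (unit_entry0 a ik) pure0l dinj0 !linear0.
case: _ / ik a v => a v.
rewrite mat_lunitE mat_lunitVE pureZr -pureZl -linearZ /=.
by rewrite [_ *: 1]mulr1 unit_epsK.
Qed.

Lemma mat_lunitVK n m (V : mat_cat n m) i j :
  (mat_lunit V i j \o mat_lunitV V i j = \1)%VF.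
Proof.
apply/lfunP => v.
by rewrite comp_lfunE mat_lunitVE mat_lunitE unit_etaK scale1r id_lfunE.
Qed.

Definition mat_lunit_iso n m (V : mat_cat n m) :
    iso (mat_hcomp n n m (mat_unit n, V)) V :=
  @Iso (mat_cat n m) _ _ (mat_lunit V) (mat_lunitV V)
    (mat_eq (mat_lunitK V)) (mat_eq (mat_lunitVK V)).

Lemma mat_runitK n m (V : mat_cat n m) i j :
  (mat_runitV V i j \o mat_runit V i j = \1)%VF.
Proof.
apply/lfunP; dsum_ext => k; tensor_ext => v a; rewrite comp_lfunE id_lfunE.
have [jk|kj] := eqVneq j k; last first.
  by rewrite eq_sym in kj; rewrite (unit_entry0 a kj) pure0r dinj0 !linear0.
case: _ / jk a v => a v.
rewrite mat_runitE mat_runitVE pureZl -pureZr -linearZ /=.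
by rewrite [_ *: 1]mulr1 unit_epsK.
Qed.

Lemma mat_runitVK n m (V : mat_cat n m) i j :
  (mat_runit V i j \o mat_runitV V i j = \1)%VF.
Proof.
apply/lfunP => v.
by rewrite comp_lfunE mat_runitVE mat_runitE unit_etaK scale1r id_lfunE.
Qed.

Definition mat_runit_iso n m (V : mat_cat n m) :
    iso (mat_hcomp n m m (V, mat_unit m)) V :=
  @Iso (mat_cat n m) _ _ (mat_runit V) (mat_runitV V)
    (mat_eq (mat_runitK V)) (mat_eq (mat_runitVK V)).

Lemma mat_assoc_nat n m p q (V V' : mat_cat n m) (W W' : mat_cat m p)
    (X X' : mat_cat p q) (f : mor V V') (g : mor W W') (h : mor X X') :
  vcomp (mat_assoc_iso V' W' X')
    (bimap (mat_hcomp n p q) (bimap (mat_hcomp n m p) f g) h) =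
  vcomp (bimap (mat_hcomp n m q) f (bimap (mat_hcomp m p q) g h))
    (mat_assoc_iso V W X).
Proof.
apply: mat_eq => i l /=; apply/lfunP.
dsum_ext => k; tensor_ext => s x; move: s; dsum_ext => j; tensor_ext => v w.
by rewrite !comp_lfunE mat_assocE !(dmapE, tmapE) mat_assocE.
Qed.

Lemma mat_lunit_nat n m (V V' : mat_cat n m) (f : mor V V') :
  vcomp (mat_lunit_iso V') (bimap (mat_hcomp n n m) (idm (mat_unit n)) f) =
  vcomp f (mat_lunit_iso V).
Proof.
apply: mat_eq => i j /=; apply/lfunP.
dsum_ext => k; tensor_ext => a v; rewrite !comp_lfunE dmapE tmapE id_lfunE.
have [ik|ik] := eqVneq i k; last first.
  by rewrite (unit_entry0 a ik) !pure0l !dinj0 !linear0.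
by case: _ / ik a v => a v; rewrite !mat_lunitE linearZ.
Qed.

Lemma mat_runit_nat n m (V V' : mat_cat n m) (f : mor V V') :
  vcomp (mat_runit_iso V') (bimap (mat_hcomp n m m) f (idm (mat_unit m))) =
  vcomp f (mat_runit_iso V).
Proof.
apply: mat_eq => i j /=; apply/lfunP.
dsum_ext => k; tensor_ext => v a; rewrite !comp_lfunE dmapE tmapE id_lfunE.
have [jk|kj] := eqVneq j k; last first.
  by rewrite eq_sym in kj; rewrite (unit_entry0 a kj) !pure0r !dinj0 !linear0.
by case: _ / jk a v => a v; rewrite !mat_runitE linearZ.
Qed.

Lemma mat_pentagon n m p q r (V : mat_cat n m) (W : mat_cat m p)
    (X : mat_cat p q) (Y : mat_cat q r) :
  vcomp (mat_assoc_iso V W (mat_hcomp p q r (X, Y)))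
    (mat_assoc_iso (mat_hcomp n m p (V, W)) X Y) =
  vcomp (vcomp (bimap (mat_hcomp n m r) (idm V) (mat_assoc_iso W X Y))
               (mat_assoc_iso V (mat_hcomp m p q (W, X)) Y))
    (bimap (mat_hcomp n q r) (mat_assoc_iso V W X) (idm Y)).
Proof.
apply: mat_eq => i l /=; apply/lfunP.
dsum_ext => h; tensor_ext => s y; move: s.
dsum_ext => k; tensor_ext => s x; move: s.
dsum_ext => j; tensor_ext => v w.
by rewrite !comp_lfunE !(mat_assocE, dmapE, tmapE, id_lfunE).
Qed.

Lemma mat_triangle n m p (V : mat_cat n m) (W : mat_cat m p) :
  vcomp (bimap (mat_hcomp n m p) (idm V) (mat_lunit_iso W))
    (mat_assoc_iso V (mat_unit m) W) =
  bimap (mat_hcomp n m p) (mat_runit_iso V) (idm W).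
Proof.
apply: mat_eq => i l /=; apply/lfunP.
dsum_ext => k; tensor_ext => s w; move: s; dsum_ext => j; tensor_ext => v a.
rewrite comp_lfunE mat_assocE !(dmapE, tmapE, id_lfunE).
have [jk|jk] := eqVneq j k; last first.
  by rewrite (unit_entry0 a jk) pure0l pure0r !dinj0 !linear0 pure0l pure0r
    !dinj0.
case: _ / jk a w => a w.
by rewrite mat_lunitE mat_runitE pureZl pureZr.
Qed.

Definition Vect2 : bicategory :=
  @Bicategory nat mat_cat mat_hcomp mat_unit mat_assoc_iso
    mat_lunit_iso mat_runit_iso mat_assoc_nat mat_lunit_nat mat_runit_nat
    mat_pentagon mat_triangle.

End Matrices.

(* Main.v *)
(* Let [F] send [n] to the category of rows of length [n] of finite-dimensional
   vector spaces, and a matrix [V] to the module functor [M |-> M <> V].  On unit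
   rows such functors and their transformations are read off as matrices, so [F]
   is fully faithful on 2-cells.  A module functor [H] is automatically linear on
   morphisms, and hence is isomorphic to multiplication by the matrix of its
   values on unit rows.  Rows of length [n] are equivalent to [K^n]-modules, so
   [F] is also essentially surjective on objects.  A pseudofunctor with these
   properties has an inverse: choose equivalences [e_c : F (G c) -> c] and
   fillings [F (G f) <> e_d ~ e_c <> f]; as [b |-> F b <> e_d] is fully faithful,
   there is a unique pseudofunctor structure on [G] making these fillings a
   natural 2-isomorphism. *)
From Pilot Require Import Defs.
From mathcomp Require Import all_boot all_algebra.
From mathcomp Require Import boolp.
Import Pilot.Defs.

Set Implicit Arguments.
Unset Strict Implicit.
Unset Printing Implicit Defensive.

Local Open Scope cat_scope.

(** * Equivalences of module categories *)

(** Rows of length [n] are the matrices in [mat_cat K 1 n], so [F] is the pseudofunctor of 1-cells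
    out of the object 1, and its coherence laws are laws of matrix multiplication with a row as
    first factor. [K^n]-modules serve to place rows among the objects of the target and to reach
    every object of it. The target is strict: its constraints have identity components, so an
    equation of 2-cells becomes an equation of morphisms at each object [M]. The inversion of
    pseudofunctors into [modbicat P] exploits this throughout. The obstacle is that the structure
    morphisms of a 1-cell need not be invertible. Full faithfulness and essential surjectivity alone
    do not equip a quasi-inverse with a module structure; the equivalences used here are kept
    strong, so that [mstr] can be cancelled. Existence statements such as essential surjectivity are
    turned into data by choice. *)

Lemma inhabited_elt (T : Type) : inhabited T -> T.
Proof.
by move=> iT; have [x _] : {x : T | True} by apply: cid; case: iT => x; exists x.
Qed.

Section Isos.
Variable C : category.

(* Reassociated forms of equations, for rewriting inside left-bracketed
   composites. *)
Lemma comp_eq2 (x y z t : C) (k : mor z t) (g : mor y z) (f : mor x y) h :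
  g \o f = h -> k \o g \o f = k \o h.
Proof. by move=> <-; rewrite compA. Qed.

Lemma comp_eq3 (x y z t u : C) (k : mor t u) (g : mor z t) (f : mor y z)
    (e : mor x y) h :
  g \o f \o e = h -> k \o g \o f \o e = k \o h.
Proof. by move=> <-; rewrite !compA. Qed.

Lemma iso_mono (x y z : C) (f : iso y z) (g h : mor x y) :
  f \o g = f \o h -> g = h.
Proof. by move=> e; rewrite -[g]comp1m -(bwdK f) -compA e compA bwdK comp1m. Qed.

Lemma iso_epi (x y z : C) (f : iso x y) (g h : mor y z) :
  g \o f = h \o f -> g = h.
Proof. by move=> e; rewrite -[g]compm1 -(fwdK f) compA e -compA fwdK compm1. Qed.

Definition inv_iso (x y : C) (f : iso x y) : iso y x := Iso (fwdK f) (bwdK f).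

Lemma is_isoP (x y : C) (f : mor x y) : is_iso f -> exists i : iso x y, fwd i = f.
Proof. by case=> g [gf fg]; exists (Iso gf fg). Qed.

Lemma is_iso_comp (x y z : C) (g : mor y z) (f : mor x y) :
  is_iso g -> is_iso f -> is_iso (g \o f).
Proof.
by case/is_isoP=> j <- /is_isoP[i <-]; exact: (iso_is_iso (comp_iso j i)).
Qed.

Lemma is_iso_fmap (D : category) (F : functor C D) (x y : C) (f : mor x y) :
  is_iso f -> is_iso (fmap F f).
Proof. by case/is_isoP=> i <-; exact: (iso_is_iso (fmap_iso F i)). Qed.

End Isos.

Definition bimap_iso (C D E : category) (F : functor (prod_category C D) E)
    (x x' : C) (y y' : D) (f : iso x x') (g : iso y y') :
  iso (F (x, y)) (F (x', y')).
Proof.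
by apply: (@Iso E _ _ (bimap F f g) (bimap F (bwd f) (bwd g)));
  rewrite -bimapM ?bwdK ?fwdK bimap1.
Defined.

Lemma fmap_isoE (C D : category) (F : functor C D) (x y : C) (f : iso x y) :
  fwd (fmap_iso F f) = fmap F f.
Proof. by []. Qed.

(** * Full, faithful and essentially surjective functors *)

Section FullyFaithful.
Variables C D : category.

Definition faithful (F : functor C D) : Prop :=
  forall (x y : C) (f g : mor x y), fmap F f = fmap F g -> f = g.

Definition full (F : functor C D) : Prop :=
  forall (x y : C) (g : mor (F x) (F y)), exists f, fmap F f = g.

Definition ess_surjective (F : functor C D) : Prop :=
  forall y, exists x, inhabited (iso (F x) y).

Lemma full_iso (F : functor C D) : full F -> faithful F ->
  forall (x y : C) (i : iso (F x) (F y)), exists j : iso x y, fmap F j = i.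
Proof.
move=> Ff Fi x y i; have [f fi] := Ff _ _ i; have [g gi] := Ff _ _ (bwd i).
suff [gf fg] : g \o f = idm x /\ f \o g = idm y by exists (Iso gf fg).
by split; apply: Fi; rewrite fmapM fi gi ?bwdK ?fwdK fmap1.
Qed.

Lemma faithful_is_iso (F : functor C D) : full F -> faithful F ->
  forall (x y : C) (f : mor x y), is_iso (fmap F f) -> is_iso f.
Proof.
move=> Ff Fi x y f /is_isoP[i iE]; have [j jE] := full_iso Ff Fi i.
have -> : f = j by apply: Fi; rewrite jE iE.
exact: iso_is_iso.
Qed.

End FullyFaithful.

Lemma quasi_inverse_sym (C D : category) (F : functor C D) (G : functor D C) :
  quasi_inverse F G -> quasi_inverse G F.
Proof. by case. Qed.

Lemma quasi_inverse_faithful (C D : category) (F : functor C D)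
  (G : functor D C) : quasi_inverse F G -> faithful F.
Proof.
move=> [[a ai] _] x y f g e; have /is_isoP[i iE] := ai x.
apply: (iso_epi (f := i)); rewrite iE.
have nf := natural a f; have ng := natural a g; rewrite /= in nf ng.
by rewrite -nf -ng e.
Qed.

Lemma quasi_inverse_full (C D : category) (F : functor C D)
  (G : functor D C) : quasi_inverse F G -> full F.
Proof.
move=> qi x y g; have Gi := quasi_inverse_faithful (quasi_inverse_sym qi).
case: qi => [[a ai] _]; have /is_isoP[i iE] := ai x; have /is_isoP[j jE] := ai y.
(* The preimage is [fmap G g] conjugated by [a]. That [F] sends it to [g] is checked after applying
   [G], which is faithful by the symmetric argument. *)
exists (j \o fmap G g \o bwd i); apply: Gi.
have n := natural a (j \o fmap G g \o bwd i); rewrite /= -jE -iE in n.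
by apply: (iso_mono (f := j)); rewrite n -!compA bwdK compm1.
Qed.

Lemma quasi_inverse_ess_surjective (C D : category) (F : functor C D)
  (G : functor D C) : quasi_inverse F G -> ess_surjective F.
Proof.
by move=> [_ [b bi]] y; exists (G y); have /is_isoP[i _] := bi y; constructor.
Qed.

Section ModuleEquivalences.
Variable V : monoidal.

(** Invertibility of [mstr] is not at stake: solving [mtrans_str] for the inverse only cancels [a]
    at [M \box X] and [a M \Box idm X]. *)
Lemma modtrans_iso (C D : modcat V) (F G : modfunctor C D) (a : modtrans F G) :
  (forall M, is_iso (a M)) -> exists i : @iso (modhom C D) F G, fwd i = a.
Proof.
move=> ai; pose i M := projT1 (cid (is_isoP (ai M))).
have iE M : fwd (i M) = a M := projT2 (cid (is_isoP (ai M))).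
have bn M N (f : mor M N) : bwd (i N) \o fmap G f = fmap F f \o bwd (i M).
  apply: (iso_mono (f := i N)); apply: (iso_epi (f := i M)).
  by rewrite compA fwdK comp1m -!compA bwdK compm1 !iE natural.
have bs M X : mstr F M X \o bwd (i (M \box X)) =
    (bwd (i M) \Box idm X) \o mstr G M X.
  apply: (iso_mono (f := bimap_iso (mact D) (i M) (id_iso X))) => /=.
  apply: (iso_epi (f := i (M \box X))).
  rewrite -!compA bwdK compm1 compA -bimapM fwdK comp1m bimap1 comp1m.
  by rewrite iE [in RHS]iE mtrans_str.
pose b : modtrans G F := @ModTrans _ _ _ G F
  (@NatTrans _ _ G F (fun M => bwd (i M)) bn) bs.
by exists (@modhom_iso _ _ _ F G a b
  (fun M => etrans (congr1 _ (esym (iE M))) (bwdK _))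
  (fun M => etrans (congr1 (fun f => f \o _) (esym (iE M))) (fwdK _))).
Qed.

Lemma strong_equiv_comp (C D E : modcat V) (F : modfunctor C D) (G : modfunctor D E) :
    [/\ strong F, full F, faithful F & ess_surjective F] ->
    [/\ strong G, full G, faithful G & ess_surjective G] ->
  [/\ strong (comp_modfunctor F G), full (comp_modfunctor F G),
    faithful (comp_modfunctor F G) & ess_surjective (comp_modfunctor F G)].
Proof.
move=> [sF fF iF eF] [sG fG iG eG]; split.
- by move=> M X; apply: is_iso_comp (sG _ _) (is_iso_fmap _ (sF M X)).
- by move=> M N g; have [g' <-] := fG _ _ g; have [f <-] := fF _ _ g'; exists f.
- by move=> M N f g /iG/iF.
- move=> z; have [y [j]] := eG z; have [x [i]] := eF y; exists x; constructor.
  exact: (comp_iso j (fmap_iso G i)).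
Qed.

(** * Quasi-inverse of a strong module functor *)

Section QuasiInverse.
Variables (C D : modcat V) (E : modfunctor C D).
Hypotheses (sE : strong E) (fullE : full E) (faithE : faithful E).
Hypothesis surjE : ess_surjective E.

Let q y : C := projT1 (cid (surjE y)).

Let b y : iso (E (q y)) y := inhabited_elt (projT2 (cid (surjE y))).

Let lift (x y : C) (g : mor (E x) (E y)) : mor x y := projT1 (cid (fullE g)).

Let liftK (x y : C) (g : mor (E x) (E y)) : fmap E (lift g) = g.
Proof. exact: (projT2 (cid (fullE g))). Qed.

Let s M X : iso (E (M \box X)) (E M \box X) := projT1 (cid (is_isoP (sE M X))).

Let sK M X : fwd (s M X) = mstr E M X.
Proof. exact: (projT2 (cid (is_isoP (sE M X)))). Qed.

Let qmap (x y : D) (f : mor x y) : mor (q x) (q y) := lift (bwd (b y) \o f \o b x).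

Let qmapE x y (f : mor x y) : b y \o fmap E (qmap f) = f \o b x.
Proof. by rewrite liftK !compA fwdK comp1m. Qed.

Let bE_inj x y (f g : mor x (q y)) : b y \o fmap E f = b y \o fmap E g -> f = g.
Proof. by move/iso_mono/faithE. Qed.

Let Q0 : functor D C.
Proof.
apply: (@Functor D C q qmap) => [x|x y z g f]; apply: bE_inj; rewrite qmapE.
- by rewrite fmap1 comp1m compm1.
- by rewrite fmapM !compA qmapE -!compA qmapE.
Defined.

(* The module structure of the quasi-inverse is the only one for which [b] is a
   module transformation. *)
Let qstr M X : mor (q (M \box X)) (q M \box X) :=
  lift (bwd (s (q M) X) \o (bwd (b M) \Box idm X) \o b (M \box X)).

Let qstrE M X : (b M \Box idm X) \o mstr E (q M) X \o fmap E (qstr M X) =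
  b (M \box X).
Proof.
rewrite liftK -sK !compA -(compA _ (s _ _)) fwdK compm1 -bimapM fwdK comp1m.
by rewrite bimap1 comp1m.
Qed.

(** Morphisms into [q M \box X] are tested after applying [E] and the composite that defines [qstr].
    Strength of [E] makes that composite cancellable; the module functor laws of [Q] are then those
    of [E] and of [D]. *)
Let sE_inj x M X (f g : mor x (q M \box X)) :
  (b M \Box idm X) \o mstr E (q M) X \o fmap E f =
  (b M \Box idm X) \o mstr E (q M) X \o fmap E g -> f = g.
Proof.
rewrite -!compA => /(iso_mono (f := bimap_iso (mact D) (b M) (id_iso X))).
by rewrite -sK => /iso_mono/faithE.
Qed.

Let Q : modfunctor D C.
Proof.
apply: (@ModFunctor V D C Q0 qstr).
- move=> M M' X X' f g; apply: sE_inj.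
  have bn : (b M' \Box idm X') \o (fmap E (qmap f) \Box g) =
    (f \Box g) \o (b M \Box idm X) by rewrite -!bimapM qmapE comp1m compm1.
  rewrite !fmapM !compA qstrE qmapE (comp_eq2 _ (mstr_nat _ _ _)) compA bn.
  by rewrite -!compA (compA (b M \Box _)) qstrE.
- move=> M X Y; apply: sE_inj.
  rewrite !fmapM !compA qstrE qmapE (comp_eq2 _ (esym (mstr_assoc _ _ _ _))).
  rewrite !compA -bimap1 -aassoc_nat.
  rewrite (comp_eq2 _ (esym (bimapMl _ _ _ _))).
  rewrite (comp_eq2 _ (mstr_nat _ _ _)) !compA.
  rewrite (comp_eq2 _ (esym (bimapMl _ _ _ _))) qstrE.
  by rewrite -!compA (compA (bimap _ (b _) _)) qstrE.
- move=> M; apply: bE_inj; rewrite qmapE fmapM -mstr_unit !compA.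
  by rewrite -aunit_nat -!compA (compA (b M \Box _)) qstrE.
Defined.

Let bt : modtrans (comp_modfunctor Q E) (id_modfunctor D).
Proof.
apply: (@ModTrans V D D _ _ (@NatTrans _ _ (comp_modfunctor Q E)
  (id_modfunctor D) (fun M => b M) (fun M N f => qmapE f)) _) => [M X] /=.
by rewrite comp1m compA qstrE.
Defined.

(** The isomorphism back to [M] is the [E]-preimage of [b (E M)], so that its naturality and module
    compatibility can be read off from those of [b] after applying [E]. *)
Let at0 M : iso (q (E M)) M :=
  projT1 (cid (full_iso fullE faithE (b (E M)))).

Let at0E M : fmap E (at0 M) = b (E M).
Proof. exact: (projT2 (cid (full_iso fullE faithE (b (E M))))). Qed.

Let at_ : modtrans (comp_modfunctor E Q) (id_modfunctor C).
Proof.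
apply: (@ModTrans V C C _ _ (@NatTrans _ _ (comp_modfunctor E Q)
  (id_modfunctor C) (fun M => at0 M) _)) => [M N f|sq M X] /=.
- by apply: faithE; rewrite !fmapM !at0E qmapE.
- rewrite comp1m; apply: faithE.
  apply: (iso_mono (f := s M X)); rewrite sK fmapM !compA mstr_nat !at0E.
  by rewrite fmapM compA qstrE qmapE.
Defined.

Lemma strong_equivalence : exists Q : modfunctor D C, strong Q /\
  (inhabited (iso (comp_modfunctor Q E : modhom D D) (id_modfunctor D)) /\
   inhabited (iso (comp_modfunctor E Q : modhom C C) (id_modfunctor C))).
Proof.
exists Q; split=> [M X|].
- apply: (faithful_is_iso fullE faithE); rewrite liftK.
  exact: (iso_is_iso (comp_iso (comp_iso (inv_iso (s _ _))
    (bimap_iso (mact D) (inv_iso (b M)) (id_iso X))) (b _))).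
- split.
  + by have [|i _] := @modtrans_iso _ _ _ _ bt; [move=> M; exact: iso_is_iso|].
  + by have [|i _] := @modtrans_iso _ _ _ _ at_; [move=> M; exact: iso_is_iso|].
Qed.

End QuasiInverse.

Lemma strong_module_equivalent (C D : modcat V) (E : modfunctor C D) :
  strong E -> full E -> faithful E -> ess_surjective E -> module_equivalent C D.
Proof.
move=> sE fE iE eE; have [Q [sQ [[i] [j]]]] := strong_equivalence sE fE iE eE.
have is_nat_iso_mod (A : modcat V) (G H : modhom A A) (k : iso G H) :
    is_nat_iso (mtrans (fwd k)).
  move=> M; exists ((bwd k : modtrans _ _) M).
  by split; [have := congr1 (fun a : modtrans _ _ => a M) (bwdK k)|
    have := congr1 (fun a : modtrans _ _ => a M) (fwdK k)].
exists E, Q; split=> //; split.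
- by exists (mtrans (fwd j)); exact: (is_nat_iso_mod _ _ _ j).
- by exists (mtrans (fwd i)); exact: (is_nat_iso_mod _ _ _ i).
Qed.

End ModuleEquivalences.

(** * Local equivalences of bicategories *)

(* In the bicategory of module categories [f \dia g] unfolds to
   [comp_modfunctor f g]; a conversion test between the two must unfold the
   bicategory first, or it ends up comparing the proofs inside the latter. *)
Strategy 100 [comp_modfunctor id_modfunctor modtrans_comp hcomp_modtrans
  modtrans_id].

Section Components.
Variables (V : monoidal) (P : modcat V -> Prop).
Local Notation B' := (modbicat P).

(* The views [mf] and [cmp] of 1-cells and 2-cells of the bicategory of module
   categories keep statements typed in that bicategory, not in [modhom]. *)
Definition mf (c d : B') (f : homcat c d) : modfunctor c d := f.

Definition cmp (c d : B') (f g : homcat c d) (a : mor f g) (M : c) :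
  mor (mf f M) (mf g M) := (a : modtrans (mf f) (mf g)) M.

Lemma cmp_eq (c d : B') (f g : homcat c d) (a b : mor f g) :
  (forall M, cmp a M = cmp b M) -> a = b.
Proof. exact: modtrans_eq. Qed.

Lemma cmp_id (c d : B') (f : homcat c d) M : cmp (idm f) M = idm _.
Proof. by []. Qed.

Lemma cmp_comp (c d : B') (f g h : homcat c d) (b : mor g h) (a : mor f g) M :
  cmp (b \o a) M = cmp b M \o cmp a M.
Proof. by []. Qed.

Lemma cmp_nat (c d : B') (f g : homcat c d) (a : mor f g) (M N : c)
    (u : mor M N) :
  cmp a N \o fmap (mf f) u = fmap (mf g) u \o cmp a M.
Proof. exact: natural. Qed.

Lemma cmp_dia (c d e : B') (f f' : homcat c d) (g g' : homcat d e)
    (a : mor f f') (b : mor g g') M :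
  cmp (a \Dia b) M = cmp b (mf f' M) \o fmap (mf g) (cmp a M).
Proof. by []. Qed.

Lemma cmp_bwdK (c d : B') (f g : homcat c d) (a : iso f g) M :
  cmp (bwd a) M \o cmp a M = idm _.
Proof. by rewrite -cmp_comp bwdK. Qed.

Lemma cmp_fwdK (c d : B') (f g : homcat c d) (a : iso f g) M :
  cmp a M \o cmp (bwd a) M = idm _.
Proof. by rewrite -cmp_comp fwdK. Qed.

Definition cmp_iso (c d : B') (f g : homcat c d) (a : iso f g) (M : c) :
  iso (mf f M) (mf g M) := Iso (cmp_bwdK a M) (cmp_fwdK a M).

Lemma is_iso_cmp (c d : B') (f g : homcat c d) (a : mor f g) :
  (forall M, is_iso (cmp a M)) -> exists i : iso f g, fwd i = a.
Proof. exact: modtrans_iso. Qed.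

(** The components are lifted through [E] one at a time. Naturality and compatibility with the
    action then follow from faithfulness, the latter after cancelling [mstr] of [E], where strength
    is used. *)
Lemma whisker_full (c d e : B') (f g : homcat c d) (E : homcat d e)
    (a : mor (f \dia E) (g \dia E)) :
  strong (mf E) -> full (mf E) -> faithful (mf E) ->
  exists b : mor f g, forall M, fmap (mf E) (cmp b M) = cmp a M.
Proof.
move=> sE fE iE; pose b M := projT1 (cid (fE _ _ (cmp a M))).
have bE M : fmap (mf E) (b M) = cmp a M := projT2 (cid (fE _ _ (cmp a M))).
have bn M N (u : mor M N) : b N \o fmap (mf f) u = fmap (mf g) u \o b M.
  apply: iE; rewrite !fmapM !bE; exact: (cmp_nat a u).
have bs M X : mstr (mf g) M X \o b (M \box X) = (b M \Box idm X) \o mstr (mf f) M X.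
  apply: iE; have [i iE'] := is_isoP (sE (mf g M) X).
  apply: (iso_mono (f := i)); rewrite iE' !fmapM compA bE.
  have := mtrans_str (a : modtrans (mf (f \dia E)) (mf (g \dia E))) M X.
  by rewrite /= => ->; rewrite !compA mstr_nat bE.
by exists (@ModTrans _ _ _ (mf f) (mf g) (NatTrans bn) bs).
Qed.

End Components.

Strategy -100 [mf cmp cmp_iso modbicat].

Section LocalEquivalence.
Variables (V : monoidal) (P : modcat V -> Prop) (B : bicategory).
Local Notation B' := (modbicat P).
Variable F : pseudofunctor B B'.

Hypothesis F_full : forall x y, full (phom F (x := x) (y := y)).
Hypothesis F_faithful : forall x y, faithful (phom F (x := x) (y := y)).
Hypothesis F_surj : forall x y, ess_surjective (phom F (x := x) (y := y)).

Definition cell_image x y (f g : homcat x y) (b : mor f g) (M : F x) :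
    mor (mf (phom F f) M) (mf (phom F g) M) :=
  cmp (fmap (phom F) b) M.

Lemma cell_image_inj x y (f g : homcat x y) (b b' : mor f g) :
  (forall M, cell_image b M = cell_image b' M) -> b = b'.
Proof. by move=> e; apply/F_faithful/cmp_eq. Qed.

Lemma cell_image1 x y (f : homcat x y) M : cell_image (idm f) M = idm _.
Proof. by rewrite /cell_image fmap1 cmp_id. Qed.

Lemma cell_imageM x y (f g h : homcat x y) (b : mor g h) (a : mor f g) M :
  cell_image (b \o a) M = cell_image b M \o cell_image a M.
Proof. by rewrite /cell_image fmapM cmp_comp. Qed.

Lemma cell_image_nat x y (f g : homcat x y) (b : mor f g) (M N : F x) (u : mor M N) :
  cell_image b N \o fmap (mf (phom F f)) u = fmap (mf (phom F g)) u \o cell_image b M.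
Proof. exact: cmp_nat. Qed.

Definition phi x y z (f : homcat x y) (g : homcat y z) (M : F x) :
    iso (mf (phom F g) (mf (phom F f) M)) (mf (phom F (f \dia g)) M) :=
  cmp_iso (phcomp F f g) M.

Definition phi0 x (M : F x) : iso M (mf (phom F (unit1 x)) M) :=
  cmp_iso (punit F x) M.

Lemma phi_nat x y z (f : homcat x y) (g : homcat y z) (M N : F x) (u : mor M N) :
  phi f g N \o fmap (mf (phom F g)) (fmap (mf (phom F f)) u) =
  fmap (mf (phom F (f \dia g))) u \o phi f g M.
Proof. exact: (cmp_nat (phcomp F f g) u). Qed.

Lemma phi0_nat x (M N : F x) (u : mor M N) :
  phi0 N \o u = fmap (mf (phom F (unit1 x))) u \o phi0 M.
Proof. exact: (cmp_nat (punit F x) u). Qed.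

Lemma cell_image_phi x y z (f f' : homcat x y) (g g' : homcat y z) (a : mor f f')
    (b : mor g g') M :
  cell_image (a \Dia b) M \o phi f g M =
  phi f' g' M \o cell_image b (mf (phom F f') M) \o
    fmap (mf (phom F g)) (cell_image a M).
Proof.
by rewrite -compA; exact: (congr1 (fun u => cmp u M) (esym (phcomp_nat F a b))).
Qed.

Lemma cell_image_phil x y z (f f' : homcat x y) (g : homcat y z) (a : mor f f') M :
  cell_image (a \Dia idm g) M \o phi f g M = phi f' g M \o
    fmap (mf (phom F g)) (cell_image a M).
Proof. by rewrite cell_image_phi cell_image1 compm1. Qed.

Lemma cell_image_phir x y z (f : homcat x y) (g g' : homcat y z) (b : mor g g') M :
  cell_image (idm f \Dia b) M \o phi f g M = phi f g' M \o
    cell_image b (mf (phom F f) M).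
Proof. by rewrite cell_image_phi cell_image1 !fmap1 compm1. Qed.

Lemma cell_image_assoc x y z t (f : homcat x y) (g : homcat y z) (k : homcat z t) M :
  cell_image (assoc f g k) M \o phi (f \dia g) k M \o
    fmap (mf (phom F k)) (phi f g M) =
  phi f (g \dia k) M \o phi g k (mf (phom F f) M).
Proof.
(* The identities are the components of the associator of module functors and of the identity
   2-cells being whiskered; with them displayed, the equation is [passoc] at [M]. *)
have e : cell_image (assoc f g k) M \o phi (f \dia g) k M \o
    (idm _ \o fmap (mf (phom F k)) (phi f g M)) =
    phi f (g \dia k) M \o (phi g k (mf (phom F f) M) \o
      fmap (mf (phom F k)) (fmap (mf (phom F g)) (idm _))) \o idm _.
  exact: (congr1 (fun a => cmp a M) (passoc F f g k)).
by move: e; rewrite comp1m compm1 !fmap1 compm1.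
Qed.

Lemma cell_image_assocV x y z t (f : homcat x y) (g : homcat y z) (k : homcat z t) M :
  cell_image (bwd (assoc f g k)) M \o phi f (g \dia k) M \o
    phi g k (mf (phom F f) M) =
  phi (f \dia g) k M \o fmap (mf (phom F k)) (phi f g M).
Proof.
by rewrite -compA -cell_image_assoc !compA -cell_imageM bwdK cell_image1 comp1m.
Qed.

Lemma cell_image_lunit x y (f : homcat x y) M :
  cell_image (lunit f) M \o phi (unit1 x) f M \o fmap (mf (phom F f)) (phi0 M) =
    idm _.
Proof.
have e : cell_image (lunit f) M \o phi (unit1 x) f M \o
    (idm _ \o fmap (mf (phom F f)) (phi0 M)) = idm _.
  exact: (congr1 (fun a => cmp a M) (plunit F f)).
by rewrite comp1m in e.
Qed.

Lemma cell_image_runit x y (f : homcat x y) M :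
  cell_image (runit f) M \o phi f (unit1 y) M \o phi0 (mf (phom F f) M) = idm _.
Proof.
have e : cell_image (runit f) M \o phi f (unit1 y) M \o
    (phi0 (mf (phom F f) M) \o idm _) = idm _.
  exact: (congr1 (fun a => cmp a M) (prunit F f)).
by rewrite compm1 in e.
Qed.

(* The data chosen from the essential surjectivity of [F] on objects and on
   1-cells. *)
Variable inv_ob : B' -> B.
Variable ceq : forall c : B', @homcat B' (F (inv_ob c)) c.
Hypothesis ceq_strong : forall c, strong (mf (ceq c)).
Hypothesis ceq_full : forall c, full (mf (ceq c)).
Hypothesis ceq_faithful : forall c, faithful (mf (ceq c)).
Hypothesis ceq_inv : forall c, quasi_invertible (ceq c).

Variable inv_mor : forall c d : B', homcat c d -> homcat (inv_ob c) (inv_ob d).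
Variable cofill : forall (c d : B') (f : homcat c d),
  iso (phom F (inv_mor f) \dia ceq d) (ceq c \dia f).

Definition cofill_at (c d : B') (f : homcat c d) M :
    iso (mf (ceq d) (mf (phom F (inv_mor f)) M)) (mf f (mf (ceq c) M)) :=
  cmp_iso (cofill f) M.

Lemma cofillK (c d : B') (f : homcat c d) M : cofill_at f M \o
  cmp (bwd (cofill f)) M = idm _.
Proof. exact: (cmp_fwdK (cofill f) M). Qed.

Lemma cofill_nat (c d : B') (f : homcat c d) (M N : F (inv_ob c)) (u : mor M N) :
  cofill_at f N \o fmap (mf (ceq d)) (fmap (mf (phom F (inv_mor f))) u) =
  fmap (mf f) (fmap (mf (ceq c)) u) \o cofill_at f M.
Proof. exact: (cmp_nat (cofill f) u). Qed.

(* The whiskering of [F b] with [ceq d]. It is faithful and full in [b], so that the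
   2-cells of the inverse pseudofunctor can be defined and compared through it. *)
Definition whisk (x : B) (d : B') (g g' : homcat x (inv_ob d)) (b : mor g g') M :
    mor (mf (ceq d) (mf (phom F g) M)) (mf (ceq d) (mf (phom F g') M)) :=
  fmap (mf (ceq d)) (cell_image b M).

Lemma whisk_inj x d (g g' : homcat x (inv_ob d)) (b b' : mor g g') :
  (forall M, whisk b M = whisk b' M) -> b = b'.
Proof. by move=> e; apply: cell_image_inj => M; apply: ceq_faithful (e M). Qed.

Lemma whisk_ex x d (g g' : homcat x (inv_ob d))
    (a : mor (phom F g \dia ceq d) (phom F g' \dia ceq d)) :
  exists b, forall M, @whisk x d g g' b M = cmp a M.
Proof.
have [b bE] := whisker_full a (@ceq_strong d) (@ceq_full d) (@ceq_faithful d).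
by have [b' b'E] := F_full b; exists b' => M; rewrite /whisk /cell_image b'E bE.
Qed.

Lemma whisk1 x d (g : homcat x (inv_ob d)) M : whisk (idm g) M = idm _.
Proof. by rewrite /whisk cell_image1 fmap1. Qed.

Lemma whiskM x d (g g' g'' : homcat x (inv_ob d)) (b : mor g' g'') (a : mor g g') M :
  whisk (b \o a) M = whisk b M \o whisk a M.
Proof. by rewrite /whisk cell_imageM fmapM. Qed.

Lemma whisk_ex_iso x d (g g' : homcat x (inv_ob d))
    (a : mor (phom F g \dia ceq d) (phom F g' \dia ceq d)) :
  (forall M, is_iso (cmp a M)) ->
  exists b : iso g g', forall M, whisk b M = cmp a M.
Proof.
move=> /is_iso_cmp[{}a <-].
have [b bE] := whisk_ex a; have [b' b'E] := whisk_ex (bwd a).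
have bb' : b' \o b = idm _.
  by apply: whisk_inj => M; rewrite whiskM bE b'E whisk1; exact: (cmp_bwdK a M).
have b'b : b \o b' = idm _.
  by apply: whisk_inj => M; rewrite whiskM bE b'E whisk1; exact: (cmp_fwdK a M).
by exists (Iso bb' b'b).
Qed.

Lemma cofill_inj c d (f : homcat c d) (g : homcat (inv_ob c) (inv_ob d))
    (b b' : mor g (inv_mor f)) :
  (forall M, cofill_at f M \o whisk b M = cofill_at f M \o whisk b' M) -> b = b'.
Proof. by move=> e; apply: whisk_inj => M; apply: iso_mono (e M). Qed.

(** The equation is [psi2_nat] for [cofill], read at [M]. By [cofill_inj] it has at most one
    solution, so functoriality of [inv_hom] is a matter of uniqueness. *)
Lemma inv_map_sig c d (f f' : homcat c d) (a : mor f f') :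
  {b : mor (inv_mor f) (inv_mor f') | forall M,
    cofill_at f' M \o whisk b M = cmp a (mf (ceq c) M) \o cofill_at f M}.
Proof.
have [b bE] := cid (whisk_ex (bwd (cofill f') \o (idm (ceq c) \Dia a) \o cofill f)).
exists b => M; rewrite bE !cmp_comp cmp_dia cmp_id fmap1 compm1 !compA.
by rewrite cofillK comp1m.
Qed.

Definition inv_map c d (f f' : homcat c d) (a : mor f f') : mor (inv_mor f)
  (inv_mor f') :=
  sval ((inv_map_sig a)).

Lemma inv_mapE c d (f f' : homcat c d) (a : mor f f') M :
  cofill_at f' M \o whisk (inv_map a) M = cmp a (mf (ceq c) M) \o cofill_at f M.
Proof. exact: (svalP ((inv_map_sig a))). Qed.

Definition inv_hom (c d : B') : functor (homcat c d) (homcat (inv_ob c) (inv_ob d)).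
Proof.
apply: (@Functor (homcat c d) (homcat (inv_ob c) (inv_ob d)) (@inv_mor c d)
  (@inv_map c d)).
- move=> f; apply: whisk_inj => M; apply: (iso_mono (f := cofill_at f M)).
  by rewrite inv_mapE whisk1 cmp_id comp1m compm1.
- move=> f g h b a; apply: whisk_inj => M; apply: (iso_mono (f := cofill_at h M)).
  by rewrite inv_mapE whiskM compA inv_mapE -compA inv_mapE compA cmp_comp.
Defined.

Lemma inv_hcomp_sig c d e (f : homcat c d) (g : homcat d e) :
  {i : iso (inv_mor f \dia inv_mor g) (inv_mor (f \dia g)) | forall M,
    cofill_at (f \dia g) M \o whisk i M \o
      fmap (mf (ceq e)) (phi (inv_mor f) (inv_mor g) M) =
    fmap (mf g) (cofill_at f M) \o cofill_at g (mf (phom F (inv_mor f)) M)}.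
Proof.
(* This is [psi2_comp] for [cofill], solved for the whiskering of the unknown constraint with
   [ceq e]. *)
pose a : mor (phom F (inv_mor f \dia inv_mor g) \dia ceq e)
             (phom F (inv_mor (f \dia g)) \dia ceq e) :=
  bwd (cofill (f \dia g)) \o assoc (ceq c) f g \o (cofill f \Dia idm g)
    \o bwd (assoc (phom F (inv_mor f)) (ceq d) g)
    \o (idm (phom F (inv_mor f)) \Dia cofill g)
    \o assoc (phom F (inv_mor f)) (phom F (inv_mor g)) (ceq e)
    \o (bwd (phcomp F (inv_mor f) (inv_mor g)) \Dia idm (ceq e)).
pose p M := fmap_iso (mf (ceq e)) (phi (inv_mor f) (inv_mor g) M).
have aE M : cmp a M = bwd (cofill_at (f \dia g) M) \o fmap (mf g) (cofill_at f M) \o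
    cofill_at g (mf (phom F (inv_mor f)) M) \o bwd (p M).
  by rewrite /a /cofill_at /p /phi /phi0 /cmp /= !compm1 !comp1m !fmap1 compm1.
have ai M : is_iso (cmp a M).
  rewrite aE.
  exact: (iso_is_iso (comp_iso (comp_iso (comp_iso (inv_iso (cofill_at (f \dia g) M))
    (fmap_iso (mf g) (cofill_at f M))) (cofill_at g _)) (inv_iso (p M)))).
have [i iE] := cid (whisk_ex_iso ai); exists i => M.
rewrite iE aE !compA -[fmap (mf (ceq e)) _]/(fwd (p M)) -compA bwdK.
by rewrite compm1 -!compA compA fwdK comp1m.
Qed.

Definition inv_hcomp c d e (f : homcat c d) (g : homcat d e) :
  iso (inv_mor f \dia inv_mor g) (inv_mor (f \dia g)) := sval ((inv_hcomp_sig f g)).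

Lemma inv_hcompE c d e (f : homcat c d) (g : homcat d e) M :
  cofill_at (f \dia g) M \o whisk (inv_hcomp f g) M \o
    fmap (mf (ceq e)) (phi (inv_mor f) (inv_mor g) M) =
  fmap (mf g) (cofill_at f M) \o cofill_at g (mf (phom F (inv_mor f)) M).
Proof. exact: (svalP ((inv_hcomp_sig f g))). Qed.

Lemma inv_unit_sig c : {i : iso (unit1 (inv_ob c)) (inv_mor (unit1 c)) | forall M,
  cofill_at (unit1 c) M \o whisk i M \o fmap (mf (ceq c)) (phi0 M) = idm _}.
Proof.
(* Likewise, [psi2_unit] solved for the whiskered unit constraint. *)
pose a : mor (phom F (unit1 (inv_ob c)) \dia ceq c)
  (phom F (inv_mor (unit1 c)) \dia ceq c) :=
  bwd (cofill (unit1 c)) \o bwd (runit (ceq c)) \o lunit (ceq c)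
   \o (bwd (punit F (inv_ob c)) \Dia idm (ceq c)).
pose p M := fmap_iso (mf (ceq c)) (phi0 M).
have aE M : cmp a M = bwd (cofill_at (unit1 c) M) \o bwd (p M).
  by rewrite /a /cofill_at /p /phi /phi0 /cmp /= !compm1 !comp1m.
have ai M : is_iso (cmp a M).
  by rewrite aE; exact: (iso_is_iso
    (comp_iso (inv_iso (cofill_at (unit1 c) M)) (inv_iso (p M)))).
have [i iE] := cid (whisk_ex_iso ai); exists i => M.
rewrite iE aE !compA -[fmap (mf (ceq c)) _]/(fwd (p M)) -compA bwdK.
by rewrite compm1 fwdK.
Qed.

Definition inv_unit c : iso (unit1 (inv_ob c)) (inv_mor (unit1 c)) :=
  sval ((inv_unit_sig c)).

Lemma inv_unitE c M :
  cofill_at (unit1 c) M \o whisk (inv_unit c) M \o fmap (mf (ceq c)) (phi0 M) =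
  idm _.
Proof. exact: (svalP ((inv_unit_sig c))). Qed.

Lemma whisk_phi x y d (f f' : homcat x y) (g g' : homcat y (inv_ob d)) (a : mor f f')
    (b : mor g g') M :
  whisk (a \Dia b) M \o fmap (mf (ceq d)) (phi f g M) =
  fmap (mf (ceq d)) (phi f' g' M) \o whisk b (mf (phom F f') M) \o
    fmap (mf (ceq d)) (fmap (mf (phom F g)) (cell_image a M)).
Proof. by rewrite /whisk -!fmapM cell_image_phi. Qed.

Lemma whisk_phil x y d (f f' : homcat x y) (g : homcat y (inv_ob d)) (a : mor f f')
  M :
  whisk (a \Dia idm g) M \o fmap (mf (ceq d)) (phi f g M) =
  fmap (mf (ceq d)) (phi f' g M) \o
    fmap (mf (ceq d)) (fmap (mf (phom F g)) (cell_image a M)).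
Proof. by rewrite /whisk -!fmapM cell_image_phil. Qed.

Lemma whisk_phir x y d (f : homcat x y) (g g' : homcat y (inv_ob d)) (b : mor g g')
  M :
  whisk (idm f \Dia b) M \o fmap (mf (ceq d)) (phi f g M) =
  fmap (mf (ceq d)) (phi f g' M) \o whisk b (mf (phom F f) M).
Proof. by rewrite /whisk -!fmapM cell_image_phir. Qed.

Lemma whisk_assoc x y z d (f : homcat x y) (g : homcat y z)
  (k : homcat z (inv_ob d)) M :
  whisk (assoc f g k) M \o fmap (mf (ceq d)) (phi (f \dia g) k M) \o
    fmap (mf (ceq d)) (fmap (mf (phom F k)) (phi f g M)) =
  fmap (mf (ceq d)) (phi f (g \dia k) M) \o
    fmap (mf (ceq d)) (phi g k (mf (phom F f) M)).
Proof. by rewrite /whisk -!fmapM cell_image_assoc. Qed.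

Lemma whisk_lunit x d (f : homcat x (inv_ob d)) M :
  whisk (lunit f) M \o fmap (mf (ceq d)) (phi (unit1 x) f M) \o
    fmap (mf (ceq d)) (fmap (mf (phom F f)) (phi0 M)) = idm _.
Proof. by rewrite /whisk -!fmapM cell_image_lunit fmap1. Qed.

Lemma whisk_runit x d (f : homcat x (inv_ob d)) M :
  whisk (runit f) M \o fmap (mf (ceq d)) (phi f (unit1 _) M) \o
    fmap (mf (ceq d)) (phi0 (mf (phom F f) M)) = idm _.
Proof. by rewrite /whisk -!fmapM cell_image_runit fmap1. Qed.

Lemma inv_hcomp_nat c d e (f f' : homcat c d) (g g' : homcat d e) (a : mor f f')
    (b : mor g g') :
  inv_hcomp f' g' \o (fmap (inv_hom c d) a \Dia fmap (inv_hom d e) b) =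
  fmap (inv_hom c e) (a \Dia b) \o inv_hcomp f g.
Proof.
apply: cofill_inj => M.
pose p := fmap_iso (mf (ceq e)) (phi (inv_mor f) (inv_mor g) M).
apply: (iso_epi (f := p)).
rewrite !whiskM !compA inv_mapE (comp_eq2 _ (whisk_phi _ _ _)) !compA inv_hcompE.
rewrite (comp_eq2 _ (inv_mapE b _)) !compA (comp_eq2 _ (cofill_nat _ _)) !compA.
rewrite (comp_eq3 _ (inv_hcompE f g M)) cmp_dia !compA.
rewrite -(cmp_nat b (cofill_at f' M))
  (comp_eq2 _ (esym (fmapM (mf g) (cofill_at f' M) _))).
by rewrite -[fmap (mf (ceq d)) _]/(whisk (inv_map a) M) inv_mapE fmapM !compA.
Qed.

(** After composition with the filling of the triple composite and with the comparison isomorphisms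
    of [F], both sides become the fillings of [k], [g] and [f] applied in turn. *)
Lemma inv_assoc c d e h (f : homcat c d) (g : homcat d e) (k : homcat e h) :
  fmap (inv_hom c h) (assoc f g k) \o inv_hcomp (f \dia g) k
      \o (inv_hcomp f g \Dia idm (inv_hom e h k)) =
  inv_hcomp f (g \dia k) \o (idm (inv_hom c d f) \Dia inv_hcomp g k)
      \o assoc (inv_hom c d f) (inv_hom d e g) (inv_hom e h k).
Proof.
apply: cofill_inj => M.
pose p := fmap_iso (mf (ceq h)) (phi (inv_mor f \dia inv_mor g) (inv_mor k) M).
pose p' := fmap_iso (mf (ceq h)) (fmap_iso (mf (phom F (inv_mor k)))
  (phi (inv_mor f) (inv_mor g) M)).
apply: (iso_epi (f := p)); apply: (iso_epi (f := p')).
rewrite !whiskM !compA inv_mapE.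
have -> : cmp (assoc f g k) (mf (ceq c) M) \o cofill_at (f \dia g \dia k) M =
  cofill_at (f \dia g \dia k) M by exact: comp1m.
rewrite (comp_eq2 _ (whisk_phil _ _ _)) !compA.
rewrite inv_hcompE (comp_eq2 _ (cofill_nat k _)) !compA
  (comp_eq2 _ (cofill_nat k _)) !compA.
rewrite -[fmap (mf (ceq e)) (cell_image _ M)]/(whisk (inv_hcomp f g) M).
rewrite (comp_eq3 _ (whisk_assoc _ _ _ _)) !compA.
rewrite (comp_eq2 _ (whisk_phir _ _ _)) !compA inv_hcompE.
by rewrite (comp_eq3 _ (inv_hcompE g k _)) -!fmapM inv_hcompE fmapM !compA.
Qed.

Lemma inv_lunit c d (f : homcat c d) :
  fmap (inv_hom c d) (lunit f) \o inv_hcomp (unit1 c) f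
      \o (inv_unit c \Dia idm (inv_hom c d f)) =
  lunit (inv_hom c d f).
Proof.
apply: cofill_inj => M.
pose p := fmap_iso (mf (ceq d)) (phi (unit1 (inv_ob c)) (inv_mor f) M).
pose p' := fmap_iso (mf (ceq d)) (fmap_iso (mf (phom F (inv_mor f)))
  (phi0 M)).
apply: (iso_epi (f := p)); apply: (iso_epi (f := p')).
rewrite !whiskM !compA inv_mapE.
have -> : cmp (lunit f) (mf (ceq c) M) \o cofill_at (unit1 c \dia f) M =
  cofill_at (unit1 c \dia f) M by exact: comp1m.
rewrite (comp_eq3 _ (whisk_lunit _ _)) compm1.
rewrite (comp_eq2 _ (whisk_phil _ _ _)) !compA.
rewrite inv_hcompE (comp_eq2 _ (cofill_nat f _)) !compA
  (comp_eq2 _ (cofill_nat f _)) !compA.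
rewrite -[fmap (mf (ceq c)) (cell_image _ M)]/(whisk (inv_unit c) M).
by rewrite -!fmapM inv_unitE fmap1 comp1m.
Qed.

Lemma inv_runit c d (f : homcat c d) :
  fmap (inv_hom c d) (runit f) \o inv_hcomp f (unit1 d)
      \o (idm (inv_hom c d f) \Dia inv_unit d) =
  runit (inv_hom c d f).
Proof.
apply: cofill_inj => M.
pose p := fmap_iso (mf (ceq d)) (phi (inv_mor f) (unit1 (inv_ob d)) M).
pose p' := fmap_iso (mf (ceq d)) (phi0 (mf (phom F (inv_mor f)) M)).
apply: (iso_epi (f := p)); apply: (iso_epi (f := p')).
rewrite !whiskM !compA inv_mapE.
have -> : cmp (runit f) (mf (ceq c) M) \o cofill_at (f \dia unit1 d) M =
  cofill_at (f \dia unit1 d) M by exact: comp1m.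
rewrite (comp_eq3 _ (whisk_runit _ _)) compm1.
rewrite (comp_eq2 _ (whisk_phir _ _ _)) !compA inv_hcompE.
by rewrite (comp_eq3 _ (inv_unitE _)) compm1.
Qed.

Definition inv_pseudofunctor : pseudofunctor B' B :=
  @Pseudofunctor B' B inv_ob inv_hom inv_hcomp inv_unit inv_hcomp_nat inv_assoc
    inv_lunit inv_runit.

(** * The fillings as a natural 2-isomorphism to the identity of the target *)

Lemma cofill_2nat c d (f f' : homcat c d) (a : mor f f') :
  cofill f' \o (fmap (phom F) (inv_map a) \Dia idm (ceq d)) =
    (idm (ceq c) \Dia a) \o cofill f.
Proof.
apply: cmp_eq => M.
suff h : cofill_at f' M \o (idm _ \o whisk (inv_map a) M) =
    cmp a (mf (ceq c) M) \o fmap (mf f) (idm _) \o cofill_at f M by exact: h.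
by rewrite comp1m fmap1 compm1 inv_mapE.
Qed.

Lemma cofill_comp c d e (f : homcat c d) (g : homcat d e) :
  cofill (f \dia g) \o
    ((fmap (phom F) (inv_hcomp f g) \o phcomp F (inv_mor f) (inv_mor g)) \Dia idm
      (ceq e)) =
  (idm (ceq c) \Dia idm (f \dia g)) \o assoc (ceq c) f g \o (cofill f \Dia idm g)
    \o bwd (assoc (phom F (inv_mor f)) (ceq d) g)
    \o (idm (phom F (inv_mor f)) \Dia cofill g)
    \o assoc (phom F (inv_mor f)) (phom F (inv_mor g)) (ceq e).
Proof.
apply: cmp_eq => M.
rewrite /cmp /=. rewrite !compm1. rewrite !comp1m. rewrite !fmap1. rewrite compm1.
rewrite !comp1m.
rewrite fmapM.
rewrite compA.
have e1 := inv_hcompE f g M. rewrite /cofill_at /whisk /cell_image /phi /phi0 /cmp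
  /= in e1. exact e1.
Qed.

Lemma cofill_unit c :
  cofill (unit1 c) \o ((fmap (phom F) (inv_unit c) \o punit F (inv_ob c)) \Dia idm
    (ceq c)) =
  (idm (ceq c) \Dia idm (unit1 c)) \o bwd (runit (ceq c)) \o lunit (ceq c).
Proof.
apply: cmp_eq => M.
rewrite /cmp /=. rewrite !comp1m fmapM compA.
have e := inv_unitE M. rewrite /cofill_at /whisk /cell_image /phi /phi0 /cmp /=
  in e. exact e.
Qed.

Definition counit_2trans : nat_2trans (comp_pseudofunctor F inv_pseudofunctor)
    (id_pseudofunctor B') :=
  @Nat2Trans B' B' (comp_pseudofunctor F inv_pseudofunctor)
    (id_pseudofunctor B') ceq cofill cofill_2nat cofill_comp cofill_unit.

Lemma counit_2iso : is_nat_2iso counit_2trans.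
Proof. by split=> [c|c d f]; [exact: ceq_inv|exact: iso_is_iso]. Qed.

(** * The natural 2-isomorphism to the identity of the source *)

Variable ueq : forall x : B, homcat (inv_ob (F x)) x.
Variable ueq_iso : forall x : B, @iso (homcat (F (inv_ob (F x))) (F x))
  (phom F (ueq x)) (ceq (F x)).

Definition ueq_at x M : iso (mf (phom F (ueq x)) M) (mf (ceq (F x)) M) :=
  cmp_iso (ueq_iso x) M.

Lemma ueq_nat x (M N : F (inv_ob (F x))) (u : mor M N) :
  ueq_at N \o fmap (mf (phom F (ueq x))) u = fmap (mf (ceq (F x))) u \o ueq_at M.
Proof. exact: (cmp_nat (ueq_iso x) u). Qed.

(* The 2-cell inverse to [F f] applied to [ueq_iso x], followed by the constraint
   of [F]. *)
Lemma uconj_sig x y (f : homcat x y) M :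
  {i : iso (mf (phom F f) (mf (ceq (F x)) M)) (mf (phom F (ueq x \dia f)) M) |
   fwd i = phi (ueq x) f M \o fmap (mf (phom F f)) (bwd (ueq_at M))}.
Proof.
by exists (comp_iso (phi (ueq x) f M)
  (fmap_iso (mf (phom F f)) (inv_iso (ueq_at M)))).
Qed.

Definition uconj x y (f : homcat x y) M := sval (uconj_sig f M).

Lemma uconjE x y (f : homcat x y) M :
  uconj f M \o fmap (mf (phom F f)) (ueq_at M) = phi (ueq x) f M.
Proof. by rewrite (svalP (uconj_sig f M)) -compA -fmapM bwdK fmap1 compm1. Qed.

(** Transported along [ueq_iso] and the constraints of [F], [cofill (phom F f)] becomes a 2-cell
    between images of [F], and [ufill f] is its lift. The laws of [ufill] are therefore transported
    laws of [cofill]. *)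
Lemma ufill_sig x y (f : homcat x y) :
  {i : iso (inv_mor (phom F f) \dia ueq y) (ueq x \dia f) | forall M,
    cell_image i M \o phi (inv_mor (phom F f)) (ueq y) M =
    uconj f M \o cofill_at (phom F f) M \o
      ueq_at (mf (phom F (inv_mor (phom F f))) M)}.
Proof.
pose a : mor (phom F (inv_mor (phom F f) \dia ueq y)) (phom F (ueq x \dia f)) :=
  phcomp F (ueq x) f \o (bwd (ueq_iso x) \Dia idm (phom F f)) \o cofill (phom F f)
    \o (idm (phom F (inv_mor (phom F f))) \Dia ueq_iso y)
    \o bwd (phcomp F (inv_mor (phom F f)) (ueq y)).
have aE M : cmp a M = uconj f M \o cofill_at (phom F f) M \o
    ueq_at (mf (phom F (inv_mor (phom F f))) M) \o
      bwd (phi (inv_mor (phom F f)) (ueq y) M).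
  rewrite [fwd (uconj f M)](svalP (uconj_sig f M)) /a /cofill_at /ueq_at /phi /cmp
    /= !comp1m !fmap1 compm1.
  by [].
have /is_iso_cmp/cid[j jE] : forall M, is_iso (cmp a M).
  move=> M; rewrite aE.
  exact: (iso_is_iso (comp_iso
    (comp_iso (comp_iso (uconj f M) (cofill_at (phom F f) M)) (ueq_at _))
    (inv_iso (phi _ _ M)))).
have [i iE] := cid (full_iso (@F_full _ _) (@F_faithful _ _) j); exists i => M.
by rewrite /cell_image iE jE aE -compA bwdK compm1.
Qed.

Definition ufill x y (f : homcat x y) : iso (inv_mor (phom F f) \dia ueq y)
  (ueq x \dia f) :=
  sval (ufill_sig f).

Lemma ufillE x y (f : homcat x y) M :
  cell_image (ufill f) M \o phi (inv_mor (phom F f)) (ueq y) M =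
  uconj f M \o cofill_at (phom F f) M \o ueq_at (mf (phom F (inv_mor (phom F f))) M).
Proof. exact: (svalP (ufill_sig f)). Qed.

Lemma uconj_nat x y (f f' : homcat x y) (a : mor f f') M :
  cell_image (idm (ueq x) \Dia a) M \o uconj f M = uconj f' M \o
    cell_image a (mf (ceq (F x)) M).
Proof.
apply: (iso_epi (f := fmap_iso (mf (phom F f)) (ueq_at M))).
by rewrite fmap_isoE -!compA uconjE cell_image_nat compA uconjE cell_image_phir.
Qed.

Lemma uconj_comp x y t (f : homcat x y) (g : homcat y t) M :
  cell_image (assoc (ueq x) f g) M \o phi (ueq x \dia f) g M \o
    fmap (mf (phom F g)) (uconj f M) =
  uconj (f \dia g) M \o phi f g (mf (ceq (F x)) M).
Proof.
apply: (iso_epi (f := fmap_iso (mf (phom F g))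
  (fmap_iso (mf (phom F f)) (ueq_at M)))).
rewrite !fmap_isoE -!compA -fmapM uconjE phi_nat !compA uconjE; exact:
  cell_image_assoc.
Qed.

Lemma uconj_assocV w y t (f : homcat w (inv_ob (F y))) (g : homcat y t) M :
  cell_image (bwd (assoc f (ueq y) g)) M \o phi f (ueq y \dia g) M \o
    uconj g (mf (phom F f) M) =
  phi (f \dia ueq y) g M \o
    fmap (mf (phom F g)) (phi f (ueq y) M \o bwd (ueq_at (mf (phom F f) M))).
Proof. by rewrite (svalP (uconj_sig _ _)) !compA cell_image_assocV fmapM compA. Qed.

Lemma uconj_unit x M :
  cell_image (bwd (runit (ueq x))) M = uconj (unit1 x) M \o
    phi0 (mf (ceq (F x)) M) \o ueq_at M.
Proof.
rewrite -compA phi0_nat compA uconjE.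
apply: (iso_mono (f := Iso (C := F x)
  (fwd := cell_image (runit (ueq x)) M) (bwd := cell_image (bwd (runit (ueq x))) M)
    _ _)).
- by rewrite -cell_imageM bwdK cell_image1.
- by rewrite -cell_imageM fwdK cell_image1.
- by move=> ? ? /=; rewrite -cell_imageM fwdK cell_image1 compA cell_image_runit.
Qed.

Lemma ufill_nat x y (f f' : homcat x y) (a : mor f f') :
  ufill f' \o (inv_map (fmap (phom F) a) \Dia idm (ueq y)) = (idm (ueq x) \Dia a) \o
    ufill f.
Proof.
apply: cell_image_inj => M; apply:
  (iso_epi (f := phi (inv_mor (phom F f)) (ueq y) M)).
rewrite !cell_imageM -!compA cell_image_phil ufillE !compA ufillE uconj_nat
  (comp_eq2 _ (ueq_nat _)) !compA.
by rewrite (comp_eq2 _ (inv_mapE (fmap (phom F) a) M)) !compA.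
Qed.

Lemma ufill_comp x y t (f : homcat x y) (g : homcat y t) :
  ufill (f \dia g) \o
    ((inv_map (phcomp F f g) \o inv_hcomp (phom F f) (phom F g)) \Dia idm (ueq t)) =
  (idm (ueq x) \Dia idm (f \dia g)) \o assoc (ueq x) f g \o (ufill f \Dia idm g)
    \o bwd (assoc (inv_mor (phom F f)) (ueq y) g)
    \o (idm (inv_mor (phom F f)) \Dia ufill g)
    \o assoc (inv_mor (phom F f)) (inv_mor (phom F g)) (ueq t).
Proof.
apply: cell_image_inj => M.
apply: (iso_epi (f := phi (inv_mor (phom F f) \dia inv_mor (phom F g)) (ueq t) M)).
apply: (iso_epi (f := fmap_iso (mf (phom F (ueq t)))
  (phi (inv_mor (phom F f)) (inv_mor (phom F g)) M))).
rewrite fmap_isoE bimap1 !cell_imageM cell_image1 comp1m.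
(* The common value is the filling of [g] followed by the image under [F g] of the filling of [f],
   with [ueq_at] at the source and [uconj] at the target. *)
transitivity (uconj (f \dia g) M \o phi f g (mf (ceq (F x)) M) \o
  fmap (mf (phom F g)) (cofill_at (phom F f) M) \o
  cofill_at (phom F g) (mf (phom F (inv_mor (phom F f))) M) \o
  ueq_at (mf (phom F (inv_mor (phom F g))) (mf (phom F (inv_mor (phom F f))) M))).
- rewrite (comp_eq2 _ (cell_image_phil _ _ _)) !compA ufillE
  (comp_eq2 _ (ueq_nat _)) !compA.
  rewrite (comp_eq2 _ (ueq_nat _)) !compA -[fmap (mf (ceq _)) _]/(whisk _ M) whiskM
    !compA.
  rewrite (comp_eq2 _ (inv_mapE _ M)) !compA.
  rewrite (comp_eq3 _ (inv_hcompE (phom F f) (phom F g) M)) !compA.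
  by [].
- rewrite (comp_eq3 _ (cell_image_assoc _ _ _ M)) !compA
  (comp_eq2 _ (cell_image_phir _ _ _)) !compA.
  rewrite (comp_eq2 _ (ufillE g _)) !compA.
  rewrite (comp_eq3 _ (uconj_assocV _ g M)) !compA
    (comp_eq2 _ (cell_image_phil g (ufill f) _)).
  rewrite compA (comp_eq2 _ (esym (fmapM _ _ _))) compA ufillE.
  by rewrite -(compA (uconj f M \o _)) fwdK compm1 fmapM !compA uconj_comp.
Qed.

Lemma ufill_unit x :
  ufill (unit1 x) \o ((inv_map (punit F x) \o inv_unit (F x)) \Dia idm (ueq x)) =
  (idm (ueq x) \Dia idm (unit1 x)) \o bwd (runit (ueq x)) \o lunit (ueq x).
Proof.
apply: cell_image_inj => M.
apply: (iso_epi (f := phi (unit1 _) (ueq x) M)).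
apply: (iso_epi (f := fmap_iso (mf (phom F (ueq x))) (phi0 M))).
rewrite fmap_isoE bimap1 !cell_imageM cell_image1 comp1m.
rewrite [in RHS](comp_eq3 _ (cell_image_lunit _ M)) compm1 uconj_unit.
rewrite (comp_eq2 _ (cell_image_phil _ _ _)) !compA ufillE (comp_eq2 _ (ueq_nat _))
  !compA.
rewrite (comp_eq2 _ (ueq_nat _)) !compA -[fmap (mf (ceq _)) _]/(whisk _ M) whiskM
  !compA.
rewrite (comp_eq2 _ (inv_mapE _ M)) !compA (comp_eq3 _ (inv_unitE M)) compm1.
by [].
Qed.

Definition unit_2trans : nat_2trans (comp_pseudofunctor inv_pseudofunctor F)
    (id_pseudofunctor B) :=
  @Nat2Trans B B (comp_pseudofunctor inv_pseudofunctor F)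
    (id_pseudofunctor B) ueq ufill ufill_nat ufill_comp ufill_unit.

(** A local equivalence reflects quasi-invertibility: a quasi-inverse of [ceq (F x)] lifts to a
    1-cell of [B], and the two isomorphisms with units lift as well. *)
Lemma ueq_inv x : quasi_invertible (ueq x).
Proof.
have [q [[i] [j]]] := ceq_inv (F x); have [r [k]] := F_surj q.
have lift y t (f g : homcat y t) : iso (phom F f) (phom F g) -> inhabited (iso f g).
  by move=> l; have [m _] := full_iso (@F_full _ _) (@F_faithful _ _) l; constructor.
exists r; split; apply: lift.
- apply: (comp_iso (punit F (inv_ob (F x)))); apply: (comp_iso i).
  apply: (comp_iso (bimap_iso (hcomp _ _ _) (ueq_iso x) k)).
  exact: (inv_iso (phcomp F (ueq x) r)).
- apply: (comp_iso (punit F x)); apply: (comp_iso j).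
  apply: (comp_iso (bimap_iso (hcomp _ _ _) k (ueq_iso x))).
  exact: (inv_iso (phcomp F r (ueq x))).
Qed.

Lemma unit_2iso : is_nat_2iso unit_2trans.
Proof. by split=> [x|x y f]; [exact: ueq_inv|exact: iso_is_iso]. Qed.

End LocalEquivalence.

Theorem biequivalence_of_local_equivalence (V : monoidal) (P : modcat V -> Prop)
    (B : bicategory) (F : pseudofunctor B (modbicat P)) :
    (forall x y, full (phom F (x := x) (y := y))) ->
    (forall x y, faithful (phom F (x := x) (y := y))) ->
    (forall x y, ess_surjective (phom F (x := x) (y := y))) ->
    (forall c : modbicat P, exists x (E : modfunctor (F x) c),
      [/\ strong E, full E, faithful E & ess_surjective E]) ->
  exists G : pseudofunctor (modbicat P) B,
    (exists eta : nat_2trans (comp_pseudofunctor G F) (id_pseudofunctor B),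
       is_nat_2iso eta) /\
    (exists eps : nat_2trans (comp_pseudofunctor F G) (id_pseudofunctor (modbicat P)),
       is_nat_2iso eps).
Proof.
move=> F_full F_faithful F_surj F_ob.
have /choice[inv_ob /= inv_obP] : forall c : modbicat P, exists x, exists E :
  modfunctor (F x) c,
  [/\ strong E, full E, faithful E & ess_surjective E] := F_ob.
pose ceq c : @homcat (modbicat P) (F (inv_ob c)) c := sval (cid (inv_obP c)).
have ceqP c : [/\ strong (mf (ceq c)), full (mf (ceq c)), faithful (mf (ceq c))
  & ess_surjective (mf (ceq c))] := svalP (cid (inv_obP c)).
move: ceq ceqP => ceq ceqP {inv_obP}.
have ceq_inv c : quasi_invertible (ceq c).
  by have [sE fE iE eE] := ceqP c; have [q [_ [i j]]] :=
    strong_equivalence sE fE iE eE;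
    exists q.
(* [inv_mor f] lifts [ceq c \dia f \dia q], with [q] a quasi-inverse of [ceq d]; the filling cancels
   [q] against [ceq d]. *)
have inv_mor_ex c d (f : homcat c d) : {g : homcat (inv_ob c) (inv_ob d) &
    iso (phom F g \dia ceq d) (ceq c \dia f)}.
  have [q [_ /inhabited_elt i]] := cid (ceq_inv d).
  have [g /inhabited_elt j] := cid (F_surj _ _ (ceq c \dia f \dia q)); exists g.
  apply: (comp_iso (runit (ceq c \dia f))).
  apply: (comp_iso (bimap_iso (hcomp _ _ _) (id_iso (ceq c \dia f)) i)).
  apply: (comp_iso (assoc (ceq c \dia f) q (ceq d))).
  exact: (bimap_iso (hcomp _ _ _) j (id_iso (ceq d))).
(* The source and target of [ceq (F x)] are both images of [F], so it lifts up to isomorphism. *)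
have ueq_ex x : {u : homcat (inv_ob (F x)) x & iso (phom F u) (ceq (F x))}.
  by have [u /inhabited_elt i] := cid (F_surj _ _ (ceq (F x))); exists u.
have ceq_strong c : strong (mf (ceq c)) by case: (ceqP c).
have ceq_full c : full (mf (ceq c)) by case: (ceqP c).
have ceq_faithful c : faithful (mf (ceq c)) by case: (ceqP c).
exists (inv_pseudofunctor F_full F_faithful ceq_strong ceq_full ceq_faithful
  (fun c d f => projT2 (inv_mor_ex c d f))); split.
- exists (unit_2trans F_full F_faithful ceq_strong ceq_full ceq_faithful
    (fun c d f => projT2 (inv_mor_ex c d f)) (fun x => projT2 (ueq_ex x))).
  exact: unit_2iso.
- exists (counit_2trans F_full F_faithful ceq_strong ceq_full ceq_faithful
    (fun c d f => projT2 (inv_mor_ex c d f))).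
  exact: counit_2iso.
Qed.

(** * Module categories of rows *)

Import GRing.Theory.
Local Open Scope ring_scope.

Section RowModules.
Variable K : fieldType.

Lemma dinjZ n (V : 'I_n -> vectType K) k c (v : V k) :
  dinj k (c *: v) = c *: dinj k v.
Proof. by have := dinj_linear c v 0; rewrite dinj0 !addr0. Qed.

Lemma dproj0 n (V : 'I_n -> vectType K) k : dproj k (0 : dsum V) = 0 :> V k.
Proof. by rewrite -(scale0r 0) dprojZ scale0r. Qed.

Section LinearExtensionality.
Variables (n : nat) (Z : vectType K).

Lemma lfun_ext2 (A B : 'I_n -> vectType K)
    (f g : 'Hom(dsum (fun k => tensor (A k) (B k)), Z)) :
  (forall k a b, f (dinj k (pure a b)) = g (dinj k (pure a b))) -> f = g.
Proof. by move=> fg; apply/lfunP; dsum_ext => k; tensor_ext => a b. Qed.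

Lemma lfun_ext3 (A B C : 'I_n -> vectType K)
    (f g : 'Hom(dsum (fun k => tensor (tensor (A k) (B k)) (C k)), Z)) :
  (forall k a b c, f (dinj k (pure (pure a b) c)) = g (dinj k (pure (pure a b) c))) ->
  f = g.
Proof.
move=> fg; apply/lfunP; dsum_ext => k; tensor_ext => s c; move: s.
by tensor_ext => a b.
Qed.

Lemma lfun_ext4 (A B C D : 'I_n -> vectType K)
    (f g : 'Hom(dsum (fun k => tensor (tensor (tensor (A k) (B k)) (C k)) (D k)),
      Z)) :
  (forall k a b c d, f (dinj k (pure (pure (pure a b) c) d)) =
    g (dinj k (pure (pure (pure a b) c) d))) -> f = g.
Proof.
move=> fg; apply/lfunP; dsum_ext => k; tensor_ext => s d; move: s.
by tensor_ext => s c; move: s; tensor_ext => a b.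
Qed.

Lemma lfun_ext32 m (A B C : 'I_n -> 'I_m -> vectType K) (D : 'I_n -> vectType K)
    (f g : 'Hom(dsum (fun l =>
      tensor (dsum (fun k => tensor (tensor (A l k) (B l k)) (C l k))) (D l)), Z)) :
  (forall l k a b c d, f (dinj l (pure (dinj k (pure (pure a b) c)) d)) =
    g (dinj l (pure (dinj k (pure (pure a b) c)) d))) -> f = g.
Proof.
move=> fg; apply/lfunP; dsum_ext => l; tensor_ext => s d; move: s.
by dsum_ext => k; tensor_ext => s c; move: s; tensor_ext => a b.
Qed.

End LinearExtensionality.

Section Swap.
Variables U X V : vectType K.

(** Vector spaces act by tensoring on the right, and so do matrix entries, so the structure morphism
    of a row functor must move [X] past the entry. *)
Definition tswap : 'Hom(tensor (tensor U X) V, tensor (tensor U V) X) :=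
  tlift (fun s v => tlift (fun u x => pure (pure u v) x) s).

Lemma tswapE (u : U) (x : X) (v : V) :
  tswap (pure (pure u x) v) = pure (pure u v) x.
Proof.
rewrite tliftE ?tliftE //; split=> [w|w] a y z.
- by rewrite !pure_linear_l.
- by rewrite pure_linear_r.
- by rewrite linearP.
- apply: (tlift_linear (b := fun v u x => pure (pure u v) x)) => u' x' b y' z'.
  by rewrite pure_linear_r pure_linear_l.
Qed.

End Swap.

Section RowModule.
Variable n : nat.

Definition row_act : functor (prod_category (mat_cat K 1 n) (Vect_cat K))
  (mat_cat K 1 n).
Proof.
refine (@Functor (prod_category (mat_cat K 1 n) (Vect_cat K)) (mat_cat K 1 n)
  (fun p i j => tensor (p.1 i j) p.2) (fun p q f i j => tmap (f.1 i j) f.2) _ _).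
- by move=> [M X]; apply: mat_eq => i j; apply: tmap1.
- by move=> p q r g f; apply: mat_eq => i j; apply: tmapM.
Defined.

Definition mat_iso p q (M N : mat_cat K p q) (f : forall i j, 'Hom(M i j, N i j))
    (g : forall i j, 'Hom(N i j, M i j))
    (fK : forall i j, (g i j \o f i j = \1)%VF)
    (gK : forall i j, (f i j \o g i j = \1)%VF) : iso M N :=
  @Iso (mat_cat K p q) M N f g (mat_eq fK) (mat_eq gK).

Definition row_modcat : modcat (Vect K).
Proof.
refine (@ModCat (Vect K) (mat_cat K 1 n) row_act
  (fun M X Y => mat_iso (M := row_act (row_act (M, X), Y))
    (N := row_act (M, tensor X Y))
    (fun i j => tassocK (M i j) X Y) (fun i j => tassocVK (M i j) X Y))
  (fun M => mat_iso (M := row_act (M, K^o : vectType K)) (N := M)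
    (fun i j => trunitK (M i j)) (fun i j => trunitVK (M i j))) _ _ _ _).
- by move=> *; apply: mat_eq => i j; apply: tassoc_nat.
- by move=> *; apply: mat_eq => i j; apply: trunit_nat.
- by move=> *; apply: mat_eq => i j; apply: tpentagon.
- by move=> *; apply: mat_eq => i j; apply: ttriangle.
Defined.

End RowModule.

Section RowFunctor.
Variables (n m : nat) (V : mat_cat K n m).

Definition row_functor0 : functor (mat_cat K 1 n) (mat_cat K 1 m).
Proof.
refine (@Functor (mat_cat K 1 n) (mat_cat K 1 m) (fun M => mat_hcomp K 1 n m (M, V))
  (fun M N f => bimap (mat_hcomp K 1 n m) f (idm V)) _ _).
- by move=> M; apply: bimap1.
- by move=> M N L g f; apply: bimapMl.
Defined.

Definition row_str (M : mat_cat K 1 n) (X : vectType K) :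
    mor (row_functor0 (row_act n (M, X))) (row_act m (row_functor0 M, X)) :=
  fun i j => dlift (fun k t =>
    tmap (linfun (dinj (V := fun k => tensor (M i k) (V k j)) k)) \1%VF
      (tswap (M i k) X (V k j) t)).

Lemma row_strE (M : mat_cat K 1 n) (X : vectType K) i j k (a : M i k) (x : X)
  (v : V k j) :
  row_str M X i j (dinj k (pure (pure a x) v)) = pure (dinj k (pure a v)) x.
Proof.
rewrite /row_str dliftE; last by move=> l b y z; rewrite !linearP.
by rewrite tswapE tmapE id_lfunE linfunE //; apply: dinj_linear.
Qed.

Lemma row_str_nat (M M' : mat_cat K 1 n) (X X' : Vect_cat K) (f : mor M M')
    (g : mor X X') :
  row_str M' X' \o fmap row_functor0 (bimap (row_act n) f g) =
  bimap (row_act m) (fmap row_functor0 f) g \o row_str M X.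
Proof.
apply: mat_eq => i j; apply: lfun_ext3 => k a x v /=.
by rewrite !comp_lfunE /= !(dmapE, tmapE, row_strE, id_lfunE).
Qed.

Lemma row_str_assoc (M : row_modcat n) (X Y : Vect K) :
  aassoc (row_functor0 M : row_modcat m) X Y \o
    bimap (row_act m) (row_str M X) (idm Y) \o row_str (row_act n (M, X)) Y =
  row_str M (X \ten Y) \o fmap row_functor0 (aassoc M X Y).
Proof.
apply: mat_eq => i j; apply: lfun_ext4 => k a x y v /=.
by rewrite !comp_lfunE /= !(dmapE, tmapE, row_strE, id_lfunE, tassocE).
Qed.

Lemma row_str_unit (M : row_modcat n) :
  aunit (row_functor0 M : row_modcat m) \o row_str M (mone (m := Vect K)) =
  fmap row_functor0 (aunit M).
Proof.
apply: mat_eq => i j; apply: lfun_ext3 => k a x v /=.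
rewrite !comp_lfunE /= !(dmapE, tmapE, row_strE, id_lfunE, trunitE).
by rewrite pureZl dinjZ.
Qed.

Definition row_functor : modfunctor (row_modcat n) (row_modcat m) :=
  @ModFunctor (Vect K) (row_modcat n) (row_modcat m) row_functor0 row_str
    row_str_nat row_str_assoc row_str_unit.

End RowFunctor.

End RowModules.

Section DsumTensor.
Variables (K : fieldType) (n : nat) (V : 'I_n -> vectType K) (X : vectType K).

Definition dtens : 'Hom(dsum (fun k => tensor (V k) X), tensor (dsum V) X) :=
  dlift (fun k t => tmap (linfun (dinj (V := V) k)) \1%VF t).

Lemma dtensE k (a : V k) (x : X) : dtens (dinj k (pure a x)) = pure (dinj k a) x.
Proof.
rewrite /dtens dliftE; last by move=> l; exact: lfun_linear.
by rewrite tmapE id_lfunE linfunE //; apply: dinj_linear.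
Qed.

Definition dtensV : 'Hom(tensor (dsum V) X, dsum (fun k => tensor (V k) X)) :=
  tlift (fun s x => dlift (fun k a =>
    dinj (V := fun k => tensor (V k) X) k (pure a x)) s).

Lemma dtensVE k (a : V k) (x : X) : dtensV (pure (dinj k a) x) = dinj k (pure a x).
Proof.
have lin l (y : X) : linear (fun a : V l =>
    dinj (V := fun k => tensor (V k) X) l (pure a y)).
  by move=> c u v; rewrite pure_linear_l dinj_linear.
rewrite /dtensV tliftE; first by rewrite dliftE //; move=> l; exact: lin.
split=> [y|s]; first exact: lfun_linear.
apply: (dlift_linear (b := fun x k a =>
  dinj (V := fun k => tensor (V k) X) k (pure a x))) => [l v c y z|y l];
  last exact: lin.
by rewrite pure_linear_r dinj_linear.
Qed.

Lemma dtensK : (dtensV \o dtens = \1)%VF.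
Proof.
apply/lfunP; dsum_ext => k; tensor_ext => a x.
by rewrite comp_lfunE dtensE dtensVE id_lfunE.
Qed.

Lemma dtensVK : (dtens \o dtensV = \1)%VF.
Proof.
apply/lfunP; tensor_ext => s x; move: s; dsum_ext => k a.
by rewrite comp_lfunE dtensVE dtensE id_lfunE.
Qed.

End DsumTensor.

(** * Rows of length [n] as [K^n]-modules *)

Section RowToModule.
Variable K : fieldType.
Variable n : nat.

Definition row_mod_rho (M : mat_cat K 1 n) (a : {ffun 'I_n -> K^o}) :
    'End(dsum (M ord0)) :=
  dmap (fun i => (a i : K) *: \1%VF).

Lemma row_mod_rhoE (M : mat_cat K 1 n) a k (v : M ord0 k) :
  row_mod_rho M a (dinj k v) = (a k : K) *: dinj k v.
Proof. by rewrite dmapE scale_lfunE id_lfunE dinjZ. Qed.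

Lemma row_mod_rho_linear M : linear (row_mod_rho M).
Proof.
move=> c a b; apply/lfunP; dsum_ext => k v.
by rewrite !lfun_simp !row_mod_rhoE ffunE scalerDl scalerA; congr (_ *: _ + _);
  rewrite !ffunE.
Qed.

Definition row_mod (M : mat_cat K 1 n) : fdmod K n.
Proof.
refine (@FdMod K n (dsum (M ord0)) (linfun (row_mod_rho M)) _ _).
- rewrite linfunE; last exact: row_mod_rho_linear.
  by apply/lfunP; dsum_ext => k v; rewrite row_mod_rhoE ffunE id_lfunE scale1r.
- move=> a b; rewrite !linfunE; try exact: row_mod_rho_linear.
  apply/lfunP; dsum_ext => k v.
  by rewrite comp_lfunE !row_mod_rhoE linearZ /= row_mod_rhoE ffunE scalerA mulrC.
Defined.

Lemma row_modE (M : mat_cat K 1 n) a k (v : M ord0 k) : rho (row_mod M) a (dinj k v)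
  = (a k : K) *: dinj k v.
Proof. by rewrite linfunE ?row_mod_rhoE //; exact: row_mod_rho_linear. Qed.

Lemma fdmod_iso (M N : fdmod K n) (f : fdhom M N) (g : 'Hom(N, M)) :
    (g \o f = \1)%VF -> (f \o g = \1)%VF ->
  exists i : @iso (fdmod_cat K n) M N, fwd i = f.
Proof.
move=> gf fg; have ge a : (g \o rho N a = rho M a \o g)%VF.
  rewrite -[LHS]comp_lfun1r -fg comp_lfunA -(comp_lfunA g) -fdfun_equiv comp_lfunA.
  by rewrite gf comp_lfun1l.
have gf' : vcomp (c := fdmod_cat K n) (FdHom ge) f =
  idm (c := fdmod_cat K n) M by exact: fdhom_eq.
have fg' : vcomp (c := fdmod_cat K n) f (FdHom ge) =
  idm (c := fdmod_cat K n) N by exact: fdhom_eq.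
by exists (@Iso (fdmod_cat K n) M N f (FdHom ge) gf' fg').
Qed.

Definition row_mod_hom (M N : mat_cat K 1 n) (f : mor M N) :
  fdhom (row_mod M) (row_mod N).
Proof.
refine (@FdHom _ _ (row_mod M) (row_mod N) (dmap (f ord0)) _) => a.
apply/lfunP; dsum_ext => k v.
by rewrite !comp_lfunE row_modE linearZ /= dmapE row_modE.
Defined.

Definition row_mod_functor : functor (mat_cat K 1 n) (fdmod_cat K n).
Proof.
refine (@Functor (mat_cat K 1 n) (fdmod_cat K n) row_mod row_mod_hom _ _).
- by move=> M; apply/fdhom_eq/lfunP; dsum_ext => k v; rewrite dmapE !id_lfunE.
- move=> M N L g f; apply/fdhom_eq/lfunP; dsum_ext => k v.
  by rewrite comp_lfunE !dmapE comp_lfunE.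
Defined.

Definition row_mod_str (M : row_modcat K n) (X : Vect K) :
  fdhom (row_mod (mact _ (M, X))) (fdmod_act_ob (row_mod M) X).
Proof.
refine (@FdHom _ _ (row_mod (mact _ (M, X))) (fdmod_act_ob (row_mod M) X)
  (dtens (M ord0) X) _) => a.
rewrite fdmod_act_rho; apply/lfunP; dsum_ext => k; tensor_ext => v x.
by rewrite !comp_lfunE row_modE linearZ /= dtensE tmapE id_lfunE row_modE pureZl.
Defined.

Definition row_mod_modfunctor : modfunctor (row_modcat K n) (fdmod_modcat K n).
Proof.
refine (@ModFunctor (Vect K) (row_modcat K n) (fdmod_modcat K n) row_mod_functor
  row_mod_str _ _ _).
- move=> M M' X X' f g; apply/fdhom_eq/lfunP; dsum_ext => k; tensor_ext => v x.
  by rewrite /= !comp_lfunE !(dmapE, dtensE, tmapE).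
- move=> M X Y; apply/fdhom_eq/lfunP; dsum_ext => k; tensor_ext => s y.
  move: s; tensor_ext => v x.
  by rewrite /= !comp_lfunE !(dmapE, dtensE, tmapE, tassocE, id_lfunE).
- move=> M; apply/fdhom_eq/lfunP; dsum_ext => k; tensor_ext => v x.
  by rewrite /= !comp_lfunE !(dmapE, dtensE, tmapE, trunitE) dinjZ.
Defined.

Lemma row_mod_strong : strong row_mod_modfunctor.
Proof.
move=> M X; have [i iE] := fdmod_iso (f := row_mod_str M X) (dtensK (M ord0) X)
  (dtensVK (M ord0) X).
by have := iso_is_iso i; rewrite iE.
Qed.

(** An index in ['I_1] equals [ord0] only propositionally, hence the transport; at [ord0] it
    disappears by [row_morE]. *)
Definition row_mor (M N : mat_cat K 1 n) (f : forall j, 'Hom(M ord0 j, N ord0 j)) :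
    mor M N :=
  fun i j => eq_rect ord0 (fun i => 'Hom(M i j, N i j)) (f j) i (esym (ord1 i)).

Lemma row_morE M N f j : @row_mor M N f ord0 j = f j.
Proof.
by rewrite /row_mor; move: (esym _) => e; rewrite (eq_irrelevance e erefl).
Qed.

Lemma row_mod_faithful : faithful row_mod_modfunctor.
Proof.
move=> M N f g fg; apply: mat_eq => i k; rewrite (ord1 i); apply/lfunP => v.
have := congr1 (fun h : fdhom (row_mod M) (row_mod N) =>
  dproj k ((h : 'Hom(dsum (M ord0), dsum (N ord0))) (dinj k v))) fg.
by rewrite /= !dmapE !dprojK.
Qed.

(** The primitive idempotents of [K^n], which split every module into a row. *)
Definition idem (k : 'I_n) : {ffun 'I_n -> K^o} := [ffun i => (i == k)%:R : K].

Lemma idem_mul a k : a * idem k = (a k : K) *: idem k.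
Proof.
apply/ffunP => i; rewrite !ffunE; have [->|_] :=
  eqVneq i k; last by rewrite mulr0 scaler0.
by [].
Qed.

Lemma idem_sum : \sum_k idem k = 1.
Proof.
apply/ffunP => i; rewrite sum_ffunE ffunE (bigD1 i) //= big1 => [|k ki].
  by rewrite ffunE eqxx addr0.
by rewrite ffunE eq_sym (negPf ki).
Qed.

Lemma row_mod_idem M k y : rho (row_mod M) (idem k) y = dinj k (dproj k y).
Proof.
move: y; apply: dsum_eq.
- by move=> x y; rewrite linearD.
- by move=> x y; rewrite dprojD dinjD.
move=> l v; rewrite row_modE ffunE; have [lk|lk] := eqVneq l k.
  by case: _ / lk; rewrite scale1r dprojK.
by rewrite dproj_inj // scale0r dinj0.
Qed.

(** Commuting with the idempotents forces a module map to preserve every summand, so it is the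
    direct sum of its diagonal blocks. *)
Lemma row_mod_full : full row_mod_modfunctor.
Proof.
move=> M N g.
pose h : 'Hom(dsum (M ord0), dsum (N ord0)) :=
  fdfun (g : fdhom (row_mod M) (row_mod N)).
have hlin k : linear (fun v : M ord0 k => dproj k (h (dinj k v))).
  by move=> c u v; rewrite dinj_linear linearP dprojD dprojZ.
exists (row_mor (fun k => linfun (fun v : M ord0 k => dproj k (h (dinj k v))))).
apply/fdhom_eq/lfunP; apply: dsum_eq => [u v|u v|k v]; try exact: linearD.
rewrite /= dmapE row_morE linfunE // -row_mod_idem -[RHS]/(h _).
rewrite -[in RHS](dprojK v) -row_mod_idem.
have := congr1 (fun f : 'Hom(_, _) => f (dinj k v))
  (esym (fdfun_equiv (g : fdhom (row_mod M) (row_mod N)) (idem k))).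
by rewrite !comp_lfunE.
Qed.

(** The row consists of the images of the idempotents. Their inclusions are jointly onto because the
    idempotents sum to 1, and the sum is direct because [idem l] vanishes on the image of [idem k]
    for distinct [k] and [l]. *)
Lemma row_mod_ess_surjective : ess_surjective row_mod_modfunctor.
Proof.
move=> N.
pose W k : vectType K := subvs_of (limg (rho N (idem k))).
pose M : mat_cat K 1 n := fun _ k => W k.
exists M.
have Wlin k : linear (vsval : W k -> N) by move=> c u v; rewrite linearP.
pose f : 'Hom(dsum W, N) := dlift (fun k (v : W k) => vsval v).
have fE k (v : W k) : f (dinj k v) = vsval v by rewrite /f dliftE.
have rW a k (v : W k) : rho N a (vsval v) = (a k : K) *: vsval v.
  have /memv_imgP[w _ ->] := subvsP v.
  by rewrite -comp_lfunE -rhoM idem_mul linearZ /= scale_lfunE.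
have fe a : (f \o rho (row_mod M) a = rho N a \o f)%VF.
  apply/lfunP; dsum_ext => k v.
  by rewrite !comp_lfunE row_modE linearZ /= !fE rW.
have glin k : linear (fun y : N => vsproj (limg (rho N (idem k))) (rho N (idem k) y)
  : W k).
  by move=> c u v; rewrite linearP linearP.
pose g : 'Hom(N, dsum W) := linfun (fun y => \sum_k
  dinj (V := W) k (vsproj (limg (rho N (idem k))) (rho N (idem k) y))).
have gE y : g y = \sum_k
    dinj (V := W) k (vsproj (limg (rho N (idem k))) (rho N (idem k) y)).
  rewrite /g linfunE // => c u v; rewrite scaler_sumr -big_split.
  by apply: eq_bigr => k _ /=; rewrite glin dinj_linear.
have fg : (f \o g = \1)%VF.
  apply/lfunP => y; rewrite comp_lfunE gE linear_sum id_lfunE.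
  transitivity (\sum_k rho N (idem k) y).
    by apply: eq_bigr => k _; rewrite /= fE vsprojK ?memv_img ?memvf.
  by rewrite -sum_lfunE -linear_sum idem_sum /= rho1 id_lfunE.
have gf : (g \o f = \1)%VF.
  apply/lfunP; dsum_ext => k v; rewrite comp_lfunE fE gE id_lfunE.
  rewrite (bigD1 k) //= rW ffunE eqxx scale1r vsvalK big1 ?addr0 // => l lk.
  by rewrite rW ffunE eq_sym (negPf lk) scale0r linear0 dinj0.
have [i _] := fdmod_iso (M := row_mod M) (f := FdHom fe) gf fg.
by constructor.
Qed.

Lemma row_module_equivalent : module_equivalent (row_modcat K n) (fdmod_modcat K n).
Proof.
exact: (strong_module_equivalent row_mod_strong row_mod_full row_mod_faithful
  row_mod_ess_surjective).
Qed.

End RowToModule.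

(** * The pseudofunctor of matrix multiplication *)

Section RowPseudofunctor.
Variable K : fieldType.
Local Notation B' := (ModVect2 K).

Definition row_ob (n : nat) : B' :=
  @ModCatIn (Vect K) _ (row_modcat K n) (ex_intro _ n (row_module_equivalent K n)).

(* As above: unfold the bicategory of module categories before its objects. *)
Strategy 200 [row_modcat row_functor mat_hcomp mat_cat].
Strategy -200 [row_ob].

Section RowTrans.
Variables (n m : nat) (V W : mat_cat K n m) (a : mor V W).

Let cmp_row (M : row_modcat K n) : mor (row_functor V M) (row_functor W M) :=
  bimap (mat_hcomp K 1 n m) (idm M) a.

Let bimap_swap (M N : mat_cat K 1 n) (f : mor M N) :
  bimap (mat_hcomp K 1 n m) (idm N) a \o bimap (mat_hcomp K 1 n m) f (idm V) =
  bimap (mat_hcomp K 1 n m) f (idm W) \o bimap (mat_hcomp K 1 n m) (idm M) a.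
Proof. by rewrite -!bimapM !comp1m !compm1. Qed.

Let cmp_row_nat (M N : row_modcat K n) (f : mor M N) :
  cmp_row N \o fmap (row_functor V) f = fmap (row_functor W) f \o cmp_row M.
Proof. exact: bimap_swap. Qed.

Let cmp_row_str (M : row_modcat K n) (X : Vect K) :
  mstr (row_functor W) M X \o cmp_row (M \box X) =
  (cmp_row M \Box idm X) \o mstr (row_functor V) M X.
Proof.
apply: mat_eq => i j; apply: lfun_ext3 => k b x v /=.
by rewrite !comp_lfunE /= !(dmapE, tmapE, row_strE, id_lfunE).
Qed.

Definition row_trans : modtrans (row_functor V) (row_functor W) :=
  ModTrans (mtrans := NatTrans (F := row_functor V) (G := row_functor W)
    (ncomp := cmp_row) cmp_row_nat) cmp_row_str.

End RowTrans.

Definition row_hom n m : functor (mat_cat K n m) (@homcat B' (row_ob n) (row_ob m)).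
Proof.
refine (@Functor (mat_cat K n m) (@homcat B' (row_ob n) (row_ob m))
  (@row_functor K n m) (@row_trans n m) _ _).
- by move=> V; apply: modtrans_eq => M; apply: bimap1.
- by move=> V W X b a; apply: modtrans_eq => M; apply: bimapMr.
Defined.

Section RowAssoc.
Variables (n m p : nat) (V : mat_cat K n m) (W : mat_cat K m p).
Let F := comp_modfunctor (row_functor V) (row_functor W).
Let G := row_functor (mat_hcomp K n m p (V, W)).

Let a (M : row_modcat K n) : mor (F M) (G M) := fwd (mat_assoc_iso M V W).

Let a_nat (M N : row_modcat K n) (f : mor M N) : a N \o fmap F f = fmap G f \o a M.
Proof.
have := mat_assoc_nat (V := M) (V' := N) (W := V) (W' := V) (X := W) (X' := W)
  f (idm V) (idm W).
by rewrite bimap1.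
Qed.

Let a_str (M : row_modcat K n) (X : Vect K) :
  mstr G M X \o a (M \box X) = (a M \Box idm X) \o mstr F M X.
Proof.
apply: mat_eq => i j; apply: lfun_ext32 => l k b x v w /=.
by rewrite !comp_lfunE /= !(dmapE, tmapE, row_strE, id_lfunE, mat_assocE).
Qed.

Definition row_assoc_trans : modtrans F G :=
  ModTrans (mtrans := NatTrans (F := F) (G := G) (ncomp := a) a_nat) a_str.

End RowAssoc.

Section RowUnit.
Variable n : nat.
Let F := id_modfunctor (row_modcat K n).
Let G := row_functor (@mat_unit K n).

Let u (M : row_modcat K n) : mor (F M) (G M) := bwd (mat_runit_iso M).

Let u_nat (M N : row_modcat K n) (f : mor M N) : u N \o fmap F f = fmap G f \o u M.
Proof.
apply: mat_eq => i j; apply/lfunP => v.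
by rewrite /= !comp_lfunE !mat_runitVE dmapE tmapE id_lfunE.
Qed.

Let u_str (M : row_modcat K n) (X : Vect K) :
  mstr G M X \o u (M \box X) = (u M \Box idm X) \o mstr F M X.
Proof.
apply: mat_eq => i j; apply/lfunP; tensor_ext => b x.
by rewrite /= !comp_lfunE !mat_runitVE row_strE id_lfunE tmapE id_lfunE mat_runitVE.
Qed.

Definition row_unit_trans : modtrans F G :=
  ModTrans (mtrans := NatTrans (F := F) (G := G) (ncomp := u) u_nat) u_str.

End RowUnit.

Lemma row_phcomp_sig n m p (V : mat_cat K n m) (W : mat_cat K m p) :
  {i : @iso (modhom (row_modcat K n) (row_modcat K p))
         (comp_modfunctor (row_functor V) (row_functor W))
         (row_functor (mat_hcomp K n m p (V, W))) | fwd i = row_assoc_trans V W}.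
Proof.
have ai (M : mat_cat K 1 n) : is_iso (row_assoc_trans V W M).
  exact: (iso_is_iso (mat_assoc_iso M V W)).
by have [i iE] := cid (modtrans_iso (a := row_assoc_trans V W) ai); exists i.
Qed.

Definition row_phcomp n m p (V : mat_cat K n m) (W : mat_cat K m p) :
    @iso (homcat (row_ob n) (row_ob p)) (row_hom n m V \dia row_hom m p W)
         (row_hom n p (mat_hcomp K n m p (V, W))) :=
  sval (row_phcomp_sig V W).

Lemma row_phcompE n m p (V : mat_cat K n m) (W : mat_cat K m p) (M : mat_cat K 1 n) :
  cmp (row_phcomp V W) M = fwd (mat_assoc_iso M V W).
Proof.
exact (congr1 (fun a : modtrans (comp_modfunctor (row_functor V) (row_functor W))
  (row_functor (mat_hcomp K n m p (V, W))) => a M) (svalP (row_phcomp_sig V W))).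
Qed.

Lemma row_punit_sig n :
  {i : @iso (modhom (row_modcat K n) (row_modcat K n))
    (id_modfunctor (row_modcat K n))
         (row_functor (@mat_unit K n)) | fwd i = row_unit_trans n}.
Proof.
have ui (M : mat_cat K 1 n) : is_iso (row_unit_trans n M).
  exact: (iso_is_iso (inv_iso (mat_runit_iso M))).
by have [i iE] := cid (modtrans_iso (a := row_unit_trans n) ui); exists i.
Qed.

Definition row_punit n :
    @iso (homcat (row_ob n) (row_ob n)) (unit1 (row_ob n))
      (row_hom n n (@mat_unit K n)) :=
  sval (row_punit_sig n).

Lemma row_punitE n (M : mat_cat K 1 n) : cmp (row_punit n) M = bwd (mat_runit_iso M).
Proof.
exact (congr1 (fun a : modtrans (id_modfunctor (row_modcat K n))
  (row_functor (@mat_unit K n)) => a M) (svalP (row_punit_sig n))).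
Qed.

Lemma row_phcomp_nat n m p (V V' : mat_cat K n m) (W W' : mat_cat K m p)
    (a : mor V V') (b : mor W W') :
  row_phcomp V' W' \o (fmap (row_hom n m) a \Dia fmap (row_hom m p) b) =
  fmap (row_hom n p) (bimap (mat_hcomp K n m p) a b) \o row_phcomp V W.
Proof.
apply: cmp_eq => M.
suff h : cmp (row_phcomp V' W') M \o
    (bimap (mat_hcomp K 1 m p) (idm (mat_hcomp K 1 n m (M : mat_cat K 1 n, V'))) b \o
     bimap (mat_hcomp K 1 m p)
       (bimap (mat_hcomp K 1 n m) (idm (M : mat_cat K 1 n)) a) (idm W)) =
    bimap (mat_hcomp K 1 n p) (idm (M : mat_cat K 1 n))
      (bimap (mat_hcomp K n m p) a b) \o
     cmp (row_phcomp V W) M by exact h.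
rewrite (row_phcompE V' W' M) (row_phcompE V W M).
rewrite -bimapM comp1m compm1. exact: mat_assoc_nat.
Qed.

(** At a row [M] this is the pentagon of matrix multiplication for [M], [V], [W], [X]. *)
Lemma row_passoc n m p q (V : mat_cat K n m) (W : mat_cat K m p) (X : mat_cat K p q) :
  fmap (row_hom n q) (mat_assoc_iso V W X) \o row_phcomp (mat_hcomp K n m p (V, W)) X
    \o (row_phcomp V W \Dia idm (row_hom p q X)) =
  row_phcomp V (mat_hcomp K m p q (W, X)) \o (idm (row_hom n m V) \Dia row_phcomp W X)
    \o assoc (row_hom n m V) (row_hom m p W) (row_hom p q X).
Proof.
apply: cmp_eq => M; pose N := mat_hcomp K 1 n m (M : mat_cat K 1 n, V).
suff h : bimap (mat_hcomp K 1 n q) (idm (M : mat_cat K 1 n)) (mat_assoc_iso V W X) \o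
     cmp (row_phcomp (mat_hcomp K n m p (V, W)) X) M \o
     (idm (mat_hcomp K 1 p q (mat_hcomp K 1 n p
       (M : mat_cat K 1 n, mat_hcomp K n m p (V, W)), X)) \o
       bimap (mat_hcomp K 1 p q) (cmp (row_phcomp V W) M) (idm X)) =
    cmp (row_phcomp V (mat_hcomp K m p q (W, X))) M \o
     (cmp (row_phcomp W X) N \o
       bimap (mat_hcomp K 1 p q) (bimap (mat_hcomp K 1 m p) (idm N) (idm W))
         (idm X)) \o
     idm (mat_hcomp K 1 p q (mat_hcomp K 1 m p (N, W), X)) by exact h.
rewrite (row_phcompE _ X M) (row_phcompE V W M) (row_phcompE V _ M)
  (row_phcompE W X N).
rewrite comp1m compm1 !bimap1 compm1; exact: (esym (mat_pentagon M V W X)).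
Qed.

(** At a row [M] this is the triangle law for [M] and [V], with the right unitor of [M] moved to the
    other side. *)
Lemma row_plunit n m (V : mat_cat K n m) :
  fmap (row_hom n m) (mat_lunit_iso V) \o row_phcomp (@mat_unit K n) V
    \o (row_punit n \Dia idm (row_hom n m V)) =
  lunit (row_hom n m V).
Proof.
apply: cmp_eq => M; pose N := mat_hcomp K 1 n m (M : mat_cat K 1 n, V).
suff h : bimap (mat_hcomp K 1 n m) (idm (M : mat_cat K 1 n)) (mat_lunit_iso V) \o
     cmp (row_phcomp (@mat_unit K n) V) M \o
     (idm (mat_hcomp K 1 n m (mat_hcomp K 1 n n (M : mat_cat K 1 n, @mat_unit K n),
       V)) \o
       bimap (mat_hcomp K 1 n m) (cmp (row_punit n) M) (idm V)) = idm N by exact h.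
rewrite (row_phcompE _ V M) (row_punitE M) comp1m mat_triangle -bimapM fwdK comp1m.
exact: bimap1.
Qed.

(** At a row [M] this is the law for the right unitor of a composite, a consequence of the
    bicategory axioms and not one of them; it is verified on generators. *)
Lemma row_prunit n m (V : mat_cat K n m) :
  fmap (row_hom n m) (mat_runit_iso V) \o row_phcomp V (@mat_unit K m)
    \o (idm (row_hom n m V) \Dia row_punit m) =
  runit (row_hom n m V).
Proof.
apply: cmp_eq => M; pose N := mat_hcomp K 1 n m (M : mat_cat K 1 n, V).
suff h : bimap (mat_hcomp K 1 n m) (idm (M : mat_cat K 1 n)) (mat_runit_iso V) \o
     cmp (row_phcomp V (@mat_unit K m)) M \o (cmp (row_punit m) N \o idm N) =
       idm N by exact h.
rewrite (row_phcompE V _ M) (row_punitE N) compm1.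
apply: mat_eq => i j; apply: lfun_ext2 => k a v /=.
by rewrite !comp_lfunE mat_runitVE mat_assocE !(dmapE, tmapE) mat_runitE unit_etaK
  scale1r !id_lfunE.
Qed.

Definition row_pseudofunctor : pseudofunctor (Vect2 K) B' :=
  @Pseudofunctor (Vect2 K) B' row_ob row_hom row_phcomp row_punit
    row_phcomp_nat row_passoc row_plunit row_prunit.

End RowPseudofunctor.

(** * Full faithfulness on 2-cells, by evaluation at unit rows *)

Section RowLocal.
Variable K : fieldType.

Section Hat.
Variable n : nat.

Definition unit_row (i : 'I_n) : mat_cat K 1 n := fun _ => @mat_unit K n i.

Section HatMor.
Variables (M : mat_cat K 1 n) (i : 'I_n) (x : M ord0 i).

Let hat_entry_linear k :
  linear (fun a : unit_entry K i k => (unit_eps K i k a : K) *: dproj k (dinj i x)).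
Proof. by move=> c a b; rewrite linearP scalerDl scalerA. Qed.

(* It maps the generator of the [i]-th unit row to [x]: [dproj k (dinj i x)] is
   [x] cast to [M ord0 k] if [k = i], and 0 otherwise. *)
Definition hat : mor (unit_row i) M :=
  row_mor (M := unit_row i) (fun k => linfun (fun a : unit_entry K i k =>
    (unit_eps K i k a : K) *: dproj k (dinj i x))).

Lemma hatE k a : hat ord0 k a = (unit_eps K i k a : K) *: dproj k (dinj i x).
Proof. by rewrite /hat row_morE linfunE //; apply: hat_entry_linear. Qed.

Lemma hatK a : hat ord0 i a = (unit_eps K i i a : K) *: x.
Proof. by rewrite hatE dprojK. Qed.

Lemma hat_eta : hat ord0 i (unit_eta K i i 1) = x.
Proof. by rewrite hatK unit_etaK scale1r. Qed.

End HatMor.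

Lemma hat_linear (M : mat_cat K 1 n) i c (x y : M ord0 i) k l :
  hat (c *: x + y) k l = c *: hat x k l + hat y k l.
Proof.
rewrite (ord1 k); apply/lfunP => a; rewrite !lfun_simp !hatE dinj_linear.
by rewrite dprojD dprojZ scalerDr !scalerA mulrC.
Qed.

Lemma hat_comp (M N : mat_cat K 1 n) (f : mor M N) i (x : M ord0 i) :
  f \o hat x = hat (f ord0 i x).
Proof.
apply: mat_eq => k l; rewrite (ord1 k); apply/lfunP => a /=.
rewrite comp_lfunE !hatE linearZ /=; have [il|il] := eqVneq i l.
  by case: _ / il a => a; rewrite !dprojK.
by rewrite !dproj_inj // linear0.
Qed.

End Hat.

Lemma hat_hcomp n m (W : mat_cat K n m) (M : mat_cat K 1 n) i j (x : M ord0 i)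
    (y : dsum (fun k => tensor (@mat_unit K n i k) (W k j))) :
  bimap (mat_hcomp K 1 n m) (hat x) (idm W) ord0 j y =
    dinj i (pure x (mat_lunit W i j y)).
Proof.
have -> : dinj i (pure x (mat_lunit W i j y)) =
    (linfun (dinj i) \o linfun (pure x) \o mat_lunit W i j)%VF y
    :> dsum (fun k => tensor (M ord0 k) (W k j)).
  rewrite !comp_lfunE (linfunE (@dinj_linear _ _ _ i)).
  by rewrite (linfunE (pure_linear_r x)).
congr (fun_of_lfun _ y); apply: lfun_ext2 => k a w.
rewrite !comp_lfunE /= dmapE tmapE id_lfunE.
have [ik|ik] := eqVneq i k; last first.
  by rewrite (unit_entry0 a ik) linear0 !pure0l !dinj0 !linear0.
case: _ / ik a w => a w; rewrite hatK mat_lunitE (linfunE (@dinj_linear _ _ _ i)).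
by rewrite (linfunE (pure_linear_r x)) pureZl pureZr.
Qed.

Lemma row_hom_faithful n m : faithful (row_hom K n m).
Proof.
move=> V W a b ab; apply: mat_eq => i j; apply/lfunP => v.
have := congr1 (fun c : modtrans (row_functor V) (row_functor W) =>
  mat_lunit W i j ((c : nat_trans _ _) (unit_row i) ord0 j (mat_lunitV V i j v))) ab.
rewrite /= !mat_lunitVE !dmapE !tmapE !id_lfunE !mat_lunitE unit_etaK !scale1r.
by [].
Qed.

(** The matrix is read off at the unit rows. Each generator [dinj k (pure x v)] over [M] comes from
    the [k]-th unit row along [hat x], so naturality at [hat x] determines the value of the
    transformation there. *)
Lemma row_hom_full n m : full (row_hom K n m).
Proof.
move=> V W al.
pose al0 := (al : modtrans (row_functor V) (row_functor W)).
pose a : @mor (mat_cat K n m) V W := fun i j =>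
  (mat_lunit W i j \o (al0 (unit_row i) ord0 j \o mat_lunitV V i j))%VF.
exists a; apply: modtrans_eq => M; apply: mat_eq => i j; rewrite (ord1 i).
apply: lfun_ext2 => k x v /=.
rewrite dmapE tmapE id_lfunE !comp_lfunE.
have nt := natural al0 (hat x).
have := congr1 (fun f : mor (row_functor V (unit_row k)) (row_functor W M) =>
   f ord0 j (mat_lunitV V k j v)) nt.
rewrite /= !comp_lfunE mat_lunitVE dmapE tmapE id_lfunE hat_eta => ->.
by rewrite -mat_lunitVE; exact: (esym (hat_hcomp _ _)).
Qed.

End RowLocal.

(** * Linearity and representability of module functors *)

Section ModuleFunctorLinear.
Variables (K : fieldType) (n m : nat).
Variable H : modfunctor (row_modcat K n) (row_modcat K m).

(* With [X = K^2] and [f = u (x) e_1 + v (x) e_2], a linear form [xi] on [X]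
   yields a linear combination of [u] and [v]; its image under [H] is linear in
   [xi] because [H] passes through [mstr H]. *)
Lemma modfunctor_form (M N : row_modcat K n) (X : Vect K)
    (f : mor M (N \box X)) (xi : @mor (Vect K) X (mone (m := Vect K))) :
  fmap H (aunit N \o (idm N \Box xi) \o f) =
  aunit (H N) \o (idm (H N) \Box xi) \o mstr H N X \o fmap H f.
Proof.
by rewrite !fmapM -mstr_unit -!compA (compA (mstr H N _)) mstr_nat fmap1 -!compA.
Qed.

Lemma modfunctor_linear (M N : mat_cat K 1 n) c (u v w : mor M N) :
    (forall i j, w i j = c *: u i j + v i j) ->
  forall i j, fmap H w i j = c *: fmap H u i j + fmap H v i j.
Proof.
move=> wE.
pose X : vectType K := (K^o * K^o)%type.
pose f : mor M (row_act K n (N, X)) := fun i j =>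
  ((linfun (fun y : N i j => pure y ((1, 0) : X)) \o u i j) +
   (linfun (fun y : N i j => pure y ((0, 1) : X)) \o v i j))%VF.
have fE i j y : f i j y = pure (u i j y) ((1, 0) : X) + pure (v i j y) ((0, 1) : X).
  rewrite /f add_lfunE !comp_lfunE.
  by rewrite !(linfunE (pure_linear_l _)).
pose form (a b : K) (x : X) : K^o := a * x.1 + b * x.2.
have form_lin a b : linear (form a b).
  move=> d [x1 x2] [y1 y2].
  suff: a * (d * x1 + y1) + b * (d * x2 + y2) =
    d * (a * x1 + b * x2) + (a * y1 + b * y2) :> K by [].
  by rewrite !mulrDr !(mulrCA _ d) addrACA.
pose xi a b : 'Hom(X, K^o) := linfun (form a b).
have xiE a b x : xi a b x = form a b x by rewrite /xi linfunE.
have comb (a b : K) (h : mor M N) : (forall i j, h i j = a *: u i j + b *: v i j) ->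
    h = (aunit (N : row_modcat K n) \o (idm (N : row_modcat K n) \Box xi a b) \o f).
  move=> hE; apply: mat_eq => i j; apply/lfunP => y.
  rewrite hE /= !comp_lfunE fE linearD /= !tmapE !id_lfunE linearD /= !trunitE !xiE.
  by rewrite /form /= !mulr0 !mulr1 addr0 add0r !lfun_simp.
have Hxi (a b : K) (h : mor M N) : (forall i j, h i j = a *: u i j + b *: v i j) ->
    forall i j y, fmap H h i j y =
      trunit _ (tmap \1%VF (xi a b) (mstr H N X i j (fmap H f i j y))).
  move=> hE i j y; rewrite (comb a b h hE) modfunctor_form.
  by rewrite /= !comp_lfunE.
move=> i j; apply/lfunP => y; rewrite add_lfunE scale_lfunE.
(* The form [(c, 1)], which produces [w], is [c] times [(1, 0)], which produces [u], plus [(0, 1)],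
   which produces [v]. *)
have xi_lin t : trunit (fob H N i j) (tmap \1%VF (xi c 1) t) =
    c *: trunit (fob H N i j) (tmap \1%VF (xi 1 0) t) +
      trunit (fob H N i j) (tmap \1%VF (xi 0 1) t).
  move: t; apply: tensor_eq => [s t|s t|b x].
  - by rewrite !linearD.
  - by rewrite !linearD /= addrACA.
  rewrite !tmapE !trunitE !id_lfunE !xiE /form !(mul0r, mul1r, addr0, add0r).
  by rewrite scalerDl scalerA.
rewrite (Hxi c 1 w) ?(Hxi 1 0 u) ?(Hxi 0 1 v) //.
- by move=> k l; rewrite scale0r add0r scale1r.
- by move=> k l; rewrite scale0r addr0 scale1r.
- by move=> k l; rewrite scale1r.
Qed.

Lemma modfunctor_sum (M N : mat_cat K 1 n) (I : Type) (r : seq I) (f : I -> mor M N)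
    (w : mor M N) :
    (forall i j, w i j = \sum_(t <- r) f t i j) ->
  forall i j, fmap H w i j = \sum_(t <- r) fmap H (f t) i j.
Proof.
elim: r w => [|t r IH] w wE i j.
  (* The zero morphism satisfies [w = - w + w]; linearity with [c = -1] then shows that its image is
     zero. *)
  rewrite big_nil (@modfunctor_linear M N (-1) w w w) ?scaleN1r ?addNr // => k l.
  by rewrite wE big_nil scaler0 addr0.
pose w' : mor M N := fun i j => \sum_(s <- r) f s i j.
rewrite big_cons -(IH w') // (@modfunctor_linear M N 1 (f t) w' w) ?scale1r // => k l.
by rewrite wE big_cons scale1r.
Qed.

End ModuleFunctorLinear.

(** * Representing a module functor by a matrix *)

Section RowRepresentation.
Variables (K : fieldType) (n m : nat).
Variable H : modfunctor (row_modcat K n) (row_modcat K m).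

Lemma modfunctor_scale (M N : mat_cat K 1 n) c (u w : mor M N) :
  (forall i j, w i j = c *: u i j) -> forall i j, fmap H w i j = c *: fmap H u i j.
Proof.
move=> wE i j; pose o : mor M N := fun _ _ => 0.
have -> : fmap H w i j = c *: fmap H u i j + fmap H o i j.
  by apply: modfunctor_linear => k l; rewrite wE addr0.
have oE k l : o k l = \sum_(t <- [::]) (fun _ : unit => o) t k l by rewrite big_nil.
by rewrite (modfunctor_sum H oE) big_nil addr0.
Qed.

Definition rep : mat_cat K n m := fun i j => fob H (unit_row K i) ord0 j.

(** Linearity in [x] is the automatic linearity of [H] on morphisms, applied to [hat]. *)
Let psi_bilin (M : mat_cat K 1 n) j i :
  bilin (fun (x : M ord0 i) (v : rep i j) => fmap H (hat x) ord0 j v).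
Proof.
split=> [v c x y|x]; last exact: lfun_linear.
have h := modfunctor_linear H (hat_linear c x y).
by rewrite h add_lfunE scale_lfunE.
Qed.

Definition psi (M : mat_cat K 1 n) : mor (row_functor rep M) (H M) :=
  row_mor (M := mat_hcomp K 1 n m (M, rep)) (N := fob H M)
    (fun j => dlift (fun i => tlift (fun x v => fmap H (hat x) ord0 j v))).

Lemma psiE (M : mat_cat K 1 n) j i (x : M ord0 i) (v : rep i j) :
  psi M ord0 j (dinj i (pure x v)) = fmap H (hat x) ord0 j v.
Proof.
rewrite /psi row_morE dliftE; last by move=> k; exact: lfun_linear.
by rewrite tliftE //; exact: psi_bilin.
Qed.

Lemma psi_nat (M N : row_modcat K n) (f : mor M N) :
  psi N \o fmap (row_functor rep) f = fmap H f \o psi M.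
Proof.
apply: mat_eq => i j; rewrite (ord1 i); apply: lfun_ext2 => k x v /=.
rewrite !comp_lfunE dmapE tmapE id_lfunE !psiE -hat_comp fmapM.
by rewrite /= comp_lfunE.
Qed.

(** Factoring through the action of [K] on the unit row reduces [psi_str] to naturality of [mstr H]
    and its unit law. *)
Lemma hat_pure (M : row_modcat K n) (X : vectType K) k (a : M ord0 k) (x : X) :
  hat (M := row_act K n (M, X)) (pure a x) =
  (bimap (row_act K n) (hat a) (linfun (fun c : K^o => (c : K) *: x)) \o
    bwd (aunit (unit_row K k : row_modcat K n))).
Proof.
have xlin : linear (fun c : K^o => (c : K) *: x).
  by move=> c b d; rewrite scalerDl scalerA.
apply: mat_eq => i j; rewrite (ord1 i); apply/lfunP => b.
rewrite /= comp_lfunE trunitVE tmapE (linfunE xlin) scale1r !hatE.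
have [kj|kj] := eqVneq k j.
  by case: _ / kj b => b; rewrite !dprojK pureZl.
by rewrite !dproj_inj // !scaler0 pure0l.
Qed.

Lemma psi_str (M : row_modcat K n) (X : Vect K) :
  mstr H M X \o psi (M \box X) = (psi M \Box idm X) \o mstr (row_functor rep) M X.
Proof.
apply: mat_eq => i j; rewrite (ord1 i); apply: lfun_ext3 => k a x v /=.
rewrite !comp_lfunE row_strE tmapE id_lfunE !psiE hat_pure.
set lx := linfun _.
have e : (mstr H M X \o fmap H (bimap (row_act K n) (hat a) lx \o
    bwd (aunit (unit_row K k : row_modcat K n)))) =
    (fmap H (hat a) \Box (lx : @mor (Vect K) (mone (m := Vect K)) X)) \o
      bwd (aunit (H (unit_row K k))).
  rewrite fmapM compA (mstr_nat H (hat a) lx) -compA; congr (_ \o _).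
  apply: (iso_mono (f := aunit (H (unit_row K k)))).
  by rewrite fwdK compA mstr_unit -fmapM fwdK fmap1.
have := congr1 (fun f : mor (fob H (unit_row K k)) (H M \box X) => f ord0 j v) e.
rewrite /= !comp_lfunE trunitVE tmapE => ->.
rewrite /lx linfunE ?scale1r // => c b d.
by rewrite scalerDl scalerA.
Qed.

Section Coordinates.
Variable M : mat_cat K 1 n.

Local Notation e i := (vbasis (fullv : {vspace M ord0 i})).
Local Notation d i := (\dim (fullv : {vspace M ord0 i})).

(** The dual of [hat]: a coordinate of the [i]-th entry, viewed as a morphism to the unit row.
    Together with the [hat] of basis vectors, these exhibit [M] as a finite direct sum of unit
    rows. *)
Definition coord_mor i (b : 'I_(d i)) :
    mor M (unit_row K i) :=
  row_mor (N := unit_row K i) (fun k => linfun (fun y : M ord0 k =>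
    coord (e i) b (dproj i (dinj k y)) *: unit_eta K i k 1)).

Lemma coord_morE i b k y :
  coord_mor b ord0 k y = coord (e i) b (dproj i (dinj k y)) *: unit_eta K i k 1.
Proof.
rewrite /coord_mor row_morE linfunE // => c u v.
by rewrite dinj_linear dprojD dprojZ linearP scalerDl scalerA.
Qed.

Definition psiV j : 'Hom(fob H M ord0 j, row_functor rep M ord0 j) :=
  \sum_i \sum_(b < d _) (linfun (fun v : rep i j =>
    dinj (V := fun i => tensor (M ord0 i) (rep i j)) i (pure (e i)`_b v)) \o
    fmap H (coord_mor b) ord0 j)%VF.

Lemma psiVE j y : psiV j y = \sum_i \sum_(b < d _)
  dinj (V := fun i => tensor (M ord0 i) (rep i j)) i
    (pure (e i)`_b (fmap H (coord_mor b) ord0 j y)).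
Proof.
rewrite /psiV sum_lfunE; apply: eq_bigr => i _; rewrite sum_lfunE.
apply: eq_bigr => b _; rewrite comp_lfunE linfunE // => c u v.
by rewrite pure_linear_r dinj_linear.
Qed.

(** The identity of [M] is the sum of the composites of [coord_mor b] with the [hat] of the [b]-th
    basis vector, over all entries, and [H] preserves sums. *)
Lemma psiVK j : (psi M ord0 j \o psiV j = \1)%VF.
Proof.
apply/lfunP => y; rewrite comp_lfunE psiVE linear_sum id_lfunE /=.
(* The sum is taken in two stages since the range of [b] depends on [i]. *)
pose q i : mor M M := fun k l => \sum_(b < d _) (hat (e i)`_b \o coord_mor b) k l.
have qE : forall k l, idm M k l = \sum_i q i k l.
  move=> k l; rewrite (ord1 k); apply/lfunP => x; rewrite id_lfunE sum_lfunE.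
  rewrite (bigD1 l) //= big1 ?addr0 => [|i il].
  - rewrite /q sum_lfunE [LHS](coord_vbasis (memvf x)); apply: eq_bigr => b _.
    by rewrite comp_lfunE coord_morE dprojK linearZ /= hatK unit_etaK scale1r.
  - rewrite /q sum_lfunE big1 // => b _.
    by rewrite comp_lfunE hatE dproj_inj // scaler0.
have H1 := modfunctor_sum H qE ord0 j.
rewrite fmap1 in H1.
rewrite -[RHS](id_lfunE y) -[\1%VF]/(idm (fob H M) ord0 j) H1 sum_lfunE.
apply: eq_bigr => i _; rewrite linear_sum /=.
have q_sum k l : q i k l = \sum_(b < d _) (hat (e i)`_b \o coord_mor b) k l by [].
rewrite (modfunctor_sum H q_sum) sum_lfunE; apply: eq_bigr => b _.
by rewrite psiE fmapM /= comp_lfunE.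
Qed.

Lemma coord_hat i (b : 'I_(d i)) (x : M ord0 i) k l :
  (coord_mor b \o hat x) k l = coord (e i) b x *: idm (unit_row K i) k l.
Proof.
rewrite (ord1 k); apply/lfunP => a /=.
rewrite comp_lfunE coord_morE hatE scale_lfunE id_lfunE.
have [il|il] := eqVneq i l; last by rewrite (unit_entry0 a il)
  (unit_entry0 (unit_eta K i l 1) il) !scaler0.
case: _ / il a => a; rewrite !dprojK linearZ /=.
rewrite [X in X *: _](_ : _ = coord (e i) b x * unit_eps K i i a); last exact: mulrC.
rewrite -scalerA; congr (_ *: _); rewrite -linearZ -[RHS]unit_epsK.
by congr (fun_of_lfun _ _); exact: mulr1.
Qed.

(** Vanishing is phrased as being [0] times itself, the form in which [modfunctor_scale] shows that
    [H] sends this composite to zero. *)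
Lemma coord_hat_neq i (b : 'I_(d i)) h (x : M ord0 h) k l : i != h ->
  (coord_mor b \o hat x) k l = 0 *: (coord_mor b \o hat x) k l.
Proof.
move=> ih; rewrite scale0r (ord1 k); apply/lfunP => a /=.
rewrite comp_lfunE coord_morE hatE lfun_simp.
have [hl|hl] := eqVneq h l; last by rewrite (dproj_inj _ hl) scaler0 dinj0 dproj0
  linear0 scale0r.
by case: _ / hl a => a; rewrite (dproj_inj _ (_ : h != i)) 1?eq_sym // linear0
  scale0r.
Qed.

(** On the entry of [x], [coord_mor b \o hat x] is a coordinate of [x] times the identity, and it
    vanishes between different entries; what remains after [H] is the expansion of [x] in the
    basis. *)
Lemma psiK j : (psiV j \o psi M ord0 j = \1)%VF.
Proof.
apply: lfun_ext2 => k x v; rewrite comp_lfunE psiE psiVE id_lfunE.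
have HH i (b : 'I_(d i)) : fmap H (coord_mor b) ord0 j (fmap H (hat x) ord0 j v) =
    fmap H (coord_mor b \o hat x) ord0 j v by rewrite fmapM /= comp_lfunE.
rewrite (bigD1 k) //= [X in _ + X]big1 ?addr0 => [|i ik].
- have lin : linear (fun u : M ord0 k => dinj
  (V := fun i => tensor (M ord0 i) (rep i j))
      k (pure u v)) by move=> c u w; rewrite pure_linear_l dinj_linear.
  rewrite [in RHS](coord_vbasis (memvf x)) -(linfunE lin) linear_sum /=.
  apply: eq_bigr => b _; rewrite HH (modfunctor_scale (coord_hat b x)) fmap1.
  by rewrite scale_lfunE id_lfunE linearZ /= linfunE // pureZr dinjZ.
- rewrite big1 // => b _; rewrite HH.
  rewrite (modfunctor_scale (fun k l => coord_hat_neq b x k l ik)) scale0r lfun_simp.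
  by rewrite pure0r dinj0.
Qed.

End Coordinates.

Definition psi_trans : modtrans (row_functor rep) H :=
  ModTrans (mtrans := NatTrans (F := row_functor rep) (G := H) (ncomp := psi) psi_nat)
    psi_str.

Lemma psi_is_iso (M : row_modcat K n) : is_iso (psi_trans M).
Proof.
pose g : @mor (mat_cat K 1 m) (H M) (row_functor rep M) :=
  row_mor (M := fob H M) (psiV M).
exists g; split; apply: mat_eq => i j; rewrite (ord1 i) /=.
- by rewrite /g row_morE psiK.
- by rewrite /g row_morE psiVK.
Qed.

End RowRepresentation.

Lemma row_hom_ess_surjective (K : fieldType) n m : ess_surjective (row_hom K n m).
Proof.
move=> H; exists (rep H).
by have [i _] := modtrans_iso (a := psi_trans H) (@psi_is_iso K n m H); constructor.
Qed.

Theorem theorem1p2 (K : fieldType) :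
  exists (F : pseudofunctor (Vect2 K) (ModVect2 K))
         (G : pseudofunctor (ModVect2 K) (Vect2 K)),
    (exists eta : nat_2trans (comp_pseudofunctor G F)
                             (id_pseudofunctor (Vect2 K)),
       is_nat_2iso eta) /\
    (exists eps : nat_2trans (comp_pseudofunctor F G)
                             (id_pseudofunctor (ModVect2 K)),
       is_nat_2iso eps).
Proof.
exists (row_pseudofunctor K); apply: biequivalence_of_local_equivalence.
- exact: row_hom_full.
- exact: row_hom_faithful.
- exact: row_hom_ess_surjective.
(* The object [c] comes with a strong [G] from [K^n]-modules to [c]; preceded by the passage from
   rows to modules, it is the required equivalence. *)
- move=> c; have [n [T [G [_ sG qT]]]] := mdcP c; have qG := quasi_inverse_sym qT.
  exists n, (comp_modfunctor (row_mod_modfunctor K n) G).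
  apply: strong_equiv_comp; split.
  + exact (@row_mod_strong K n).
  + exact (@row_mod_full K n).
  + exact (@row_mod_faithful K n).
  + exact (@row_mod_ess_surjective K n).
  + exact sG.
  + exact (quasi_inverse_full qG).
  + exact (quasi_inverse_faithful qG).
  + exact (quasi_inverse_ess_surjective qG).
Qed.
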